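(* Let $S$ be an integer and let $a\in\mathbb{C}$, where $a\notin\mathbb{Z}$ if $S\ge 1$. Let $z$ be complex with $|z|>1$ and $|\arg(1+z)|\le\pi$. Then $$\Phi(-z,S,a)=\frac{2\pi i}{z^{a}}\sum_{n=0}^{S-1}\frac{b_n}{\Gamma(S-n)\,(\ln z)^{n-S+1}}-\sum_{n=1}^{\infty}\frac{(-z)^{-n}}{(a-n)^S},$$ where the first sum (the whole first term) is zero if $S$ is a non-positive integer, and where $b_n$ are the Taylor coefficients at $t=0$ of $\frac{i}{2}\csc\bigl(\pi(t-a)\bigr)=\frac{i}{2\sin \pi(t-a)}=\sum_{n=0}^\infty b_n t^n$.
   Context: The Lerch transcendent is $\Phi(z,s,a)=\sum_{n=0}^\infty \frac{z^n}{(a+n)^s}$ for $|z|<1$, and is defined elsewhere by analytic continuation in $z$; its principal branch is taken on the sector $|\arg(1-z)|<\pi$. If $s$ is a positive integer then $a\ne0,-1,-2,\dots$ is required; if $s$ is a non-positive integer then $a$ may be any complex number. Thus $\Phi(-z,S,a)$ has its principal branch on $|\arg(1+z)|<\pi$; on the boundary $|\arg(1+z)|=\pi$ (i.e. $z<-1$, $\arg z=\pm\pi$) it denotes the continuous limiting value from the corresponding side of the cut. Here $\ln z=\ln|z|+i\arg z$ with $\arg z\in[-\pi,\pi]$ and $z^a=e^{a\ln z}$. *)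

(* Defs.v *)
From Stdlib Require Import Reals ZArith ClassicalEpsilon.
From Coquelicot Require Import Coquelicot.

Open Scope C_scope.

Definition Cexp (z : C) : C :=
  ((exp (Re z) * cos (Im z))%R, (exp (Re z) * sin (Im z))%R).

Definition Csin (z : C) : C := (Cexp (Ci * z) - Cexp (- (Ci * z))) / (2 * Ci).

(* As [/ 0 = 0] here, [1 / Cpowz x S] is the polynomial [x ^ (- S)] for every
   [x], including [x = 0], when [S <= 0]. *)
Definition Cpowz (x : C) (k : Z) : C :=
  match k with
  | Z0 => 1
  | Zpos p => x ^ Pos.to_nat p
  | Zneg p => / (x ^ Pos.to_nat p)
  end.

(* The range of the argument is left free: on a cut, the choice between the
   arguments [PI] and [- PI] records the side. *)
Definition is_arg (w : C) (phi : R) : Prop :=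
  w <> 0 /\ w = Cmod w * Cexp (Ci * phi).

(* The logarithm and the powers of [z] for the choice [theta] of [arg z]. *)
Definition Cln (z : C) (theta : R) : C := ln (Cmod z) + Ci * theta.

Definition Cpower (z : C) (theta : R) (a : C) : C := Cexp (a * Cln z theta).

(* Euler's integral, meaningful for [0 < x]. *)
Definition Gamma (x : R) : R :=
  RInt_gen (fun t : R => Rpower t (x - 1) * exp (- t))%R
    (at_right 0) (Rbar_locally p_infty).

Definition is_taylor (f : C -> C) (z0 : C) (c : nat -> C) : Prop :=
  exists r : R, (0 < r)%R /\
    forall w : C, (Cmod (w - z0) < r)%R ->
      @is_pseries C_AbsRing C_NormedModule c (w - z0) (f w).

Definition analytic_at (f : C -> C) (z0 : C) : Prop :=
  exists c : nat -> C, is_taylor f z0 c.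

(* Arbitrary if [f] is not analytic at [z0]. *)
Definition taylor_coef (f : C -> C) (z0 : C) : nat -> C :=
  epsilon (inhabits (fun _ : nat => RtoC 0)) (is_taylor f z0).

Definition lerch_sector (z : C) : Prop :=
  exists phi : R, is_arg (1 - z) phi /\ (Rabs phi < PI)%R.

(* By the identity theorem this determines [F] on [lerch_sector], and only
   there. *)
Definition is_lerch_branch (s : Z) (a : C) (F : C -> C) : Prop :=
  (forall z : C, (Cmod z < 1)%R ->
     @is_series C_AbsRing C_NormedModule
       (fun n : nat => z ^ n / Cpowz (a + INR n) s) (F z)) /\
  (forall z : C, lerch_sector z -> analytic_at F z).

(* Principal branch; arbitrary outside [lerch_sector]. *)
Definition Lerch (z : C) (s : Z) (a : C) : C :=
  epsilon (inhabits (fun _ : C => RtoC 0)) (is_lerch_branch s a) z.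

(* [v] is the value of the transcendent at the point [z] of the sector closed by
   the two sides of its cut, where [phi] is the argument of [1 - z].  On the cut
   ([phi = PI] or [phi = - PI]) it is the limit over the [w] for which
   [Im (1 - w)] has the sign of [phi]. *)
Definition is_Lerch (z : C) (phi : R) (s : Z) (a v : C) : Prop :=
  if Rlt_dec (Rabs phi) PI then Lerch z s a = v
  else filterlim (fun w : C => Lerch w s a)
         (within (fun w : C => (0 < phi * Im (1 - w))%R) (locally z))
         (locally v).

(* Main.v *)
Require Import Defs.
From Stdlib Require Import Reals ZArith Lra Lia Classical ClassicalEpsilon.
From Coquelicot Require Import Coquelicot.
Open Scope C_scope.
Bind Scope C_scope with C.

(** For [S <= 0] and, in the right half-plane of [a], for [S >= 1] the transcendent is
    explicit: the operator [a + x d/dx] iterated on [1 / (1 - x)], respectively the iterated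
    Mellin transform of [t |-> 1 / (1 - x t)] on [0, 1], which expands around every
    point of the sector uniformly in [t]; the recursion [a -> a + 1] then removes the
    restriction on [a].  The identity theorem along segments from [0] makes the
    branch unique, so that [(a + x d/dx) Phi_S = Phi_(S-1)] on the whole sector,
    and the exterior series satisfies the same equation.

    In the variable [L = ln z], the function
    [U_S = z ^ a (Phi (- z, S, a) + exterior series)] on the half-strip
    [0 < Re L], [|Im L| < PI] hence has derivative [U_(S-1)], and [U_0 = 0].  So
    [U_S] vanishes for [S <= 0] and is [sum_(j < S) q_j L ^ (S-1-j) / (S-1-j)!]
    for [S >= 1].  For [S >= 2] all series converge uniformly up to the unit
    circle, where [U_S] is a bilateral Fourier series: its values at
    [L = i PI] and [L = - i PI] agree up to the factor [exp (2 i PI a)], and for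
    [S = 2] its zeroth Fourier coefficient is [1 / a ^ 2].  These conditions say
    that [sum_j q_j t ^ j] times [exp (i PI (t - a)) - exp (- i PI (t - a))] is the
    constant [- 2 i PI], i.e. that [q_j = 2 i PI b_j]. *)

(** * Complex series *)

(** The coefficients [q_j] do not depend on [S]: raising [S] integrates once more in [L] and adds
    one constant of integration. This settles [S = 1], whose series do not converge absolutely on
    the unit circle: its constant [q_0] is read off at [S = 2]. Periodicity at order [S >= 2] kills
    the coefficient of [t ^ (S - 1)] in the product with the sine; these conditions are homogeneous,
    so the Fourier coefficient must supply the scale, that is the coefficient of [t ^ 0]. The sign
    in [- 2 i PI] comes from [i / (2 sin u) = - 1 / (exp (i u) - exp (- i u))]. Since [Lerch] is an
    epsilon choice, a branch must be exhibited for every [S] and [a]; integrals over [0, 1] reach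
    the whole sector at once, without continuation from disc to disc. The cut comes last: the
    right-hand side, as a function of [L], is differentiable across [Im L = PI] and [Im L = - PI],
    so its value there is the one-sided limit. *)

Definition cseries (u : nat -> C) (l : C) : Prop :=
  @is_series C_AbsRing C_NormedModule u l.

(** The upper bound is excluded, unlike in [sum_n], so that the empty sum is available to inductions
    and to remainders [l - psum u N]. *)
Fixpoint psum (u : nat -> C) (n : nat) : C :=
  match n with O => 0 | S n => psum u n + u n end.

Lemma psum_S (u : nat -> C) (n : nat) : psum u (S n) = psum u n + u n.
Proof. reflexivity. Qed.

Lemma sum_n_psum (u : nat -> C) (n : nat) :
  @sum_n C_AbelianMonoid u n = psum u (S n).
Proof.
induction n as [|n IH].
- rewrite sum_O; simpl; ring.
- rewrite sum_Sn, IH; reflexivity.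
Qed.

Lemma psum_ext (u v : nat -> C) (n : nat) :
  (forall k, (k < n)%nat -> u k = v k) -> psum u n = psum v n.
Proof.
induction n as [|n IH]; intros H; simpl; [reflexivity|].
rewrite IH, H by (intros; try apply H; lia); reflexivity.
Qed.

Lemma psum_plus (u v : nat -> C) (n : nat) :
  psum (fun k => u k + v k) n = psum u n + psum v n.
Proof. induction n as [|n IH]; simpl; [|rewrite IH]; ring. Qed.

Lemma psum_scal (c : C) (u : nat -> C) (n : nat) :
  psum (fun k => c * u k) n = c * psum u n.
Proof. induction n as [|n IH]; simpl; [|rewrite IH]; ring. Qed.

Lemma psum_zero (n : nat) : psum (fun _ => 0) n = 0.
Proof. induction n as [|n IH]; simpl; [|rewrite IH]; ring. Qed.

Lemma psum_Sn_l (u : nat -> C) (n : nat) :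
  psum u (S n) = u O + psum (fun k => u (S k)) n.
Proof. induction n as [|n IH]; [simpl; ring|].
change (psum u (S (S n))) with (psum u (S n) + u (S n)). rewrite IH; simpl; ring. Qed.

Lemma Cmod_psum (u : nat -> C) (n : nat) :
  (Cmod (psum u (S n)) <= sum_n (fun k => Cmod (u k)) n)%R.
Proof.
induction n as [|n IH].
- rewrite sum_O; simpl; rewrite Cplus_0_l; lra.
- rewrite sum_Sn. change (psum u (S (S n))) with (psum u (S n) + u (S n)).
  eapply Rle_trans; [apply Cmod_triangle|].
  unfold plus; simpl in *; lra.
Qed.

Lemma Re_le_Cmod (z : C) : (Rabs (Re z) <= Cmod z)%R.
Proof. eapply Rle_trans; [apply Rmax_l|apply (Rmax_Cmod z)]. Qed.

Lemma Im_le_Cmod (z : C) : (Rabs (Im z) <= Cmod z)%R.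
Proof. eapply Rle_trans; [apply Rmax_r|apply (Rmax_Cmod z)]. Qed.

Lemma Cmod_le_Re_Im (z : C) : (Cmod z <= Rabs (Re z) + Rabs (Im z))%R.
Proof.
destruct z as [x y]; unfold Re, Im; simpl.
replace (x, y) with (RtoC x + Ci * RtoC y)
  by (apply injective_projections; simpl; ring).
eapply Rle_trans; [apply Cmod_triangle|].
rewrite Cmod_mult, !Cmod_R.
replace (Cmod Ci) with 1%R; [lra|].
unfold Cmod; simpl. rewrite Rmult_0_l, Rplus_0_l, !Rmult_1_r; symmetry; apply sqrt_1.
Qed.

(** Balls of the product structure bound each coordinate separately, hence the factor 2 on the
    modulus. *)
Lemma ball_C (x y : C) (e : posreal) :
  ball (x : C_UniformSpace) e y -> (Cmod (y - x) < 2 * e)%R.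
Proof.
intros [H1 H2].
change (Rabs (fst y + - fst x) < e)%R in H1. change (Rabs (snd y + - snd x) < e)%R in H2.
eapply Rle_lt_trans; [apply Cmod_le_Re_Im|].
change (Rabs (fst y + - fst x) + Rabs (snd y + - snd x) < 2 * e)%R. lra.
Qed.

Lemma locally_Cmod (z : C) (P : C -> Prop) :
  locally (T := C_UniformSpace) z P <->
  exists d : R, (0 < d)%R /\ forall w : C, (Cmod (w - z) < d)%R -> P w.
Proof.
split.
- intros [e He]. exists e; split; [apply cond_pos|].
  intros w Hw; apply He. apply C_NormedModule_mixin_compat1. exact Hw.
- intros (d & Hd & H). assert (Hd2 : (0 < d / 2)%R) by lra.
  exists (mkposreal _ Hd2). intros w Hw; apply H.
  apply ball_C in Hw; simpl in Hw; lra.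
Qed.

Lemma cseries_eps (u : nat -> C) (l : C) :
  cseries u l <->
  forall e : R, (0 < e)%R ->
    exists N : nat, forall n, (N <= n)%nat -> (Cmod (psum u n - l) < e)%R.
Proof.
split.
- intros H e He.
  assert (HP : locally (T := C_UniformSpace) l (fun w => (Cmod (w - l) < e)%R)).
  { apply locally_Cmod; exists e; split; [exact He|auto]. }
  destruct (H _ HP) as [N HN]. exists (S N). intros n Hn.
  destruct n as [|n]; [lia|]. rewrite <- sum_n_psum. apply HN; lia.
- intros H P HP. apply (locally_Cmod l P) in HP. destruct HP as (d & Hd & HP).
  destruct (H d Hd) as [N HN]. exists N. intros n Hn. apply HP.
  change (Cmod (@sum_n C_AbelianMonoid u n - l) < d)%R.
  rewrite sum_n_psum. apply HN; lia.
Qed.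

Lemma cseries_unique (u : nat -> C) (l l' : C) :
  cseries u l -> cseries u l' -> l = l'.
Proof. intros H H'. exact (@filterlim_locally_unique _ _ C_NormedModule eventually _ _ _ _ H H'). Qed.

Lemma cseries_ext (u v : nat -> C) (l : C) :
  (forall n, u n = v n) -> cseries u l -> cseries v l.
Proof. intros H; apply is_series_ext; exact H. Qed.

Lemma cseries_plus (u v : nat -> C) (l m : C) :
  cseries u l -> cseries v m -> cseries (fun n => u n + v n) (l + m).
Proof. intros H1 H2; exact (is_series_plus _ _ _ _ H1 H2). Qed.

Lemma cseries_scal (c : C) (u : nat -> C) (l : C) :
  cseries u l -> cseries (fun n => c * u n) (c * l).
Proof. intros H; exact (is_series_scal c _ _ H). Qed.

Lemma cseries_incr (u : nat -> C) (l : C) :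
  cseries (fun n => u (S n)) l -> cseries u (u O + l).
Proof.
rewrite !cseries_eps; intros H e He. destruct (H e He) as [N HN].
exists (S N). intros [|n] Hn; [lia|]. rewrite psum_Sn_l.
replace (u O + psum (fun k => u (S k)) n - (u O + l))
  with (psum (fun k => u (S k)) n - l) by ring.
apply HN; lia.
Qed.

Lemma cseries_decr (u : nat -> C) (l : C) :
  cseries u l -> cseries (fun n => u (S n)) (l - u O).
Proof.
rewrite !cseries_eps; intros H e He. destruct (H e He) as [N HN].
exists N. intros n Hn. generalize (HN (S n) ltac:(lia)). rewrite psum_Sn_l.
replace (u O + psum (fun k => u (S k)) n - l)
  with (psum (fun k => u (S k)) n - (l - u O)) by ring. auto.
Qed.

Lemma cseries_Re (u : nat -> C) (l : C) :
  cseries u l -> is_series (fun n => Re (u n)) (Re l).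
Proof.
rewrite cseries_eps; intros H.
apply is_series_Reals. intros e He. destruct (H e He) as [N HN].
exists N; intros n Hn. specialize (HN (S n) ltac:(lia)).
replace (sum_f_R0 (fun k => Re (u k)) n) with (Re (psum u (S n))).
- eapply Rle_lt_trans; [|apply HN].
  eapply Rle_trans; [|apply Re_le_Cmod]. apply Req_le; reflexivity.
- clear; induction n as [|n IH]; [simpl; unfold Re; simpl; ring|].
  simpl sum_f_R0. rewrite <- IH. reflexivity.
Qed.

Lemma cseries_Im (u : nat -> C) (l : C) :
  cseries u l -> is_series (fun n => Im (u n)) (Im l).
Proof.
intros H.
assert (H' := cseries_Re _ _ (cseries_scal (- Ci) _ _ H)).
replace (Im l) with (Re (- Ci * l)) by (unfold Re, Im; simpl; ring).
eapply is_series_ext; [|exact H']. intros n; unfold Re, Im; simpl; ring.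
Qed.

(** A total sum function, built on the real [Series] of the coordinates; its value is meaningful
    only once convergence is known. *)
Definition csum (u : nat -> C) : C :=
  (Series (fun n => Re (u n)), Series (fun n => Im (u n))).

Lemma csum_unique (u : nat -> C) (l : C) : cseries u l -> csum u = l.
Proof.
intros H; unfold csum.
rewrite (is_series_unique _ _ (cseries_Re _ _ H)), (is_series_unique _ _ (cseries_Im _ _ H)).
destruct l; reflexivity.
Qed.

Lemma csum_correct (u : nat -> C) : (exists l, cseries u l) -> cseries u (csum u).
Proof. intros [l H]. rewrite (csum_unique _ _ H); exact H. Qed.

Lemma cseries_abs (u : nat -> C) (M : nat -> R) :
  (forall n, Cmod (u n) <= M n)%R -> ex_series M -> exists l, cseries u l.
Proof.
intros H HM.
apply (@ex_series_le C_AbsRing C_CompleteNormedModule u M); assumption.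
Qed.

Lemma Cmod_cseries_le (u : nat -> C) (l : C) (M : nat -> R) (m : R) :
  (forall n, Cmod (u n) <= M n)%R -> is_series M m -> cseries u l -> (Cmod l <= m)%R.
Proof.
intros H HM Hu. apply Rnot_lt_le; intros Hlt.
apply cseries_eps with (e := (Cmod l - m)%R) in Hu; [|lra].
destruct Hu as [N HN]. specialize (HN (S N) ltac:(lia)).
assert (Hb : (Cmod (psum u (S N)) <= m)%R).
{ eapply Rle_trans; [apply Cmod_psum|].
  apply Rle_trans with (sum_n M N); [apply sum_n_m_le; auto|].
  rewrite sum_n_Reals. apply is_series_Reals in HM.
  apply (sum_incr M N m); [exact HM|].
  intros n; eapply Rle_trans; [apply Cmod_ge_0|apply H]. }
assert (Ht := Cmod_triangle (psum u (S N)) (l - psum u (S N))).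
replace (psum u (S N) + (l - psum u (S N))) with l in Ht by ring.
replace (l - psum u (S N)) with (- (psum u (S N) - l)) in Ht by ring.
rewrite Cmod_opp in Ht. lra.
Qed.

Lemma cseries_tail (u : nat -> C) (l : C) (N : nat) :
  cseries u l -> cseries (fun n => u (N + n)%nat) (l - psum u N).
Proof.
intros H; induction N as [|N IH].
- replace (l - psum u 0) with l by (simpl; ring). exact H.
- apply cseries_decr in IH. simpl psum.
  replace (l - (psum u N + u N)) with (l - psum u N - u (N + 0)%nat)
    by (rewrite Nat.add_0_r; ring).
  eapply cseries_ext; [|exact IH]. intros n; simpl; f_equal; lia.
Qed.

(* Weierstrass M-test: the remainder is controlled by the majorant alone. *)
Lemma Mtest_remainder (M : nat -> R) (e : R) :
  (0 < e)%R -> ex_series M -> exists N0 : nat,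
  forall N u l, (N0 <= N)%nat -> (forall n, Cmod (u n) <= M n)%R -> cseries u l ->
    (Cmod (l - psum u N) < e)%R.
Proof.
intros He Hex. destruct (Hex : exists m : R, is_series M m) as [m HM].
assert (HM' := HM). apply is_series_Reals in HM'.
destruct (HM' e He) as [N0 HN0]. exists (S N0). intros [|N] u l HN Hu Hl; [lia|].
specialize (HN0 N ltac:(lia)). unfold R_dist in HN0.
assert (Ht : is_series (fun n => M (S N + n)%nat) (m - sum_n M N)%R).
{ apply (is_series_incr_n M (S N)); [lia|]. simpl pred.
  match goal with |- is_series _ ?x => replace x with m; [exact HM|] end.
  change (@eq R m (m - sum_n M N + sum_n M N)%R); ring. }
assert (Hb : (Cmod (l - psum u (S N)) <= m - sum_n M N)%R).
{ apply (Cmod_cseries_le (fun n => u (S N + n)%nat) _ (fun n => M (S N + n)%nat)).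
  - intros n; apply Hu.
  - exact Ht.
  - apply cseries_tail; exact Hl. }
rewrite sum_n_Reals in Hb. eapply Rle_lt_trans; [exact Hb|].
assert (Hx := Rle_abs (-(sum_f_R0 M N - m))). rewrite Rabs_Ropp in Hx. lra.
Qed.

Lemma Cmod_sub_sym (x y : C) : Cmod (x - y) = Cmod (y - x).
Proof. replace (x - y) with (- (y - x)) by ring. apply Cmod_opp. Qed.

Lemma Cmod_eps_0 (x : C) : (forall e, 0 < e -> Cmod x <= e)%R -> x = 0.
Proof.
intros H. apply Cmod_eq_0. apply Rle_antisym; [|apply Cmod_ge_0].
apply Rnot_lt_le; intros Hlt. specialize (H (Cmod x / 2)%R ltac:(lra)). lra.
Qed.

(** * Complex derivatives and the exponential *)

(** Here [C] is a module over itself, the setting of the product and chain rules; [rderiv] regards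
    [C] as a real module, for restrictions to lines and for integrals. *)
Definition cderiv (f : C -> C) (z l : C) : Prop :=
  @is_derive C_AbsRing (AbsRing_NormedModule C_AbsRing) f z l.

Definition rderiv (f : R -> C) (t : R) (l : C) : Prop :=
  @is_derive R_AbsRing C_R_NormedModule f t l.

Lemma cderiv_eps (f : C -> C) (z l : C) :
  cderiv f z l <->
  forall e : R, (0 < e)%R -> exists d : R, (0 < d)%R /\
    forall h : C, (Cmod h < d)%R -> (Cmod (f (z + h)%C - f z - l * h) <= e * Cmod h)%R.
Proof.
split.
- intros [_ H] e He.
  destruct (H z (fun P HP => HP) (mkposreal e He)) as [d Hd].
  exists d; split; [apply cond_pos|]. intros h Hh.
  specialize (Hd (z + h)).
  assert (Hs : minus (z + h) z = h) by (unfold minus, plus, opp; simpl; ring).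
  assert (Hball : @ball (AbsRing_UniformSpace C_AbsRing) z d (z + h)).
  { change (Cmod (minus (z + h)%C z) < d)%R. rewrite Hs; exact Hh. }
  specialize (Hd Hball).
  change (Cmod (f (z + h)%C - f z - (minus (z + h)%C z) * l) <= e * Cmod (minus (z + h)%C z))%R in Hd.
  rewrite Hs in Hd. replace (l * h) with (h * l) by ring. exact Hd.
- intros H. split; [apply @is_linear_scal_l|].
  intros x Hx e. assert (Hz := is_filter_lim_locally_unique _ _ Hx); rewrite <- Hz; clear x Hx Hz.
  destruct (H e (cond_pos e)) as (d & Hd & Hh).
  exists (mkposreal d Hd).
  assert (Hy : forall y : C, (Cmod (y - z) < d)%R ->
    (Cmod (f y - f z - (y - z) * l) <= e * Cmod (y - z))%R).
  { intros y Hy. specialize (Hh (y - z) Hy). replace (z + (y - z)) with y in Hh by ring.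
    replace ((y - z) * l) with (l * (y - z)) by ring. exact Hh. }
  exact Hy.
Qed.

Lemma norm_C_R (x : C_R_NormedModule) : norm x = Cmod x.
Proof.
destruct x as [x y]. unfold Cmod; simpl fst; simpl snd.
change (sqrt (Rabs x ^ 2 + Rabs y ^ 2) = sqrt (x ^ 2 + y ^ 2)).
rewrite !pow2_abs; reflexivity.
Qed.

Lemma rderiv_eps (f : R -> C) (t : R) (l : C) :
  rderiv f t l <->
  forall e : R, (0 < e)%R -> exists d : R, (0 < d)%R /\
    forall h : R, (Rabs h < d)%R -> (Cmod (f (t + h)%R - f t - l * h) <= e * Rabs h)%R.
Proof.
assert (E : forall h : R, @scal R_AbsRing C_R_NormedModule h l = l * h).
{ intros h; apply injective_projections; simpl; unfold scal; simpl; unfold mult; simpl; ring. }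
split.
- intros [_ H] e He.
  destruct (H t (fun P HP => HP) (mkposreal e He)) as [d Hd].
  exists d; split; [apply cond_pos|]. intros h Hh.
  specialize (Hd (t + h)%R).
  assert (Hs : minus (t + h)%R t = h) by (unfold minus, plus, opp; simpl; ring).
  assert (Hball : ball t d (t + h)%R).
  { change (Rabs (minus (t + h)%R t) < d)%R. rewrite Hs; exact Hh. }
  specialize (Hd Hball).
  change (@norm R_AbsRing C_R_NormedModule
    (minus (minus (f (t + h)%R) (f t)) (@scal R_AbsRing C_R_NormedModule (t + h + - t)%R l))
    <= e * Rabs (t + h + - t))%R in Hd.
  replace (t + h + - t)%R with h in Hd by ring. rewrite norm_C_R, E in Hd. exact Hd.
- intros H. split; [apply @is_linear_scal_l|].
  intros x Hx e. assert (Hz := is_filter_lim_locally_unique _ _ Hx); rewrite <- Hz; clear x Hx Hz.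
  destruct (H e (cond_pos e)) as (d & Hd & Hh).
  exists (mkposreal d Hd).
  assert (Hy : forall y : R, (Rabs (y - t) < d)%R ->
    (Cmod (f y - f t - l * (y - t)%R) <= e * Rabs (y - t))%R).
  { intros y Hy. specialize (Hh (y - t)%R Hy).
    replace (t + (y - t))%R with y in Hh by ring. exact Hh. }
  intros y Hd'. rewrite norm_C_R, E. exact (Hy y Hd').
Qed.

Lemma cderiv_local (f g : C -> C) (z l : C) (r : R) :
  (0 < r)%R -> (forall w, Cmod (w - z) < r -> f w = g w)%R ->
  cderiv f z l -> cderiv g z l.
Proof.
intros Hr Hfg Hf. apply cderiv_eps. intros e He.
destruct (proj1 (cderiv_eps _ _ _) Hf e He) as (d & Hd & H).
exists (Rmin d r); split; [apply Rmin_pos; auto|]. intros h Hh.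
assert (Hm1 := Rmin_l d r). assert (Hm2 := Rmin_r d r).
rewrite <- !Hfg.
- apply H; lra.
- replace (z - z) with (RtoC 0) by ring. rewrite Cmod_0; exact Hr.
- replace (z + h - z) with h by ring. lra.
Qed.

Lemma cderiv_ext (f g : C -> C) (z l m : C) :
  (forall w, f w = g w) -> l = m -> cderiv f z l -> cderiv g z m.
Proof. intros H <-. apply (cderiv_local f g z l 1); [lra|auto]. Qed.

(** One real increment [h] below both radii suffices: the two remainders bound [(l - m) h] by
    [e h]. *)
Lemma cderiv_unique (f : C -> C) (z l m : C) : cderiv f z l -> cderiv f z m -> l = m.
Proof.
intros H1 H2.
cut (l - m = 0); [intros H; replace l with ((l - m) + m) by ring; rewrite H; ring|].
apply Cmod_eps_0. intros e He.
destruct (proj1 (cderiv_eps _ _ _) H1 (e / 2)%R ltac:(lra)) as (d1 & Hd1 & K1).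
destruct (proj1 (cderiv_eps _ _ _) H2 (e / 2)%R ltac:(lra)) as (d2 & Hd2 & K2).
assert (Hd : (0 < Rmin d1 d2)%R) by (apply Rmin_pos; auto).
set (h := (Rmin d1 d2 / 2)%R).
assert (Hh : (0 < h)%R) by (unfold h; lra).
assert (Hc : Cmod (RtoC h) = h) by (rewrite Cmod_R; apply Rabs_pos_eq; lra).
assert (Hm1 := Rmin_l d1 d2). assert (Hm2 := Rmin_r d1 d2).
specialize (K1 (RtoC h) ltac:(rewrite Hc; unfold h; lra)).
specialize (K2 (RtoC h) ltac:(rewrite Hc; unfold h; lra)).
assert (K : (Cmod ((l - m) * h) <= e * h)%R).
{ replace ((l - m) * h) with ((f (z + h)%C - f z - m * h) - (f (z + h)%C - f z - l * h)) by ring.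
  eapply Rle_trans; [apply Cmod_triangle|]. rewrite Cmod_opp. rewrite Hc in *. lra. }
rewrite Cmod_mult, Hc in K. apply Rmult_le_reg_r with h; lra.
Qed.

Lemma cderiv_cont (f : C -> C) (z l : C) : cderiv f z l ->
  forall e : R, (0 < e)%R -> exists d : R, (0 < d)%R /\
    forall w : C, (Cmod (w - z) < d)%R -> (Cmod (f w - f z) < e)%R.
Proof.
intros H e He.
destruct (proj1 (cderiv_eps _ _ _) H 1%R ltac:(lra)) as (d & Hd & K).
assert (Hl := Cmod_ge_0 l).
exists (Rmin d (e / (Cmod l + 2))); split.
{ apply Rmin_pos; [exact Hd|]. apply Rdiv_lt_0_compat; lra. }
intros w Hw.
assert (H1 : (Cmod (w - z) < d)%R) by (eapply Rlt_le_trans; [exact Hw|apply Rmin_l]).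
assert (H2 : (Cmod (w - z) < e / (Cmod l + 2))%R) by (eapply Rlt_le_trans; [exact Hw|apply Rmin_r]).
specialize (K _ H1). replace (z + (w - z)) with w in K by ring.
replace (f w - f z) with ((f w - f z - l * (w - z)) + l * (w - z)) by ring.
eapply Rle_lt_trans; [apply Cmod_triangle|]. rewrite Cmod_mult.
apply Rle_lt_trans with ((Cmod l + 1) * Cmod (w - z))%R; [lra|].
apply Rle_lt_trans with ((Cmod l + 1) * (e / (Cmod l + 2)))%R.
- apply Rmult_le_compat_l; lra.
- apply Rmult_lt_reg_r with (Cmod l + 2)%R; [lra|]. field_simplify; [nra|lra].
Qed.

Lemma cderiv_const (c z : C) : cderiv (fun _ => c) z 0.
Proof. apply @is_derive_const. Qed.

Lemma cderiv_id (z : C) : cderiv (fun w => w) z 1.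
Proof. apply @is_derive_id. Qed.

Lemma cderiv_plus (f g : C -> C) (z l m : C) :
  cderiv f z l -> cderiv g z m -> cderiv (fun w => f w + g w) z (l + m).
Proof. intros H1 H2; exact (is_derive_plus _ _ _ _ _ H1 H2). Qed.

Lemma cderiv_mult (f g : C -> C) (z l m : C) :
  cderiv f z l -> cderiv g z m -> cderiv (fun w => f w * g w) z (l * g z + f z * m).
Proof. intros H1 H2; exact (is_derive_mult _ _ _ _ _ H1 H2 Cmult_comm). Qed.

Lemma cderiv_scal (c : C) (f : C -> C) (z l : C) :
  cderiv f z l -> cderiv (fun w => c * f w) z (c * l).
Proof.
intros H. eapply cderiv_ext; [reflexivity| |apply (cderiv_mult _ _ _ _ _ (cderiv_const c z) H)].
ring.
Qed.

Lemma cderiv_opp (f : C -> C) (z l : C) :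
  cderiv f z l -> cderiv (fun w => - f w) z (- l).
Proof.
intros H. apply (cderiv_ext (fun w => - (1) * f w) _ _ (- (1) * l)); [intros; ring|ring|].
apply cderiv_scal; exact H.
Qed.

Lemma cderiv_comp (f g : C -> C) (z l m : C) :
  cderiv f (g z) l -> cderiv g z m -> cderiv (fun w => f (g w)) z (m * l).
Proof. intros H1 H2; exact (is_derive_comp _ _ _ _ _ H1 H2). Qed.

Lemma cderiv_line (f : C -> C) (z d l : C) (t : R) :
  cderiv f (z + t * d) l -> rderiv (fun s : R => f (z + s * d)) t (l * d).
Proof.
intros H. apply rderiv_eps. intros e He.
assert (Hd := Cmod_ge_0 d).
assert (He' : (0 < e / (Cmod d + 1))%R) by (apply Rdiv_lt_0_compat; lra).
destruct (proj1 (cderiv_eps _ _ _) H _ He') as (r & Hr & K).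
exists (r / (Cmod d + 1))%R; split; [apply Rdiv_lt_0_compat; lra|].
intros h Hh.
assert (Hhd : Cmod (h * d) = (Rabs h * Cmod d)%R) by (rewrite Cmod_mult, Cmod_R; reflexivity).
assert (Hh0 := Rabs_pos h).
assert (Hlt : (Cmod (h * d) < r)%R).
{ rewrite Hhd. apply Rle_lt_trans with (Rabs h * (Cmod d + 1))%R; [nra|].
  apply Rmult_lt_reg_r with (/ (Cmod d + 1))%R; [apply Rinv_0_lt_compat; lra|].
  rewrite Rmult_assoc, Rinv_r by lra. unfold Rdiv in Hh; lra. }
specialize (K _ Hlt).
replace (z + (t + h)%R * d) with (z + t * d + h * d) by (rewrite RtoC_plus; ring).
replace (l * d * h) with (l * (h * d)) by ring.
eapply Rle_trans; [exact K|]. rewrite Hhd.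
replace (e / (Cmod d + 1) * (Rabs h * Cmod d))%R
  with (e * Rabs h * (Cmod d / (Cmod d + 1)))%R by (field; lra).
rewrite <- (Rmult_1_r (e * Rabs h)) at 2. apply Rmult_le_compat_l; [nra|].
apply Rmult_le_reg_r with (Cmod d + 1)%R; [lra|]. field_simplify; lra.
Qed.

(** Along the segment only one real variable is left, with derivative zero. Convexity of the domain
    thus replaces an argument on connected open sets. *)
Lemma cderiv_zero_segment (f : C -> C) (z w : C) :
  (forall t : R, (0 <= t <= 1)%R -> cderiv f (z + t * (w - z)) 0) -> f w = f z.
Proof.
intros H.
assert (K := eq_is_derive (V := C_R_NormedModule) (fun s : R => f (z + s * (w - z))) 0 1).
replace w with (z + 1%R * (w - z)) by ring.
replace (f z) with (f (z + 0%R * (w - z))) by (f_equal; ring).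
replace (z + 1%R * (w - z)) with (z + RtoC 1 * (w - z)) by reflexivity.
symmetry; apply K; [|lra].
intros t Ht. specialize (H t Ht). apply cderiv_line in H.
rewrite Cmult_0_l in H. exact H.
Qed.

(** * The complex exponential *)

Lemma Cexp_plus (z w : C) : Cexp (z + w) = Cexp z * Cexp w.
Proof.
destruct z as [a b], w as [c d]. unfold Cexp, Re, Im; simpl.
rewrite exp_plus, cos_plus, sin_plus.
apply injective_projections; simpl; ring.
Qed.

Lemma Cexp_0 : Cexp 0 = 1.
Proof.
unfold Cexp, Re, Im; simpl. rewrite exp_0, cos_0, sin_0.
apply injective_projections; simpl; ring.
Qed.

Lemma Cexp_opp_l (z : C) : Cexp (- z) * Cexp z = 1.
Proof. rewrite <- Cexp_plus. replace (- z + z) with (RtoC 0) by ring. apply Cexp_0. Qed.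

Lemma Cexp_neq_0 (z : C) : Cexp z <> 0.
Proof. intros H. assert (E := Cexp_opp_l z). rewrite H in E.
rewrite Cmult_0_r in E. apply RtoC_inj in E. lra. Qed.

Lemma Cexp_opp (z : C) : Cexp (- z) = / Cexp z.
Proof.
assert (H := Cexp_neq_0 z). rewrite <- (Cmult_1_l (/ Cexp z)), <- (Cexp_opp_l z).
field; exact H.
Qed.

Lemma Cmod_Cexp (z : C) : Cmod (Cexp z) = exp (Re z).
Proof.
unfold Cexp, Cmod; simpl fst; simpl snd.
replace ((exp (Re z) * cos (Im z)) ^ 2 + (exp (Re z) * sin (Im z)) ^ 2)%R
  with ((exp (Re z)) ^ 2)%R.
- apply sqrt_pow2, Rlt_le, exp_pos.
- assert (E := sin2_cos2 (Im z)). unfold Rsqr in E.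
  replace ((exp (Re z) * cos (Im z)) ^ 2 + (exp (Re z) * sin (Im z)) ^ 2)%R with
   (exp (Re z) ^ 2 * (sin (Im z) * sin (Im z) + cos (Im z) * cos (Im z)))%R by ring.
  rewrite E; ring.
Qed.

Lemma Cexp_pow (z : C) (n : nat) : Cexp z ^ n = Cexp (INR n * z).
Proof.
induction n as [|n IH]; [simpl; rewrite Cmult_0_l, Cexp_0; reflexivity|].
rewrite Cpow_S, IH, <- Cexp_plus, S_INR, RtoC_plus. f_equal; ring.
Qed.

Lemma Cexp_Ci (t : R) : Cexp (Ci * t) = (cos t, sin t).
Proof.
unfold Cexp, Re, Im; simpl. replace (0 * t - 1 * 0)%R with 0%R by ring.
replace (0 * 0 + 1 * t)%R with t by ring. rewrite exp_0.
apply injective_projections; simpl; ring.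
Qed.

Lemma derive_0_remainder (f : R -> R) (l e : R) :
  derivable_pt_lim f 0 l -> (0 < e)%R ->
  exists d, (0 < d)%R /\ forall h, (Rabs h < d -> Rabs (f h - f 0 - l * h) <= e * Rabs h)%R.
Proof.
intros H He. destruct (H e He) as [d Hd]. exists d; split; [apply cond_pos|].
intros h Hh. destruct (Req_dec h 0) as [->|Hn].
{ replace (f 0 - f 0 - l * 0)%R with 0%R by ring. rewrite Rabs_R0; lra. }
specialize (Hd h Hn Hh). rewrite Rplus_0_l in Hd.
replace (f h - f 0 - l * h)%R with (((f h - f 0) / h - l) * h)%R by (field; auto).
rewrite Rabs_mult. apply Rmult_le_compat_r; [apply Rabs_pos|lra].
Qed.

Lemma cderiv_Cexp_0 : cderiv Cexp 0 1.
Proof.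
apply cderiv_eps; intros e He.
assert (D1 : derivable_pt_lim exp 0 1) by (rewrite <- exp_0; apply derivable_pt_lim_exp).
assert (D2 : derivable_pt_lim cos 0 0).
{ replace 0%R with (- sin 0)%R at 2 by (rewrite sin_0; ring). apply derivable_pt_lim_cos. }
assert (D3 : derivable_pt_lim sin 0 1) by (rewrite <- cos_0; apply derivable_pt_lim_sin).
(* Each coordinate of the remainder will be at most [3 e' m], so [6 e' <= e] is what counts. The
   bound [e' <= 1], with increments below [e' / 2], gives [Rabs (exp x - 1) <= e'] and
   [exp x <= 2]. *)
set (e' := (Rmin (e / 10) 1)%R).
assert (He' : (0 < e')%R) by (apply Rmin_pos; lra).
assert (Hee : (e' <= e / 10)%R) by apply Rmin_l.
assert (He1 : (e' <= 1)%R) by apply Rmin_r.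
destruct (derive_0_remainder _ _ _ D1 He') as (d1 & Hd1 & K1).
destruct (derive_0_remainder _ _ _ D2 He') as (d2 & Hd2 & K2).
destruct (derive_0_remainder _ _ _ D3 He') as (d3 & Hd3 & K3).
exists (Rmin (Rmin d1 d2) (Rmin d3 (e' / 2)))%R; split.
{ repeat apply Rmin_pos; lra. }
intros [x y] Hh.
assert (Hx := Re_le_Cmod (x, y)). assert (Hy := Im_le_Cmod (x, y)).
unfold Re, Im in Hx, Hy; simpl in Hx, Hy.
set (m := Cmod (x, y)) in *.
assert (M1 := Rmin_l (Rmin d1 d2) (Rmin d3 (e' / 2))). assert (M2 := Rmin_r (Rmin d1 d2) (Rmin d3 (e' / 2))).
assert (M3 := Rmin_l d1 d2). assert (M4 := Rmin_r d1 d2).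
assert (M5 := Rmin_l d3 (e' / 2)). assert (M6 := Rmin_r d3 (e' / 2)).
specialize (K1 x ltac:(lra)). specialize (K2 y ltac:(lra)). specialize (K3 y ltac:(lra)).
rewrite exp_0 in K1. rewrite cos_0 in K2. rewrite sin_0 in K3.
rewrite Cplus_0_l, Cexp_0, Cmult_1_l.
eapply Rle_trans; [apply Cmod_le_Re_Im|]. unfold Cexp, Re, Im; simpl.
assert (Hxp := Rabs_pos x). assert (Hyp := Rabs_pos y).
assert (Hex : (Rabs (exp x - 1) <= e')%R).
{ replace (exp x - 1)%R with ((exp x - 1 - 1 * x) + x)%R by ring.
  eapply Rle_trans; [apply Rabs_triang|]. nra. }
assert (Hex2 : (Rabs (exp x) <= 2)%R).
{ replace (exp x) with ((exp x - 1) + 1)%R by ring.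
  eapply Rle_trans; [apply Rabs_triang|]. rewrite (Rabs_pos_eq 1) by lra. lra. }
assert (A1 : (Rabs (exp x * cos y + - (1) + - x) <= 3 * e' * m)%R).
{ replace (exp x * cos y + - (1) + - x)%R with ((exp x - 1 - 1 * x) + exp x * (cos y - 1 - 0 * y))%R by ring.
  eapply Rle_trans; [apply Rabs_triang|]. rewrite Rabs_mult.
  assert (Rabs (exp x) * Rabs (cos y - 1 - 0 * y) <= 2 * (e' * m))%R.
  { apply Rmult_le_compat; try apply Rabs_pos; nra. }
  nra. }
assert (A2 : (Rabs (exp x * sin y + - 0 + - y) <= 3 * e' * m)%R).
{ replace (exp x * sin y + - 0 + - y)%R with (exp x * (sin y - 0 - 1 * y) + (exp x - 1) * y)%R by ring.
  eapply Rle_trans; [apply Rabs_triang|]. rewrite !Rabs_mult.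
  assert (Rabs (exp x) * Rabs (sin y - 0 - 1 * y) <= 2 * (e' * m))%R.
  { apply Rmult_le_compat; try apply Rabs_pos; nra. }
  assert (Rabs (exp x - 1) * Rabs y <= e' * m)%R.
  { apply Rmult_le_compat; try apply Rabs_pos; nra. }
  lra. }
assert (Hm : (0 <= m)%R) by (unfold m; apply Cmod_ge_0).
nra.
Qed.

Lemma cderiv_Cexp (z : C) : cderiv Cexp z (Cexp z).
Proof.
apply cderiv_ext with (f := fun w => Cexp z * Cexp (w + - z)) (l := Cexp z * ((1 + 0) * 1)).
- intros w. rewrite <- Cexp_plus. f_equal; ring.
- ring.
- apply cderiv_scal, (cderiv_comp Cexp (fun w => w + - z)).
  + rewrite Cplus_opp_r. apply cderiv_Cexp_0.
  + apply cderiv_plus; [apply cderiv_id|apply cderiv_const].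
Qed.

Lemma cderiv_Cexp_scal (c z : C) : cderiv (fun w => Cexp (c * w)) z (c * Cexp (c * z)).
Proof.
eapply cderiv_ext; [reflexivity| |apply (cderiv_comp Cexp (fun w => c * w))].
2: apply cderiv_Cexp. 2: apply cderiv_scal, cderiv_id. ring.
Qed.

(** * Power series *)

Lemma pow_n_Cpow (z : C) (n : nat) : @pow_n C_Ring z n = z ^ n.
Proof. induction n as [|n IH]; simpl; [|rewrite IH]; reflexivity. Qed.

Lemma is_taylor_cseries (f : C -> C) (z0 : C) (c : nat -> C) :
  is_taylor f z0 c <->
  exists r : R, (0 < r)%R /\ forall w : C, (Cmod (w - z0) < r)%R ->
    cseries (fun n => c n * (w - z0) ^ n) (f w).
Proof.
assert (E : forall w n, scal (@pow_n C_Ring (w - z0) n) (c n) = c n * (w - z0) ^ n).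
{ intros w n; rewrite pow_n_Cpow. apply Cmult_comm. }
split; intros (r & Hr & H); exists r; (split; [exact Hr|]); intros w Hw;
  specialize (H w Hw).
- eapply cseries_ext; [|exact H]. intros n; apply E.
- unfold is_pseries. eapply is_series_ext; [|exact H]. intros n; symmetry; apply E.
Qed.

Lemma cseries_bounded (u : nat -> C) (l : C) :
  cseries u l -> exists M : R, forall n, (Cmod (u n) <= M)%R.
Proof.
intros H.
destruct (@filterlim_bounded C_AbsRing C_NormedModule (sum_n u) (ex_intro _ l H)) as [M HM].
exists (2 * M)%R. intros n.
assert (HM' : forall n, (Cmod (psum u (S n)) <= M)%R).
{ intros k. rewrite <- sum_n_psum. exact (HM k). }
assert (H0 := HM' O). assert (Hp := Cmod_ge_0 (psum u 1)).
destruct n as [|n].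
- simpl in *. rewrite Cplus_0_l in *. lra.
- replace (u (S n)) with (psum u (S (S n)) - psum u (S n)) by (simpl; ring).
  eapply Rle_trans; [apply Cmod_triangle|]. rewrite Cmod_opp.
  assert (H1 := HM' n). assert (H2 := HM' (S n)). lra.
Qed.

(** The terms of a convergent series are bounded. This hands complex power series over to the theory
    of the radius for the real series of moduli. *)
Lemma CV_radius_Cmod (c : nat -> C) (z l : C) :
  cseries (fun n => c n * z ^ n) l ->
  Rbar_le (Cmod z) (CV_radius (fun n => Cmod (c n))).
Proof.
intros H. destruct (cseries_bounded _ _ H) as [M HM].
apply CV_radius_bounded. exists M. intros n.
specialize (HM n). rewrite Cmod_mult, Cmod_pow in HM.
rewrite Rabs_pos_eq; [exact HM|].
apply Rmult_le_pos; [apply Cmod_ge_0|apply pow_le, Cmod_ge_0].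
Qed.

(** The remainder [e] of one exponent yields that of the next as [(h + k) e + n k ^ 2 h ^ (n - 1)],
    with [n] the former exponent. The constant is twice the optimal one, so as to match the
    coefficients of the twice differentiated series. *)
Lemma cpow_remainder (h k : C) (rho : R) (j : nat) :
  (Cmod h <= rho)%R -> (Cmod (h + k) <= rho)%R ->
  (Cmod ((h + k) ^ (S (S j)) - h ^ (S (S j)) - INR (S (S j)) * k * h ^ (S j)) <=
   (INR (S j) * INR (S (S j))) * rho ^ j * Cmod k ^ 2)%R.
Proof.
intros Hh Hk.
assert (Hr : (0 <= rho)%R) by (eapply Rle_trans; [apply Cmod_ge_0|exact Hh]).
induction j as [|j IH].
- replace ((h + k) ^ 2 - h ^ 2 - INR 2 * k * h ^ 1) with (k ^ 2)
    by (simpl; rewrite RtoC_plus; ring).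
  rewrite Cmod_pow. simpl. nra.
- set (e := (h + k) ^ S (S j) - h ^ S (S j) - INR (S (S j)) * k * h ^ S j) in *.
  replace ((h + k) ^ S (S (S j)) - h ^ S (S (S j)) - INR (S (S (S j))) * k * h ^ S (S j))
    with ((h + k) * e + INR (S (S j)) * (k ^ 2 * h ^ S j)).
  2: { unfold e. rewrite (S_INR (S (S j))), RtoC_plus. simpl; ring. }
  eapply Rle_trans; [apply Cmod_triangle|].
  rewrite !Cmod_mult, !Cmod_pow, Cmod_R, (Rabs_pos_eq (INR _)) by apply pos_INR.
  assert (Hp : (0 <= rho ^ S j)%R) by (apply pow_le; exact Hr).
  assert (Hq : (Cmod h ^ S j <= rho ^ S j)%R)
    by (apply pow_incr; split; [apply Cmod_ge_0|exact Hh]).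
  assert (Hk2 : (0 <= Cmod k ^ 2)%R) by (apply pow_le, Cmod_ge_0).
  apply Rle_trans with (rho * (INR (S j) * INR (S (S j)) * rho ^ j * Cmod k ^ 2)
     + INR (S (S j)) * (Cmod k ^ 2 * rho ^ S j))%R.
  + apply Rplus_le_compat.
    * apply Rmult_le_compat; [apply Cmod_ge_0|apply Cmod_ge_0|exact Hk|exact IH].
    * apply Rmult_le_compat_l; [apply pos_INR|]. apply Rmult_le_compat_l; assumption.
  + rewrite (S_INR (S (S j))), (S_INR (S j)). set (n := INR (S j)).
    assert (Hn : (0 <= n)%R) by apply pos_INR.
    replace (rho ^ S j)%R with (rho * rho ^ j)%R in * by reflexivity.
    set (P := (rho * rho ^ j)%R) in *.
    replace (rho * (n * (n + 1) * rho ^ j * Cmod k ^ 2))%R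
      with (n * (n + 1) * (P * Cmod k ^ 2))%R by (unfold P; ring).
    assert (0 <= P * Cmod k ^ 2)%R by (apply Rmult_le_pos; assumption).
    nra.
Qed.

(** Summing [cpow_remainder] over the terms bounds the error of the termwise derivative by
    [K * Cmod k ^ 2], where [K] is the sum of the twice differentiated series of moduli at [rho]. *)
Lemma cpower_series_deriv (c : nat -> C) (f : C -> C) (r : R) :
  (forall h, (Cmod h < r)%R -> cseries (fun n => c n * h ^ n) (f h)) ->
  forall h, (Cmod h < r)%R ->
    exists l, cseries (fun n => INR (S n) * c (S n) * h ^ n) l /\ cderiv f h l.
Proof.
intros Hf h Hh.
(* Two radii between [Cmod h] and [r]: convergence at [rho'] puts [rho] strictly inside the disc of
   absolute convergence, and the increments stay within [rho]. *)
set (rho := ((Cmod h + r) / 2)%R). set (rho' := ((rho + r) / 2)%R).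
assert (Hh0 := Cmod_ge_0 h).
assert (H1 : (Cmod h < rho < rho')%R) by (unfold rho', rho; lra).
assert (H2 : (rho' < r)%R) by (unfold rho', rho; lra).
set (a := fun n => Cmod (c n)).
assert (Hcv : Rbar_lt rho (CV_radius a)).
{ apply Rbar_lt_le_trans with rho'; [simpl; lra|].
  assert (E : Cmod (RtoC rho') = rho') by (rewrite Cmod_R; apply Rabs_pos_eq; lra).
  rewrite <- E. apply (CV_radius_Cmod c (RtoC rho') (f (RtoC rho'))).
  apply Hf. rewrite E. exact H2. }
assert (Hrho : Rabs rho = rho) by (apply Rabs_pos_eq; lra).
assert (Hex1 : ex_series (fun n => Rabs (PS_derive a n * rho ^ n))).
{ apply CV_disk_inside. rewrite CV_radius_derive, Hrho. exact Hcv. }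
assert (Hex2 : exists K : R, is_series (fun n => Rabs (PS_derive (PS_derive a) n * rho ^ n)) K).
{ apply CV_disk_inside. rewrite !CV_radius_derive, Hrho. exact Hcv. }
destruct Hex2 as [K HK].
assert (Hl : exists l, cseries (fun n => INR (S n) * c (S n) * h ^ n) l).
{ eapply cseries_abs; [|exact Hex1]. intros n.
  rewrite !Cmod_mult, Cmod_pow, Cmod_R. rewrite Rabs_mult.
  unfold PS_derive, a. rewrite Rabs_mult, (Rabs_pos_eq (Cmod _)) by apply Cmod_ge_0.
  apply Rmult_le_compat_l.
  { apply Rmult_le_pos; [apply Rabs_pos|apply Cmod_ge_0]. }
  rewrite <- RPow_abs, Hrho. apply pow_incr; lra. }
destruct Hl as [l Hl]. exists l; split; [exact Hl|].
apply cderiv_eps. intros e He.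
assert (HK0 : (0 <= K)%R).
{ apply (Rle_trans _ (Cmod 0)); [rewrite Cmod_0; lra|].
  apply (Cmod_cseries_le (fun _ => 0) 0 _ K) with (2 := HK).
  - intros n; rewrite Cmod_0; apply Rabs_pos.
  - apply cseries_eps; intros e' He'; exists O; intros n _. rewrite psum_zero.
    replace (0 - 0) with (RtoC 0) by ring. rewrite Cmod_0; exact He'. }
exists (Rmin (rho - Cmod h) (e / (K + 1))); split.
{ apply Rmin_pos; [lra|apply Rdiv_lt_0_compat; lra]. }
intros k Hk.
assert (Hk1 : (Cmod k < rho - Cmod h)%R) by (eapply Rlt_le_trans; [exact Hk|apply Rmin_l]).
assert (Hk2 : (Cmod k < e / (K + 1))%R) by (eapply Rlt_le_trans; [exact Hk|apply Rmin_r]).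
assert (Hhk : (Cmod (h + k) <= rho)%R) by (eapply Rle_trans; [apply Cmod_triangle|lra]).
assert (S1 : cseries (fun m => c (S m) * ((h + k) ^ S m - h ^ S m - INR (S m) * k * h ^ m))
               (f (h + k) - f h - l * k)).
{ assert (A1 := cseries_decr _ _ (Hf (h + k) ltac:(lra))).
  assert (A2 := cseries_decr _ _ (Hf h Hh)).
  assert (A3 := cseries_plus _ _ _ _ A1 (cseries_plus _ _ _ _
    (cseries_scal (- (1)) _ _ A2) (cseries_scal (- k) _ _ Hl))).
  match type of A3 with cseries _ ?v => replace (f (h + k) - f h - l * k) with v end.
  - eapply cseries_ext; [|exact A3]. intros n; cbv beta. ring.
  - simpl; ring. }
apply cseries_decr in S1.
replace (f (h + k) - f h - l * k - c 1%nat * ((h + k) ^ 1 - h ^ 1 - INR 1 * k * h ^ 0))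
  with (f (h + k) - f h - l * k) in S1 by (simpl; ring).
apply Rle_trans with (Cmod k ^ 2 * K)%R.
- apply (Cmod_cseries_le _ _ (fun n => Cmod k ^ 2 * Rabs (PS_derive (PS_derive a) n * rho ^ n))%R
    _) with (3 := S1).
  + intros n. rewrite Cmod_mult.
    rewrite Rabs_pos_eq.
    2:{ unfold PS_derive, a. apply Rmult_le_pos; [|apply pow_le; lra].
        apply Rmult_le_pos; [apply pos_INR|]. apply Rmult_le_pos; [apply pos_INR|apply Cmod_ge_0]. }
    unfold PS_derive, a.
    replace (Cmod k ^ 2 * (INR (S n) * (INR (S (S n)) * Cmod (c (S (S n)))) * rho ^ n))%R
     with (Cmod (c (S (S n))) * (INR (S n) * INR (S (S n)) * rho ^ n * Cmod k ^ 2))%R by ring.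
    apply Rmult_le_compat_l; [apply Cmod_ge_0|]. apply cpow_remainder; lra.
  + exact (is_series_scal (K := R_AbsRing) (V := R_NormedModule) (Cmod k ^ 2)%R _ _ HK).
- replace (Cmod k ^ 2 * K)%R with (Cmod k * K * Cmod k)%R by ring.
  apply Rmult_le_compat_r; [apply Cmod_ge_0|].
  assert (Hkk := Cmod_ge_0 k).
  apply Rle_trans with (e / (K + 1) * K)%R; [apply Rmult_le_compat_r; lra|].
  apply Rmult_le_reg_r with (K + 1)%R; [lra|]. field_simplify; nra.
Qed.

Lemma cseries_pow_0 (c : nat -> C) : cseries (fun n => c n * 0 ^ n) (c O).
Proof.
apply cseries_eps. intros e He. exists 1%nat. intros [|n] Hn; [lia|].
rewrite psum_Sn_l. rewrite (psum_ext _ (fun _ => 0)).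
- rewrite psum_zero. simpl. replace (c O * 1 + 0 - c O) with (RtoC 0) by ring.
  rewrite Cmod_0; exact He.
- intros k _. simpl; ring.
Qed.

Lemma cseries_pow_scal (c : nat -> C) (h l : C) : h <> 0 ->
  cseries (fun n => c n * h ^ n) l ->
  cseries (fun n => c (S n) * h ^ n) ((l - c O) / h).
Proof.
intros Hh H. apply cseries_decr in H. apply (cseries_scal (/ h)) in H.
replace ((l - c O) / h) with (/ h * (l - c O * h ^ 0)) by (simpl; field; exact Hh).
eapply cseries_ext; [|exact H]. intros n; cbv beta. simpl; field; exact Hh.
Qed.

(** Zeros accumulating at the centre force [c 0 = 0] by continuity; then [f h / h] has the shifted
    coefficients and the same nonzero zeros, which drives the induction. *)
Lemma power_series_zeros (n : nat) : forall (c : nat -> C) (f : C -> C) (r : R),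
  (0 < r)%R ->
  (forall h, (Cmod h < r)%R -> cseries (fun n => c n * h ^ n) (f h)) ->
  (forall e, (0 < e)%R -> exists h : C, h <> 0 /\ (Cmod h < e)%R /\ f h = 0) ->
  c n = 0.
Proof.
assert (H0 : forall (c : nat -> C) (f : C -> C) (r : R),
  (0 < r)%R ->
  (forall h, (Cmod h < r)%R -> cseries (fun n => c n * h ^ n) (f h)) ->
  (forall e, (0 < e)%R -> exists h : C, h <> 0 /\ (Cmod h < e)%R /\ f h = 0) -> c O = 0).
{ intros c f r Hr Hf Hz.
  destruct (cpower_series_deriv c f r Hf 0) as (l & _ & Hl); [rewrite Cmod_0; exact Hr|].
  assert (E0 : f 0 = c O).
  { apply (cseries_unique (fun n => c n * 0 ^ n)); [|apply cseries_pow_0].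
    apply Hf; rewrite Cmod_0; exact Hr. }
  rewrite <- E0. apply Cmod_eps_0. intros e He.
  destruct (cderiv_cont _ _ _ Hl e He) as (d & Hd & K).
  destruct (Hz d Hd) as (h & _ & Hh & Hfh).
  specialize (K h). replace (h - 0) with h in K by ring. specialize (K Hh).
  rewrite Hfh in K. replace (0 - f 0) with (- f 0) in K by ring.
  rewrite Cmod_opp in K. lra. }
induction n as [|n IH]; intros c f r Hr Hf Hz; [exact (H0 c f r Hr Hf Hz)|].
assert (Hc0 := H0 c f r Hr Hf Hz).
(* The value [c 1] at the origin removes the singularity of the quotient. *)
apply (IH (fun n => c (S n)) (fun h => if Ceq_dec h 0 then c 1%nat else f h / h) r Hr).
- intros h Hh. destruct (Ceq_dec h 0) as [->|Hn].
  + exact (cseries_pow_0 (fun n => c (S n))).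
  + replace (f h / h) with ((f h - c O) / h) by (rewrite Hc0; field; exact Hn).
    apply cseries_pow_scal; auto.
- intros e He. destruct (Hz e He) as (h & Hn & Hh & Hfh). exists h; repeat split; auto.
  destruct (Ceq_dec h 0) as [?|_]; [contradiction|]. rewrite Hfh. field; exact Hn.
Qed.

Lemma is_taylor_plus (f g : C -> C) (z : C) (c d : nat -> C) :
  is_taylor f z c -> is_taylor g z d ->
  is_taylor (fun w => f w + g w) z (fun n => c n + d n).
Proof.
rewrite !is_taylor_cseries; intros (r & Hr & H1) (s & Hs & H2).
exists (Rmin r s); split; [apply Rmin_pos; auto|]. intros w Hw.
assert (M1 := Rmin_l r s). assert (M2 := Rmin_r r s).
eapply cseries_ext; [|apply cseries_plus; [apply H1|apply H2]; lra].
intros n; cbv beta; ring.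
Qed.

Lemma is_taylor_scal (a : C) (f : C -> C) (z : C) (c : nat -> C) :
  is_taylor f z c -> is_taylor (fun w => a * f w) z (fun n => a * c n).
Proof.
rewrite !is_taylor_cseries; intros (r & Hr & H). exists r; split; [exact Hr|].
intros w Hw. eapply cseries_ext; [|apply cseries_scal, H, Hw]. intros n; cbv beta; ring.
Qed.

Lemma is_taylor_const (a z : C) :
  is_taylor (fun _ => a) z (fun n => match n with O => a | S _ => 0 end).
Proof.
apply is_taylor_cseries. exists 1%R; split; [lra|]. intros w _.
apply cseries_eps. intros e He. exists 1%nat. intros [|n] Hn; [lia|].
rewrite psum_Sn_l, (psum_ext _ (fun _ => 0)), psum_zero.
- simpl. replace (a * 1 + 0 - a) with (RtoC 0) by ring. rewrite Cmod_0; exact He.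
- intros k _; ring.
Qed.

Lemma is_taylor_mul_id (f : C -> C) (z : C) (c : nat -> C) :
  is_taylor f z c ->
  is_taylor (fun w => w * f w) z
    (fun n => z * c n + match n with O => 0 | S m => c m end).
Proof.
rewrite !is_taylor_cseries; intros (r & Hr & H). exists r; split; [exact Hr|].
intros w Hw. specialize (H w Hw).
replace (w * f w) with (z * f w + (w - z) * f w) by ring.
eapply cseries_ext; [|apply cseries_plus; [apply (cseries_scal z), H|]].
2: { set (d := fun n => match n with O => 0 | S m => c m end * (w - z) ^ n).
  replace ((w - z) * f w) with (d O + (w - z) * f w) by (unfold d; ring).
  apply cseries_incr. eapply cseries_ext; [|apply (cseries_scal (w - z)), H].
  intros n; unfold d; cbv beta. simpl; ring. }
intros n; cbv beta; ring.
Qed.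

Lemma is_taylor_deriv (f g : C -> C) (z : C) (c : nat -> C) (s : R) :
  is_taylor f z c -> (0 < s)%R ->
  (forall w, (Cmod (w - z) < s)%R -> cderiv f w (g w)) ->
  is_taylor g z (fun n => INR (S n) * c (S n)).
Proof.
rewrite !is_taylor_cseries; intros (r & Hr & H) Hs Hg.
exists (Rmin r s); split; [apply Rmin_pos; auto|]. intros w Hw.
assert (M1 := Rmin_l r s). assert (M2 := Rmin_r r s).
destruct (cpower_series_deriv c (fun h => f (z + h)) r) with (h := w - z) as (l & Hl & Hd).
- intros h Hh. specialize (H (z + h)).
  replace (z + h - z) with h in H by ring. exact (H Hh).
- lra.
- replace (g w) with l; [exact Hl|].
  apply (cderiv_unique f w); [|apply Hg; lra].
  assert (K := cderiv_comp (fun h => f (z + h)) (fun v => v + - z) w l (1 + 0)).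
  eapply cderiv_ext; [| |apply K].
  + intros v; cbv beta; f_equal; ring.
  + ring.
  + exact Hd.
  + apply cderiv_plus; [apply cderiv_id|apply cderiv_const].
Qed.

Lemma is_taylor_cderiv (f : C -> C) (z : C) (c : nat -> C) :
  is_taylor f z c -> exists r, (0 < r)%R /\
    forall w, (Cmod (w - z) < r)%R -> exists l, cderiv f w l.
Proof.
rewrite is_taylor_cseries; intros (r & Hr & H).
exists r; split; [exact Hr|]. intros w Hw.
destruct (cpower_series_deriv c (fun h => f (z + h)) r) with (h := w - z) as (l & Hl & Hd).
- intros h Hh. specialize (H (z + h)).
  replace (z + h - z) with h in H by ring. exact (H Hh).
- lra.
- exists ((1 + 0) * l).
  assert (K := cderiv_comp (fun h => f (z + h)) (fun v => v + - z) w l (1 + 0)).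
  eapply cderiv_ext; [| |apply K].
  + intros v; cbv beta; f_equal; ring.
  + reflexivity.
  + exact Hd.
  + apply cderiv_plus; [apply cderiv_id|apply cderiv_const].
Qed.

Lemma is_taylor_unique (f : C -> C) (z : C) (c d : nat -> C) :
  is_taylor f z c -> is_taylor f z d -> forall n, c n = d n.
Proof.
intros H1 H2 n.
assert (H := is_taylor_plus _ _ _ _ _ H1 (is_taylor_scal (- (1)) _ _ _ H2)).
apply is_taylor_cseries in H. destruct H as (r & Hr & H).
cut (c n + - (1) * d n = 0).
{ intros E. replace (c n) with ((c n + - (1) * d n) + d n) by ring. rewrite E; ring. }
apply (power_series_zeros n (fun n => c n + - (1) * d n) (fun h => 0) r Hr).
- intros h Hh. specialize (H (z + h)). replace (z + h - z) with h in H by ring.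
  specialize (H Hh). cbv beta in H. replace (f (z + h) + - (1) * f (z + h)) with (RtoC 0) in H by ring.
  exact H.
- intros e He. exists (RtoC (e / 2)). repeat split.
  + intros E; apply RtoC_inj in E; lra.
  + rewrite Cmod_R, Rabs_pos_eq; lra.
Qed.

(** Let [T] be the supremum of the parameters up to which [f] vanishes on the ray. Zeros accumulate
    at [T * x] from below, so the Taylor series there is zero and the vanishing extends past [T],
    unless [T = 1]. *)
Lemma analytic_segment_zero (f : C -> C) (x : C) (d : R) :
  (forall t, (0 <= t <= 1)%R -> analytic_at f (t * x)) ->
  (0 < d)%R -> (forall t, (0 <= t <= d)%R -> f (t * x) = 0) -> f x = 0.
Proof.
intros Ha Hd Hz.
destruct (Ceq_dec x 0) as [->|Hx].
{ generalize (Hz 0%R ltac:(lra)). replace (0%R * 0) with (RtoC 0) by ring. auto. }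
assert (Hx' : (0 < Cmod x)%R) by (apply Cmod_gt_0; exact Hx).
set (E := fun t : R => (0 <= t <= 1)%R /\ forall s, (0 <= s <= t)%R -> f (s * x) = 0).
destruct (completeness E) as [T [HT1 HT2]].
{ exists 1%R. intros t [Ht _]; lra. }
{ exists 0%R. split; [lra|]. intros s Hs. apply Hz; lra. }
assert (HT0 : (0 < T)%R).
{ apply Rlt_le_trans with (Rmin d 1); [apply Rmin_pos; lra|]. apply HT1.
  assert (M1 := Rmin_l d 1). assert (M2 := Rmin_r d 1).
  assert (M3 : (0 < Rmin d 1)%R) by (apply Rmin_pos; lra).
  split; [lra|]. intros s Hs; apply Hz; lra. }
assert (HTle : (T <= 1)%R) by (apply HT2; intros t [Ht _]; lra).
assert (Hbelow : forall s, (0 <= s < T)%R -> f (s * x) = 0).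
{ intros s Hs. destruct (classic (exists t, E t /\ (s < t)%R)) as [(t & [_ Ht] & Hst)|Hn].
  - apply Ht; lra.
  - exfalso. assert (HH : (T <= s)%R); [|lra]. apply HT2. intros t Ht.
    apply Rnot_lt_le; intros Hlt; apply Hn; exists t; auto. }
destruct (Ha T ltac:(lra)) as [c Hc].
apply is_taylor_cseries in Hc. destruct Hc as (r & Hr & Hc).
assert (Hc0 : forall n, c n = 0).
{ intros n. apply (power_series_zeros n c (fun h => f (T * x + h)) r Hr).
  - intros h Hh. specialize (Hc (T * x + h)).
    replace (T * x + h - T * x) with h in Hc by ring. exact (Hc Hh).
  - intros e He. set (s := Rmin (T / 2) (e / (2 * Cmod x))%R).
    assert (Hs0 : (0 < s)%R) by (apply Rmin_pos; [lra|apply Rdiv_lt_0_compat; lra]).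
    assert (Hs1 : (s <= T / 2)%R) by apply Rmin_l.
    assert (Hs2 : (s <= e / (2 * Cmod x))%R) by apply Rmin_r.
    (* A step back along the segment: at most half of [T], to stay on it, and of modulus at most
       [e / 2]. *)
    exists (RtoC (- s)%R * x). repeat split.
    + apply Cmult_neq_0; [|exact Hx]. intros E0; apply RtoC_inj in E0; lra.
    + rewrite Cmod_mult, Cmod_R, Rabs_Ropp, Rabs_pos_eq by lra.
      apply Rle_lt_trans with (e / (2 * Cmod x) * Cmod x)%R; [apply Rmult_le_compat_r; lra|].
      field_simplify; lra.
    + replace (T * x + (- s)%R * x) with ((T - s)%R * x) by (rewrite RtoC_minus, RtoC_opp; ring).
      apply Hbelow; lra. }
assert (Hball : forall w, (Cmod (w - T * x) < r)%R -> f w = 0).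
{ intros w Hw. apply (cseries_unique (fun n => c n * (w - T * x) ^ n)); [apply Hc, Hw|].
  apply (cseries_ext (fun n => 0 * 0)).
  - intros n; rewrite Hc0; ring.
  - apply cseries_eps; intros e He; exists O; intros n _.
    rewrite (psum_ext _ (fun _ => 0)), psum_zero by (intros; ring).
    replace (0 - 0) with (RtoC 0) by ring. rewrite Cmod_0; exact He. }
assert (Hnear : forall s, (Rabs (s - T) < r / Cmod x)%R -> f (s * x) = 0).
{ intros s Hs. apply Hball. replace (s * x - T * x) with ((s - T)%R * x) by (rewrite RtoC_minus; ring).
  rewrite Cmod_mult, Cmod_R. apply Rlt_le_trans with (r / Cmod x * Cmod x)%R.
  - apply Rmult_lt_compat_r; assumption.
  - apply Req_le; field; lra. }
assert (Hrx : (0 < r / Cmod x)%R) by (apply Rdiv_lt_0_compat; assumption).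
destruct (Rle_lt_or_eq_dec T 1 HTle) as [HT|HT].
- exfalso. set (T' := Rmin 1 (T + r / (Cmod x) / 2)%R).
  assert (HT'1 : (T' <= 1)%R) by apply Rmin_l.
  assert (HT'2 : (T' <= T + r / Cmod x / 2)%R) by apply Rmin_r.
  assert (HT'3 : (T < T')%R) by (apply Rmin_glb_lt; lra).
  assert (HH : (T' <= T)%R); [|lra]. apply HT1. split; [lra|].
  intros s Hs. destruct (Rlt_or_le s T) as [Hlt|Hle]; [apply Hbelow; lra|].
  apply Hnear. rewrite Rabs_pos_eq; lra.
- rewrite <- (Cmult_1_l x). apply Hnear. rewrite HT.
  replace (1 - 1)%R with 0%R by ring. rewrite Rabs_R0. exact Hrx.
Qed.

(** * The sector and the branches on it *)

(* Half-angle formula: [tan (phi / 2) = Im w / (Cmod w + Re w)]. *)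
Lemma exists_arg (w : C) : w <> 0 -> ~ (Im w = 0 /\ Re w < 0)%R ->
  exists phi : R, (Rabs phi < PI)%R /\ is_arg w phi.
Proof.
intros Hw Hn. destruct w as [x y]. unfold Re, Im in Hn; simpl in Hn.
set (m := Cmod (x, y)).
assert (Hm : (0 < m)%R) by (apply Cmod_gt_0; exact Hw).
assert (Hm2 : (m * m = x * x + y * y)%R).
{ unfold m, Cmod; simpl fst; simpl snd. rewrite sqrt_sqrt; [ring|nra]. }
assert (Hmx : (0 < m + x)%R).
{ destruct (Rle_or_lt 0 x); [lra|].
  assert (y <> 0)%R by (intros ->; apply Hn; split; [reflexivity|lra]).
  assert (0 < y * y)%R by (apply Rsqr_pos_lt; auto).
  apply Rnot_le_lt; intros Hle. nra. }
set (t := (y / (m + x))%R).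
exists (2 * atan t)%R. split.
{ assert (B := atan_bound t). apply Rabs_def1; lra. }
split; [exact Hw|]. fold m. rewrite Cexp_Ci.
assert (Ht : (1 + t ^ 2 = 2 * m / (m + x))%R).
{ unfold t. apply Rmult_eq_reg_r with ((m + x) ^ 2)%R; [|apply pow_nonzero; lra].
  field_simplify; [nra|lra|lra]. }
assert (Hp : (0 < 1 + t ^ 2)%R) by nra.
assert (Hc2 : (cos (atan t) * cos (atan t) = / (1 + t ^ 2))%R).
{ rewrite cos_atan. unfold Rdiv. rewrite Rmult_1_l, <- Rinv_mult.
  f_equal. replace (t^2)%R with (Rsqr t) by (unfold Rsqr; ring).
  apply sqrt_sqrt. unfold Rsqr; nra. }
assert (Hsc : (sin (atan t) = t * cos (atan t))%R).
{ rewrite sin_atan, cos_atan. unfold Rdiv; ring. }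
assert (Ec : (cos (2 * atan t) = x / m)%R).
{ rewrite cos_2a_cos. rewrite Rmult_assoc, Hc2, Ht. field; lra. }
assert (Es : (sin (2 * atan t) = y / m)%R).
{ rewrite sin_2a, Hsc.
  replace (2 * (t * cos (atan t)) * cos (atan t))%R with (2 * t * (cos (atan t) * cos (atan t)))%R by ring.
  rewrite Hc2, Ht. unfold t. field; lra. }
rewrite Ec, Es. apply injective_projections; simpl; field; lra.
Qed.

Lemma is_arg_Re_Im (w : C) (phi : R) : is_arg w phi ->
  (0 < Cmod w /\ Re w = Cmod w * cos phi /\ Im w = Cmod w * sin phi)%R.
Proof.
intros [Hw E]. split; [apply Cmod_gt_0; exact Hw|].
rewrite Cexp_Ci in E.
split; rewrite E at 1; unfold Re, Im; simpl; ring.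
Qed.

Lemma sin_0_lt_PI (phi : R) : (sin phi = 0)%R -> (Rabs phi < PI)%R -> phi = 0%R.
Proof.
intros Hs Hb. apply Rabs_def2 in Hb.
destruct (Rtotal_order phi 0) as [H|[H|H]]; [|exact H|].
- assert (0 < sin (- phi))%R by (apply sin_gt_0; lra). rewrite sin_neg in *; lra.
- assert (0 < sin phi)%R by (apply sin_gt_0; lra). lra.
Qed.

(** The plane cut along the real half-line from 1 to infinity: in this form openness and
    star-shapedness are elementary. *)
Lemma lerch_sector_iff (x : C) : lerch_sector x <-> (Im x <> 0 \/ Re x < 1)%R.
Proof.
split.
- intros (phi & Ha & Hphi). apply NNPP; intros Hn.
  destruct (is_arg_Re_Im _ _ Ha) as (Hm & HR & HI).
  set (m := Cmod (1 - x)) in *.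
  assert (EI : Im (1 - x) = (- Im x)%R) by (unfold Im; simpl; ring).
  assert (ER : Re (1 - x) = (1 - Re x)%R) by (unfold Re; simpl; ring).
  assert (Im x = 0)%R by (apply NNPP; intros H; apply Hn; left; exact H).
  assert (1 <= Re x)%R by (apply Rnot_lt_le; intros H'; apply Hn; right; exact H').
  assert (Hs : sin phi = 0%R).
  { apply Rmult_eq_reg_l with m; [|lra]. rewrite <- HI, EI; lra. }
  rewrite (sin_0_lt_PI _ Hs Hphi), cos_0 in HR. lra.
- intros H. destruct (exists_arg (1 - x)) as (phi & Hphi & Ha).
  + intros E. assert (EI : Im (1 - x) = 0%R) by (rewrite E; reflexivity).
    assert (ER : Re (1 - x) = 0%R) by (rewrite E; reflexivity).
    unfold Re, Im in *; simpl in *. destruct H; lra.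
  + unfold Re, Im in *; simpl in *. intros [H1 H2]. destruct H; lra.
  + exists phi; split; assumption.
Qed.

(** Star-shapedness about 0, which lets the identity theorem run along segments and makes [1 - x t]
    nonzero for [t] in [0, 1]. *)
Lemma lerch_sector_scal (x : C) (t : R) :
  lerch_sector x -> (0 <= t <= 1)%R -> lerch_sector (t * x).
Proof.
rewrite !lerch_sector_iff; unfold Re, Im; simpl; intros H Ht.
destruct (Req_dec t 0) as [->|Hn]; [right; lra|].
destruct H as [H|H].
- left. replace (t * snd x + 0 * fst x)%R with (t * snd x)%R by ring.
  apply Rmult_integral_contrapositive; auto.
- right. destruct (Rle_or_lt 0 (fst x)); nra.
Qed.

Lemma lerch_sector_disc (x : C) : (Cmod x < 1)%R -> lerch_sector x.
Proof.
intros H. apply lerch_sector_iff. right.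
assert (A := Re_le_Cmod x). assert (B := Rle_abs (Re x)). lra.
Qed.

Lemma lerch_sector_open (x : C) : lerch_sector x ->
  exists r, (0 < r)%R /\ forall w, (Cmod (w - x) < r)%R -> lerch_sector w.
Proof.
rewrite lerch_sector_iff; intros [H|H].
- exists (Rabs (Im x)); split; [apply Rabs_pos_lt; exact H|].
  intros w Hw. apply lerch_sector_iff. left. intros E.
  assert (A := Im_le_Cmod (w - x)).
  replace (Im (w - x)) with (Im w - Im x)%R in A by (unfold Im; simpl; ring).
  rewrite E in A. replace (0 - Im x)%R with (- Im x)%R in A by ring. rewrite Rabs_Ropp in A. lra.
- exists (1 - Re x)%R; split; [lra|].
  intros w Hw. apply lerch_sector_iff. right.
  assert (A := Re_le_Cmod (w - x)). assert (B := Rle_abs (Re (w - x))).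
  replace (Re (w - x)) with (Re w - Re x)%R in * by (unfold Re; simpl; ring). lra.
Qed.

Lemma lerch_sector_ne_1 (x : C) : lerch_sector x -> 1 - x <> 0.
Proof.
rewrite lerch_sector_iff. intros H E.
assert (E1 := f_equal fst E). assert (E2 := f_equal snd E). simpl in *.
unfold Re, Im in H. destruct H; lra.
Qed.

Lemma lerch_branch_unique (S : Z) (a : C) (F G : C -> C) :
  is_lerch_branch S a F -> is_lerch_branch S a G ->
  forall x, lerch_sector x -> F x = G x.
Proof.
intros [F1 F2] [G1 G2] x Hx.
cut (F x + - (1) * G x = 0).
{ intros E. replace (F x) with ((F x + - (1) * G x) + G x) by ring. rewrite E; ring. }
assert (Hc := Cmod_ge_0 x).
(* For [t] up to this bound [t * x] stays in the unit disc, where both branches sum the same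
   series. *)
apply (analytic_segment_zero (fun w => F w + - (1) * G w) x (/ (Cmod x + 1))).
- intros t Ht. assert (Ht' := lerch_sector_scal x t Hx Ht).
  destruct (F2 _ Ht') as [c Fc]. destruct (G2 _ Ht') as [d Gd].
  exists (fun n => c n + - (1) * d n). apply is_taylor_plus; [exact Fc|].
  apply is_taylor_scal; exact Gd.
- apply Rinv_0_lt_compat; lra.
- intros t Ht. assert (Hd : (Cmod (t * x) < 1)%R).
  { rewrite Cmod_mult, Cmod_R, Rabs_pos_eq by lra.
    apply Rle_lt_trans with (/ (Cmod x + 1) * Cmod x)%R; [apply Rmult_le_compat_r; lra|].
    apply Rmult_lt_reg_r with (Cmod x + 1)%R; [lra|]. field_simplify; lra. }
  rewrite (cseries_unique _ _ _ (F1 _ Hd) (G1 _ Hd)). ring.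
Qed.

(** * Integer powers, and the relations between neighbouring [S] and [a] *)

Lemma Cinv_0 : / (RtoC 0) = 0.
Proof. apply injective_projections; simpl; unfold Rdiv; ring. Qed.

Lemma Cinv_inv (x : C) : / / x = x.
Proof.
destruct (Ceq_dec x 0) as [->|H]; [rewrite !Cinv_0; reflexivity|].
field; exact H.
Qed.

Lemma Cpowz_of_nat (x : C) (n : nat) : Cpowz x (Z.of_nat n) = x ^ n.
Proof.
destruct n as [|n]; [reflexivity|]. simpl Z.of_nat. unfold Cpowz.
rewrite SuccNat2Pos.id_succ. reflexivity.
Qed.

Lemma Cpowz_opp_of_nat (x : C) (n : nat) : Cpowz x (- Z.of_nat n) = / x ^ n.
Proof.
destruct n as [|n]; [simpl; symmetry; apply injective_projections; simpl; field|].
change (/ x ^ Pos.to_nat (Pos.of_succ_nat n) = / x ^ S n).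
rewrite SuccNat2Pos.id_succ. reflexivity.
Qed.

(** With [/ 0 = 0] the identity breaks at [x = 0], [S = 1], where the sides are 0 and 1. For
    [S <= 0] both sides are polynomial in [x]. *)
Lemma Cpowz_pred (x : C) (S : Z) : (x <> 0 \/ (S <= 0)%Z) ->
  x * / Cpowz x S = / Cpowz x (S - 1).
Proof.
intros H. destruct (Z_le_gt_dec S 0) as [HS|HS].
- replace S with (- Z.of_nat (Z.to_nat (- S)))%Z at 1 by lia.
  replace (S - 1)%Z with (- Z.of_nat (Datatypes.S (Z.to_nat (- S))))%Z by lia.
  rewrite !Cpowz_opp_of_nat, !Cinv_inv. reflexivity.
- destruct H as [H|H]; [|lia].
  replace S with (Z.of_nat (Datatypes.S (Z.to_nat (S - 1)))) at 1 by lia.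
  replace (S - 1)%Z with (Z.of_nat (Z.to_nat (S - 1))) at 2 by lia.
  rewrite !Cpowz_of_nat. simpl. field. split; [apply Cpow_nz; exact H|exact H].
Qed.

Lemma is_taylor_cderiv_center (f : C -> C) (z : C) (c : nat -> C) :
  is_taylor f z c -> cderiv f z (c 1%nat).
Proof.
intros H. destruct (is_taylor_cderiv _ _ _ H) as (s & Hs & Hd).
destruct (constructive_indefinite_description _ (Hd z ltac:(replace (z - z) with (RtoC 0) by ring; rewrite Cmod_0; exact Hs))) as [l Hl].
replace (c 1%nat) with l; [exact Hl|].
set (g := fun w => epsilon (inhabits (RtoC 0)) (cderiv f w)).
assert (Hg : forall w, (Cmod (w - z) < s)%R -> cderiv f w (g w)).
{ intros w Hw. unfold g. apply epsilon_spec. apply Hd, Hw. }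
assert (T := is_taylor_deriv f g z c s H Hs Hg).
apply is_taylor_cseries in T. destruct T as (r & Hr & T).
assert (Z0 : z - z = 0) by ring.
specialize (T z ltac:(rewrite Z0, Cmod_0; exact Hr)). rewrite Z0 in T.
assert (E := cseries_unique _ _ _ T (cseries_pow_0 (fun n => INR (Datatypes.S n) * c (Datatypes.S n)))).
rewrite (cderiv_unique f z l (g z) Hl).
- rewrite E. simpl. ring.
- apply Hg. rewrite Z0, Cmod_0; exact Hs.
Qed.

(** The operator [a + x d/dx] multiplies the coefficient of [x ^ n] by [a + n], and it preserves
    analyticity on the sector. *)
Lemma lerch_branch_pred (S : Z) (a : C) (F : C -> C) :
  ((S <= 0)%Z \/ forall n : nat, a + INR n <> 0) ->
  is_lerch_branch S a F ->
  exists G, is_lerch_branch (S - 1) a G /\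
    forall x, lerch_sector x -> exists l, cderiv F x l /\ G x = a * F x + x * l.
Proof.
intros Ha [F1 F2].
(* The first Taylor coefficient chooses the derivative at all points of the sector at once. *)
set (D := fun w => taylor_coef F w 1%nat).
assert (HD : forall w, lerch_sector w -> cderiv F w (D w)).
{ intros w Hw. apply is_taylor_cderiv_center. unfold taylor_coef. apply epsilon_spec.
  exact (F2 w Hw). }
exists (fun w => a * F w + w * D w). split; [split|].
- intros z Hz.
  destruct (cpower_series_deriv (fun n => / Cpowz (a + INR n) S) F 1) with (h := z) as (l & Hl & Hd).
  + intros h Hh. eapply cseries_ext; [|exact (F1 h Hh)]. intros n; cbv beta; unfold Cdiv; ring.
  + exact Hz.
  + rewrite (cderiv_unique _ _ _ _ (HD z (lerch_sector_disc z Hz)) Hd).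
    set (d := fun n => INR n * / Cpowz (a + INR n) S * z ^ n).
    assert (S1 : cseries d (d O + z * l)).
    { apply cseries_incr. eapply cseries_ext; [|apply (cseries_scal z), Hl].
      intros n; unfold d; cbv beta; simpl Cpow; ring. }
    replace (a * F z + z * l) with (a * F z + (d O + z * l)) by (unfold d; simpl; ring).
    apply (cseries_ext (fun n => a * (z ^ n / Cpowz (a + INR n) S) + d n)).
    * intros n. unfold d. unfold Cdiv. rewrite <- Cpowz_pred; [ring|].
      destruct Ha as [Ha|Ha]; [right; exact Ha|left; apply Ha].
    * apply cseries_plus; [|exact S1]. apply cseries_scal. exact (F1 z Hz).
- intros z Hz. destruct (F2 z Hz) as [c Hc].
  destruct (lerch_sector_open z Hz) as (r & Hr & Ho).
  eexists. apply (is_taylor_plus _ (fun w => w * D w)).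
  + apply is_taylor_scal; exact Hc.
  + apply is_taylor_mul_id. apply (is_taylor_deriv F D z c r Hc Hr).
    intros w Hw. apply HD, Ho, Hw.
- intros x Hx. exists (D x). split; [apply HD, Hx|reflexivity].
Qed.

Lemma lerch_branch_ode (S : Z) (a : C) (F G : C -> C) :
  ((S <= 0)%Z \/ forall n : nat, a + INR n <> 0) ->
  is_lerch_branch S a F -> is_lerch_branch (S - 1) a G ->
  forall x, lerch_sector x -> exists l, cderiv F x l /\ G x = a * F x + x * l.
Proof.
intros Ha HF HG x Hx. destruct (lerch_branch_pred S a F Ha HF) as (H & HH & K).
destruct (K x Hx) as (l & Hl & E). exists l; split; [exact Hl|].
rewrite <- E. exact (lerch_branch_unique _ _ _ _ HG HH x Hx).
Qed.

(** Splitting off the term [n = 0] gives [Phi(z, S, a) = a ^ (- S) + z Phi(z, S, a + 1)]. If [a = 0]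
    and [S >= 1], the split term is 0 on both sides by [/ 0 = 0]. *)
Lemma lerch_branch_shift (S : Z) (a : C) (F : C -> C) :
  is_lerch_branch S (a + 1) F ->
  is_lerch_branch S a (fun z => z * F z + / Cpowz a S).
Proof.
intros [F1 F2]. split.
- intros z Hz. set (u := fun n => z ^ n / Cpowz (a + INR n) S).
  replace (z * F z + / Cpowz a S) with (u O + z * F z).
  + apply cseries_incr. eapply cseries_ext; [|apply (cseries_scal z), (F1 z Hz)].
    intros n; unfold u; cbv beta. rewrite S_INR, RtoC_plus.
    replace (a + 1 + INR n) with (a + (INR n + 1)) by ring. simpl; unfold Cdiv; ring.
  + unfold u, Cdiv. simpl. rewrite Cplus_0_r. ring.
- intros z Hz. destruct (F2 z Hz) as [c Hc]. eexists.
  apply is_taylor_plus; [apply is_taylor_mul_id; exact Hc|apply is_taylor_const].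
Qed.

Lemma psum_geom (q : C) (n : nat) : (1 - q) * psum (fun k => q ^ k) n = 1 - q ^ n.
Proof. induction n as [|n IH]; simpl; [ring|]. rewrite Cmult_plus_distr_l, IH; ring. Qed.

Lemma ne_1_of_Cmod_lt (q : C) : (Cmod q < 1)%R -> 1 - q <> 0.
Proof.
intros H E. replace q with (RtoC 1) in H.
- rewrite Cmod_1 in H; lra.
- replace (RtoC 1) with ((1 - q) + q) by ring. rewrite E; ring.
Qed.

Lemma cseries_geom (q : C) : (Cmod q < 1)%R -> cseries (fun n => q ^ n) (/ (1 - q)).
Proof.
intros Hq. assert (Hn := ne_1_of_Cmod_lt q Hq).
apply cseries_eps. intros e He.
assert (Hm : (0 < Cmod (1 - q))%R) by (apply Cmod_gt_0; exact Hn).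
destruct (pow_lt_1_zero (Cmod q)) with (y := (e * Cmod (1 - q))%R) as [N HN].
- rewrite Rabs_pos_eq; [exact Hq|apply Cmod_ge_0].
- nra.
- exists N. intros n Hn'. specialize (HN n Hn').
  rewrite Rabs_pos_eq in HN by (apply pow_le, Cmod_ge_0).
  replace (psum (fun k => q ^ k) n - / (1 - q)) with (- (q ^ n * / (1 - q))).
  + rewrite Cmod_opp, Cmod_mult, Cmod_pow, Cmod_inv by exact Hn.
    apply Rmult_lt_reg_r with (Cmod (1 - q)); [exact Hm|].
    rewrite Rmult_assoc, Rinv_l by lra. lra.
  + assert (E := psum_geom q n).
    replace (psum (fun k => q ^ k) n) with ((1 - q ^ n) / (1 - q)).
    * field; exact Hn.
    * rewrite <- E. field; exact Hn.
Qed.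

Lemma lerch_branch_0 (a : C) : is_lerch_branch 0 a (fun z => / (1 - z)).
Proof.
split.
- intros z Hz. eapply cseries_ext; [|apply cseries_geom; exact Hz].
  intros n. simpl Cpowz. unfold Cdiv. replace (/ 1) with (RtoC 1) by (field; intros E; apply RtoC_inj in E; lra). ring.
- intros z0 Hz0. assert (Hn := lerch_sector_ne_1 z0 Hz0).
  assert (Hm : (0 < Cmod (1 - z0))%R) by (apply Cmod_gt_0; exact Hn).
  (* The geometric series is expanded again in [q = (w - z0) / (1 - z0)]; it converges up to the
     distance from [z0] to the pole 1. *)
  exists (fun n => (/ (1 - z0)) ^ Datatypes.S n). apply is_taylor_cseries.
  exists (Cmod (1 - z0)). split; [exact Hm|]. intros w Hw.
  set (q := (w - z0) / (1 - z0)).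
  assert (Hq : (Cmod q < 1)%R).
  { unfold q, Cdiv. rewrite Cmod_mult, Cmod_inv by exact Hn.
    apply Rmult_lt_reg_r with (Cmod (1 - z0)); [exact Hm|].
    rewrite Rmult_assoc, Rinv_l by lra. lra. }
  assert (H := cseries_scal (/ (1 - z0)) _ _ (cseries_geom q Hq)).
  assert (Hn2 := ne_1_of_Cmod_lt q Hq).
  assert (E : (1 - z0) * (1 - q) = 1 - w) by (unfold q; field; exact Hn).
  replace (/ (1 - w)) with (/ (1 - z0) * / (1 - q)).
  + eapply cseries_ext; [|exact H]. intros n; cbv beta. unfold q, Cdiv.
    rewrite Cpow_mult_l. simpl; ring.
  + rewrite <- E. field. split; assumption.
Qed.

(** * The Mellin transform *)

Definition cint (f : R -> C) (a b : R) : C :=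
  @RInt C_R_CompleteNormedModule f a b.

Definition is_cint (f : R -> C) (a b : R) (l : C) : Prop :=
  @is_RInt C_R_NormedModule f a b l.

Definition ccont (f : R -> C) (t : R) : Prop :=
  forall e : R, (0 < e)%R -> exists d : R, (0 < d)%R /\
    forall s : R, (Rabs (s - t) < d)%R -> (Cmod (f s - f t) < e)%R.

Lemma ccont_continuous (f : R -> C) (t : R) :
  ccont f t -> @continuous R_UniformSpace C_R_CompleteNormedModule f t.
Proof.
intros H P HP. apply (proj1 (locally_Cmod (f t) P)) in HP. destruct HP as (e & He & HP).
destruct (H e He) as (d & Hd & K). exists (mkposreal d Hd). intros s Hs. apply HP, K, Hs.
Qed.

Lemma cint_correct (f : R -> C) (a b : R) : (a <= b)%R ->
  (forall t, (a <= t <= b)%R -> ccont f t) -> is_cint f a b (cint f a b).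
Proof.
intros Hab H. apply (@RInt_correct C_R_CompleteNormedModule).
apply (@ex_RInt_continuous C_R_CompleteNormedModule).
rewrite Rmin_left, Rmax_right by exact Hab. intros t Ht. apply ccont_continuous, H, Ht.
Qed.

Lemma is_cint_unique (f : R -> C) (a b : R) (l : C) : is_cint f a b l -> cint f a b = l.
Proof. apply (@is_RInt_unique C_R_CompleteNormedModule). Qed.

Lemma is_cint_plus (f g : R -> C) (a b : R) (l m : C) :
  is_cint f a b l -> is_cint g a b m -> is_cint (fun t => f t + g t) a b (l + m).
Proof. intros H1 H2; exact (is_RInt_plus _ _ _ _ _ _ H1 H2). Qed.

(** The integral lives in a real module, where only real scalars act; a complex factor is
    distributed over the two coordinates. *)
Lemma is_cint_scal (c : C) (f : R -> C) (a b : R) (l : C) :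
  is_cint f a b l -> is_cint (fun t => c * f t) a b (c * l).
Proof.
intros H.
assert (H1 := @is_RInt_fct_extend_fst R_NormedModule R_NormedModule f a b l H).
assert (H2 := @is_RInt_fct_extend_snd R_NormedModule R_NormedModule f a b l H).
apply (@is_RInt_fct_extend_pair R_NormedModule R_NormedModule (fun t => c * f t)).
- exact (is_RInt_minus _ _ _ _ _ _ (is_RInt_scal _ _ _ (fst c) _ H1) (is_RInt_scal _ _ _ (snd c) _ H2)).
- exact (is_RInt_plus _ _ _ _ _ _ (is_RInt_scal _ _ _ (fst c) _ H2) (is_RInt_scal _ _ _ (snd c) _ H1)).
Qed.

Lemma is_cint_ext (f g : R -> C) (a b : R) (l : C) : (a <= b)%R ->
  (forall t, (a < t < b)%R -> f t = g t) -> is_cint f a b l -> is_cint g a b l.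
Proof.
intros Hab H. apply (@is_RInt_ext C_R_NormedModule).
rewrite Rmin_left, Rmax_right by exact Hab. exact H.
Qed.

Lemma Cmod_is_cint_le (f : R -> C) (a b M : R) (l : C) : (a <= b)%R ->
  (forall t, (a <= t <= b)%R -> (Cmod (f t) <= M)%R) -> is_cint f a b l ->
  (Cmod l <= (b - a) * M)%R.
Proof.
intros Hab H Hl. rewrite <- norm_C_R. apply (norm_RInt_le_const f a b l M Hab); [|exact Hl].
intros t Ht. rewrite norm_C_R. apply H, Ht.
Qed.

Lemma rderiv_ccont (f : R -> C) (t : R) (l : C) : rderiv f t l -> ccont f t.
Proof.
intros H e He.
destruct (proj1 (rderiv_eps _ _ _) H 1%R ltac:(lra)) as (d & Hd & K).
assert (Hl := Cmod_ge_0 l).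
exists (Rmin d (e / (Cmod l + 2))); split.
{ apply Rmin_pos; [exact Hd|]. apply Rdiv_lt_0_compat; lra. }
intros w Hw.
assert (H1 : (Rabs (w - t) < d)%R) by (eapply Rlt_le_trans; [exact Hw|apply Rmin_l]).
assert (H2 : (Rabs (w - t) < e / (Cmod l + 2))%R) by (eapply Rlt_le_trans; [exact Hw|apply Rmin_r]).
specialize (K _ H1). replace (t + (w - t))%R with w in K by ring.
replace (f w - f t) with ((f w - f t - l * (w - t)%R) + l * (w - t)%R) by ring.
eapply Rle_lt_trans; [apply Cmod_triangle|]. rewrite Cmod_mult, Cmod_R.
apply Rle_lt_trans with ((Cmod l + 1) * Rabs (w - t))%R; [lra|].
apply Rle_lt_trans with ((Cmod l + 1) * (e / (Cmod l + 2)))%R.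
- apply Rmult_le_compat_l; lra.
- apply Rmult_lt_reg_r with (Cmod l + 2)%R; [lra|]. field_simplify; [nra|lra].
Qed.

Lemma cint_derive (f df : R -> C) (a b : R) : (a <= b)%R ->
  (forall t, (a <= t <= b)%R -> rderiv f t (df t)) ->
  (forall t, (a <= t <= b)%R -> ccont df t) ->
  is_cint df a b (f b - f a).
Proof.
intros Hab H1 H2.
apply (@is_RInt_derive C_R_CompleteNormedModule f df a b);
rewrite Rmin_left, Rmax_right by exact Hab; intros t Ht.
- apply H1, Ht.
- apply ccont_continuous, H2, Ht.
Qed.

Lemma rderiv_comp (G : C -> C) (u : R -> R) (t m : R) (l : C) :
  cderiv G (u t) l -> derivable_pt_lim u t m -> rderiv (fun s => G (u s)) t (m * l).
Proof.
intros HG Hu. apply is_derive_Reals in Hu.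
assert (K := cderiv_line G 0 1 l (u t)).
assert (E : 0 + RtoC (u t) * 1 = u t) by ring. rewrite E in K. specialize (K HG).
assert (K' : rderiv (fun s : R => G s) (u t) l).
{ rewrite Cmult_1_r in K. eapply (is_derive_ext (V := C_R_NormedModule)); [|exact K].
  intros s; simpl. f_equal. ring. }
assert (R1 := @is_derive_comp R_AbsRing C_R_NormedModule (fun s : R => G s) u t l m K' Hu).
unfold rderiv. replace (m * l) with (@scal R_AbsRing C_R_NormedModule m l); [exact R1|].
apply injective_projections; simpl; unfold scal; simpl; unfold mult; simpl; ring.
Qed.

Lemma ccont_const (c : C) (t : R) : ccont (fun _ => c) t.
Proof.
intros e He; exists 1%R; split; [lra|]. intros s _. replace (c - c) with (RtoC 0) by ring.
rewrite Cmod_0; exact He.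
Qed.

Lemma ccont_mult (f g : R -> C) (t : R) : ccont f t -> ccont g t -> ccont (fun s => f s * g s) t.
Proof.
intros Hf Hg e He.
set (A := (Cmod (f t) + Cmod (g t) + 1)%R).
assert (Hft := Cmod_ge_0 (f t)). assert (Hgt := Cmod_ge_0 (g t)).
set (e' := Rmin 1 (e / (2 * A))).
assert (He' : (0 < e')%R) by (apply Rmin_pos; [lra|apply Rdiv_lt_0_compat; unfold A; lra]).
assert (E1 : (e' <= 1)%R) by apply Rmin_l.
assert (E2 : (e' <= e / (2 * A))%R) by apply Rmin_r.
destruct (Hf e' He') as (d1 & Hd1 & K1). destruct (Hg e' He') as (d2 & Hd2 & K2).
exists (Rmin d1 d2); split; [apply Rmin_pos; auto|]. intros s Hs.
assert (M1 := Rmin_l d1 d2). assert (M2 := Rmin_r d1 d2).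
specialize (K1 s ltac:(lra)). specialize (K2 s ltac:(lra)).
replace (f s * g s - f t * g t)
  with ((f s - f t) * (g s - g t) + (f t * (g s - g t) + g t * (f s - f t))) by ring.
eapply Rle_lt_trans; [apply Cmod_triangle|].
eapply Rle_lt_trans; [apply Rplus_le_compat_l, Cmod_triangle|].
rewrite !Cmod_mult.
assert (P1 := Cmod_ge_0 (f s - f t)). assert (P2 := Cmod_ge_0 (g s - g t)).
apply Rle_lt_trans with (e' * A)%R.
{ assert (Q1 : (Cmod (f s - f t) * Cmod (g s - g t) <= e' * 1)%R) by (apply Rmult_le_compat; lra).
  assert (Q2 : (Cmod (f t) * Cmod (g s - g t) <= Cmod (f t) * e')%R) by (apply Rmult_le_compat_l; lra).
  assert (Q3 : (Cmod (g t) * Cmod (f s - f t) <= Cmod (g t) * e')%R) by (apply Rmult_le_compat_l; lra).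
  unfold A; lra. }
apply Rle_lt_trans with (e / (2 * A) * A)%R; [apply Rmult_le_compat_r; [unfold A|]; lra|].
replace (e / (2 * A) * A)%R with (e / 2)%R by (field; unfold A; lra). lra.
Qed.

(** A class of functions on the whole line that is closed under products, under inverses bounded
    away from 0, and under the Mellin transform. It implies continuity, so iterated integrals need
    no further integrability argument. *)
Definition bounded_lipschitz (f : R -> C) : Prop :=
  exists B K : R, (forall t, (Cmod (f t) <= B)%R) /\
    (forall s t, (Cmod (f s - f t) <= K * Rabs (s - t))%R).

Lemma bounded_lipschitz_ccont (f : R -> C) (t : R) : bounded_lipschitz f -> ccont f t.
Proof.
intros (B & K & _ & H) e He.
assert (HK : (0 <= Rabs K)%R) by apply Rabs_pos.
exists (e / (Rabs K + 1))%R; split; [apply Rdiv_lt_0_compat; lra|].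
intros s Hs. eapply Rle_lt_trans; [apply H|].
assert (Hst := Rabs_pos (s - t)). assert (HK' := Rle_abs K).
apply Rle_lt_trans with (Rabs K * (e / (Rabs K + 1)))%R; [nra|].
apply Rmult_lt_reg_r with (Rabs K + 1)%R; [lra|]. field_simplify; [nra|lra].
Qed.

Lemma bounded_lipschitz_const (c : C) : bounded_lipschitz (fun _ => c).
Proof.
exists (Cmod c), 0%R; split; [intros; lra|]. intros s t.
replace (c - c) with (RtoC 0) by ring. rewrite Cmod_0; lra.
Qed.

Lemma bounded_lipschitz_plus (f g : R -> C) :
  bounded_lipschitz f -> bounded_lipschitz g -> bounded_lipschitz (fun t => f t + g t).
Proof.
intros (B & K & H1 & H2) (B' & K' & H1' & H2'). exists (B + B')%R, (K + K')%R; split.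
- intros t. eapply Rle_trans; [apply Cmod_triangle|]. specialize (H1 t); specialize (H1' t); lra.
- intros s t. replace (f s + g s - (f t + g t)) with ((f s - f t) + (g s - g t)) by ring.
  eapply Rle_trans; [apply Cmod_triangle|]. specialize (H2 s t); specialize (H2' s t); lra.
Qed.

Lemma bounded_lipschitz_mult (f g : R -> C) :
  bounded_lipschitz f -> bounded_lipschitz g -> bounded_lipschitz (fun t => f t * g t).
Proof.
intros (B & K & H1 & H2) (B' & K' & H1' & H2').
exists (B * B')%R, (B * K' + B' * K)%R; split.
- intros t. rewrite Cmod_mult. apply Rmult_le_compat; auto; apply Cmod_ge_0.
- intros s t.
  replace (f s * g s - f t * g t) with (f s * (g s - g t) + g t * (f s - f t)) by ring.
  eapply Rle_trans; [apply Cmod_triangle|]. rewrite !Cmod_mult.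
  assert (Cmod (f s) * Cmod (g s - g t) <= B * (K' * Rabs (s - t)))%R
    by (apply Rmult_le_compat; auto; apply Cmod_ge_0).
  assert (Cmod (g t) * Cmod (f s - f t) <= B' * (K * Rabs (s - t)))%R
    by (apply Rmult_le_compat; auto; apply Cmod_ge_0).
  lra.
Qed.

Lemma bounded_lipschitz_scal (c : C) (f : R -> C) :
  bounded_lipschitz f -> bounded_lipschitz (fun t => c * f t).
Proof. intros H. apply bounded_lipschitz_mult; [apply bounded_lipschitz_const|exact H]. Qed.

Lemma bounded_lipschitz_pow (f : R -> C) (n : nat) :
  bounded_lipschitz f -> bounded_lipschitz (fun t => f t ^ n).
Proof.
intros H; induction n as [|n IH]; simpl.
- apply bounded_lipschitz_const.
- apply bounded_lipschitz_mult; assumption.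
Qed.

Lemma bounded_lipschitz_inv (f : R -> C) (d : R) : (0 < d)%R ->
  (forall t, (d <= Cmod (f t))%R) -> bounded_lipschitz f -> bounded_lipschitz (fun t => / f t).
Proof.
intros Hd Hf (B & K & H1 & H2).
assert (Hn : forall t, f t <> 0) by (intros t; apply Cmod_gt_0; specialize (Hf t); lra).
assert (Hi : forall t, (Cmod (/ f t) <= / d)%R).
{ intros t. rewrite Cmod_inv by apply Hn. apply Rinv_le_contravar; auto. }
exists (/ d)%R, (/ d * / d * K)%R; split; [exact Hi|].
intros s t. replace (/ f s - / f t) with (/ f s * / f t * (f t - f s)) by (field; auto).
rewrite !Cmod_mult, (Cmod_sub_sym (f t)), Rmult_assoc with (r3 := Rabs (s - t)).
apply Rmult_le_compat; [apply Rmult_le_pos; apply Cmod_ge_0|apply Cmod_ge_0| |apply H2].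
apply Rmult_le_compat; auto; apply Cmod_ge_0.
Qed.

Lemma bounded_lipschitz_dilate (f : R -> C) (c : R) :
  bounded_lipschitz f -> bounded_lipschitz (fun t => f (c * t)%R).
Proof.
intros (B & K & H1 & H2). exists B, (K * Rabs c)%R; split; [auto|].
intros s t. eapply Rle_trans; [apply H2|].
replace (c * s - c * t)%R with (c * (s - t))%R by ring. rewrite Rabs_mult. lra.
Qed.

(** Projection onto [0, 1]: it turns [1 / (1 - x t)], of interest on [0, 1] only, into a bounded
    Lipschitz function on the line. *)
Definition clamp (t : R) : R := Rmax 0 (Rmin 1 t).

Lemma clamp_bounds (t : R) : (0 <= clamp t <= 1)%R.
Proof. unfold clamp, Rmax, Rmin. repeat destruct Rle_dec; lra. Qed.

Lemma clamp_id (t : R) : (0 <= t <= 1)%R -> clamp t = t.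
Proof. intros H. unfold clamp. rewrite Rmin_right, Rmax_right; lra. Qed.

Lemma bounded_lipschitz_clamp : bounded_lipschitz (fun t => clamp t).
Proof.
exists 1%R, 1%R; split.
- intros t. rewrite Cmod_R. assert (H := clamp_bounds t). rewrite Rabs_pos_eq; lra.
- intros s t. rewrite <- RtoC_minus, Cmod_R.
  unfold clamp, Rmax, Rmin, Rabs.
  repeat destruct Rle_dec; repeat destruct Rcase_abs; lra.
Qed.

(* [t ^ (a - 1)] on [0, 1], with the value [0] at the origin, where it is
   continuous as soon as [1 < Re a]. *)
Definition mellin_weight (a : C) (t : R) : C :=
  if Rlt_dec 0 t then Cexp ((a - 1) * ln t) else 0.

Lemma Cmod_Cexp_ln (c : C) (t : R) : (0 < t <= 1)%R -> (1 <= Re c)%R ->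
  (Cmod (Cexp (c * ln t)) <= t)%R.
Proof.
intros Ht Hc. rewrite Cmod_Cexp. replace (Re (c * ln t)) with (Re c * ln t)%R
  by (unfold Re; simpl; ring).
rewrite <- (exp_ln t) at 2 by lra.
assert (Hl : (ln t <= 0)%R) by (rewrite <- ln_1; apply ln_le; lra).
destruct (Req_dec (Re c * ln t) (ln t)) as [->|Hne]; [lra|].
apply Rlt_le, exp_increasing. nra.
Qed.

Lemma rderiv_Cexp_ln (c : C) (t : R) : (0 < t)%R ->
  rderiv (fun s => Cexp (c * ln s)) t (c * Cexp ((c - 1) * ln t)).
Proof.
intros Ht.
replace (c * Cexp ((c - 1) * ln t)) with (RtoC (/ t) * (c * Cexp (c * ln t))).
- apply (rderiv_comp (fun w => Cexp (c * w)) ln); [apply cderiv_Cexp_scal|].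
  apply derivable_pt_lim_ln; exact Ht.
- replace ((c - 1) * ln t) with (c * ln t + - RtoC (ln t)) by ring.
  rewrite Cexp_plus, <- RtoC_opp, <- ln_Rinv by exact Ht.
  replace (Cexp (ln (/ t))) with (RtoC (/ t)); [ring|].
  unfold Cexp, Re, Im; simpl. rewrite cos_0, sin_0, exp_ln by (apply Rinv_0_lt_compat; exact Ht).
  apply injective_projections; simpl; ring.
Qed.

Lemma rderiv_local (f g : R -> C) (t : R) (l : C) (r : R) : (0 < r)%R ->
  (forall s, (Rabs (s - t) < r)%R -> f s = g s) -> rderiv f t l -> rderiv g t l.
Proof.
intros Hr Hfg H. apply (is_derive_ext_loc (V := C_R_NormedModule) f); [|exact H].
exists (mkposreal r Hr). intros s Hs. apply Hfg, Hs.
Qed.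

(** Asking for [2 <= Re a] makes the weight vanish linearly at 0, so the Mellin integral is proper;
    the recursion in [a] pays for this restriction. *)
Lemma mellin_weight_le (a : C) (t : R) : (2 <= Re a)%R -> (t <= 1)%R ->
  (Cmod (mellin_weight a t) <= Rabs t)%R.
Proof.
intros Ha Ht. unfold mellin_weight. destruct Rlt_dec as [H|H].
- rewrite Rabs_pos_eq by lra. apply Cmod_Cexp_ln; [lra|]. unfold Re in *; simpl; lra.
- rewrite Cmod_0. apply Rabs_pos.
Qed.

Lemma mellin_weight_ccont (a : C) (t : R) : (2 <= Re a)%R -> (0 <= t)%R ->
  ccont (mellin_weight a) t.
Proof.
intros Ha Ht. destruct (Req_dec t 0) as [->|Hn].
- intros e He. exists (Rmin e 1); split; [apply Rmin_pos; lra|]. intros s Hs.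
  assert (M1 := Rmin_l e 1). assert (M2 := Rmin_r e 1).
  replace (s - 0)%R with s in Hs by ring.
  assert (E : mellin_weight a 0 = 0) by (unfold mellin_weight; destruct Rlt_dec; [lra|reflexivity]).
  rewrite E. replace (mellin_weight a s - 0) with (mellin_weight a s) by ring.
  eapply Rle_lt_trans; [apply mellin_weight_le; [exact Ha|]|lra].
  assert (H := Rle_abs s). lra.
- apply (rderiv_ccont _ _ ((a - 1) * Cexp ((a - 1 - 1) * ln t))).
  apply (rderiv_local (fun s => Cexp ((a - 1) * ln s)) _ _ _ t); [lra| |].
  + intros s Hs. apply Rabs_def2 in Hs. unfold mellin_weight. destruct Rlt_dec; [reflexivity|lra].
  + apply rderiv_Cexp_ln; lra.
Qed.

(** An inverse of the operator [a + s d/ds]: on [0, 1] it divides [s ^ n] by [a + n], so [S]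
    iterations produce [1 / (a + n) ^ S]. *)
Definition mellin (a : C) (f : R -> C) (s : R) : C :=
  cint (fun t => mellin_weight a t * f (s * t)%R) 0 1.

Lemma is_cint_mellin (a : C) (f : R -> C) (s : R) : (2 <= Re a)%R -> bounded_lipschitz f ->
  is_cint (fun t => mellin_weight a t * f (s * t)%R) 0 1 (mellin a f s).
Proof.
intros Ha Hf. apply cint_correct; [lra|]. intros t Ht.
apply ccont_mult; [apply mellin_weight_ccont; lra|].
apply (bounded_lipschitz_ccont (fun t => f (s * t)%R)). apply bounded_lipschitz_dilate, Hf.
Qed.

Lemma mellin_weight_le_1 (a : C) (t : R) : (2 <= Re a)%R -> (0 <= t <= 1)%R ->
  (Cmod (mellin_weight a t) <= 1)%R.
Proof.
intros Ha Ht. eapply Rle_trans; [apply mellin_weight_le; lra|]. rewrite Rabs_pos_eq; lra.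
Qed.

Lemma mellin_plus (a : C) (f g : R -> C) (s : R) : (2 <= Re a)%R ->
  bounded_lipschitz f -> bounded_lipschitz g ->
  mellin a (fun t => f t + g t) s = mellin a f s + mellin a g s.
Proof.
intros Ha Hf Hg. apply is_cint_unique.
eapply is_cint_ext; [lra| |apply is_cint_plus; apply is_cint_mellin; assumption].
intros t _; cbv beta; ring.
Qed.

Lemma mellin_scal (a c : C) (f : R -> C) (s : R) : (2 <= Re a)%R ->
  bounded_lipschitz f -> mellin a (fun t => c * f t) s = c * mellin a f s.
Proof.
intros Ha Hf. apply is_cint_unique.
eapply is_cint_ext; [lra| |apply is_cint_scal, is_cint_mellin; assumption].
intros t _; cbv beta; ring.
Qed.

Lemma Cmod_mellin_le (a : C) (f : R -> C) (B s : R) : (2 <= Re a)%R ->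
  bounded_lipschitz f -> (forall t, (Cmod (f t) <= B)%R) -> (Cmod (mellin a f s) <= B)%R.
Proof.
intros Ha Hf HB. replace B with ((1 - 0) * B)%R by ring.
apply (Cmod_is_cint_le (fun t => mellin_weight a t * f (s * t)%R) 0 1); [lra| |apply is_cint_mellin; assumption].
intros t Ht. rewrite Cmod_mult. rewrite <- (Rmult_1_l B).
apply Rmult_le_compat; [apply Cmod_ge_0|apply Cmod_ge_0| |apply HB].
apply mellin_weight_le_1; assumption.
Qed.

(** The constants of [f] are inherited unchanged: the weight is at most 1 on [0, 1], and the factor
    [t] contracts [s - s']. *)
Lemma bounded_lipschitz_mellin (a : C) (f : R -> C) : (2 <= Re a)%R ->
  bounded_lipschitz f -> bounded_lipschitz (mellin a f).
Proof.
intros Ha Hf. assert (Hf' := Hf). destruct Hf' as (B & K & H1 & H2).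
exists B, K; split.
- intros s. apply Cmod_mellin_le; assumption.
- intros s s'. replace (K * Rabs (s - s'))%R with ((1 - 0) * (K * Rabs (s - s')))%R by ring.
  apply (Cmod_is_cint_le (fun t => mellin_weight a t * f (s * t)%R + - (1) * (mellin_weight a t * f (s' * t)%R)) 0 1); [lra| |].
  + intros t Ht.
    replace (mellin_weight a t * f (s * t)%R + - (1) * (mellin_weight a t * f (s' * t)%R))
      with (mellin_weight a t * (f (s * t)%R - f (s' * t)%R)) by ring.
    rewrite Cmod_mult, <- (Rmult_1_l (K * _)).
    apply Rmult_le_compat; [apply Cmod_ge_0|apply Cmod_ge_0|apply mellin_weight_le_1; assumption|].
    eapply Rle_trans; [apply H2|]. replace (s * t - s' * t)%R with ((s - s') * t)%R by ring.
    rewrite Rabs_mult, (Rabs_pos_eq t) by lra.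
    assert (HK : (0 <= K)%R).
    { specialize (H2 1%R 0%R). rewrite Rminus_0_r, Rabs_R1 in H2.
      assert (H3 := Cmod_ge_0 (f 1%R - f 0%R)). lra. }
    assert (H3 := Rabs_pos (s - s')). assert (0 <= K * Rabs (s - s'))%R by nra. nra.
  + replace (mellin a f s - mellin a f s') with (mellin a f s + - (1) * mellin a f s') by ring.
    apply is_cint_plus; [|apply is_cint_scal]; apply is_cint_mellin; assumption.
Qed.

Lemma mellin_ext (a : C) (f g : R -> C) (s : R) : (0 <= s <= 1)%R ->
  (forall t, (0 <= t <= 1)%R -> f t = g t) -> mellin a f s = mellin a g s.
Proof.
intros Hs H. unfold mellin, cint. apply (@RInt_ext C_R_CompleteNormedModule).
rewrite Rmin_left, Rmax_right by lra. intros t Ht. f_equal. apply H. nra.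
Qed.

Lemma Re_neq_0 (c : C) : (0 < Re c)%R -> c <> 0.
Proof. intros H E. rewrite E in H. unfold Re in H; simpl in H; lra. Qed.

Lemma Cexp_ln_INR (t : R) (n : nat) : (0 < t)%R -> Cexp (INR n * ln t) = RtoC t ^ n.
Proof.
intros Ht. rewrite <- Cexp_pow. f_equal. unfold Cexp, Re, Im; simpl.
rewrite cos_0, sin_0, exp_ln by exact Ht. apply injective_projections; simpl; ring.
Qed.

Lemma mellin_pow (a : C) (n : nat) (s : R) : (2 <= Re a)%R -> (0 <= s <= 1)%R ->
  mellin a (fun t => clamp t ^ n) s = clamp s ^ n / (a + INR n).
Proof.
intros Ha Hs.
assert (Hn := pos_INR n).
assert (Hre : (2 <= Re (a + INR n))%R) by (unfold Re in *; simpl; lra).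
assert (Han : a + INR n <> 0) by (apply Re_neq_0; lra).
assert (Ham : (0 < Cmod (a + INR n))%R) by (apply Cmod_gt_0; exact Han).
(* The primitive [t ^ (a + n) / (a + n)], extended by 0 to negative [t] because a two-sided
   derivative is required at the endpoint 0. *)
set (P := fun t : R => if Rlt_dec 0 t then / (a + INR n) * Cexp ((a + INR n) * ln t) else 0).
apply is_cint_unique.
apply (is_cint_ext (fun t => RtoC s ^ n * (mellin_weight a t * RtoC t ^ n))); [lra| |].
{ intros t Ht. rewrite clamp_id by nra. rewrite RtoC_mult, Cpow_mult_l. ring. }
replace (clamp s ^ n / (a + INR n)) with (RtoC s ^ n * (P 1%R - P 0%R)).
2:{ unfold P. destruct (Rlt_dec 0 1) as [_|]; [|lra]. destruct (Rlt_dec 0 0) as [|_]; [lra|].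
  rewrite ln_1, Cmult_0_r, Cexp_0, clamp_id by exact Hs. unfold Cdiv; ring. }
apply is_cint_scal, cint_derive; [lra| |].
- intros t Ht. destruct (Req_dec t 0) as [->|Hn0].
  + replace (mellin_weight a 0 * RtoC 0 ^ n) with (RtoC 0).
    2:{ unfold mellin_weight; destruct Rlt_dec; [lra|ring]. }
    (* At the origin the logarithm gives nothing; the derivative is 0 because [P h] is at most
       [h ^ 2 / Cmod (a + INR n)]. *)
    apply rderiv_eps. intros e He.
    exists (Rmin 1 (e * Cmod (a + INR n))); split; [apply Rmin_pos; nra|].
    intros h Hh. rewrite Rplus_0_l.
    assert (M1 := Rmin_l 1 (e * Cmod (a + INR n))). assert (M2 := Rmin_r 1 (e * Cmod (a + INR n))).
    unfold P at 2. destruct (Rlt_dec 0 0) as [|_]; [lra|].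
    replace (P h - 0 - 0 * h) with (P h) by ring.
    unfold P. destruct (Rlt_dec 0 h) as [Hp|Hp].
    2:{ rewrite Cmod_0. assert (H := Rabs_pos h). nra. }
    rewrite Rabs_pos_eq in * by lra.
    replace ((a + INR n) * ln h) with ((a + INR n - 1) * ln h + ln h) by ring.
    rewrite Cexp_plus, !Cmod_mult, Cmod_inv by exact Han.
    assert (B1 : (Cmod (Cexp ((a + INR n - 1) * ln h)) <= h)%R).
    { apply Cmod_Cexp_ln; [lra|]. unfold Re in *; simpl in *; lra. }
    assert (B2 : Cmod (Cexp (ln h)) = h).
    { rewrite Cmod_Cexp. unfold Re; simpl. apply exp_ln; exact Hp. }
    rewrite B2.
    apply Rmult_le_reg_l with (Cmod (a + INR n)); [exact Ham|].
    rewrite <- !Rmult_assoc, Rinv_r, Rmult_1_l by lra.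
    apply Rmult_le_compat_r; [lra|]. eapply Rle_trans; [exact B1|]. lra.
  + apply (rderiv_local (fun t => / (a + INR n) * Cexp ((a + INR n) * ln t)) _ _ _ t); [lra| |].
    { intros u Hu. apply Rabs_def2 in Hu. unfold P. destruct Rlt_dec; [reflexivity|lra]. }
    assert (Htp : (0 < t)%R) by lra.
    replace (mellin_weight a t * RtoC t ^ n)
      with (RtoC (/ t) * (/ (a + INR n) * ((a + INR n) * Cexp ((a + INR n) * ln t)))).
    * apply (rderiv_comp (fun w => / (a + INR n) * Cexp ((a + INR n) * w)) ln).
      -- apply cderiv_scal, cderiv_Cexp_scal.
      -- apply derivable_pt_lim_ln; exact Htp.
    * unfold mellin_weight. destruct Rlt_dec; [|lra].
      rewrite <- Cexp_ln_INR, <- Cexp_plus by exact Htp.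
      replace ((a + INR n) * ln t) with ((a - 1) * ln t + INR n * ln t + INR 1 * ln t) by (simpl; ring).
      rewrite (Cexp_plus (_ + _)), (Cexp_ln_INR t 1) by exact Htp. rewrite RtoC_inv by lra.
      simpl. field. split; [exact Han|]. intros E; apply RtoC_inj in E; lra.
- intros t Ht. apply ccont_mult; [apply mellin_weight_ccont; lra|].
  clear -Ht. induction n as [|n IH]; [exact (ccont_const 1 t)|].
  apply (ccont_mult (fun t => RtoC t) (fun t => RtoC t ^ n)); [|exact IH].
  intros e He; exists e; split; [exact He|]. intros u Hu. rewrite <- RtoC_minus, Cmod_R; exact Hu.
Qed.

Definition mellin_iter (a : C) (S : nat) (f : R -> C) : R -> C := Nat.iter S (mellin a) f.

Lemma bounded_lipschitz_mellin_iter (a : C) (S : nat) (f : R -> C) : (2 <= Re a)%R ->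
  bounded_lipschitz f -> bounded_lipschitz (mellin_iter a S f).
Proof.
intros Ha Hf. induction S as [|S IH]; [exact Hf|]. apply bounded_lipschitz_mellin; assumption.
Qed.

Lemma mellin_iter_ext (a : C) (S : nat) (f g : R -> C) :
  (forall t, (0 <= t <= 1)%R -> f t = g t) ->
  forall t, (0 <= t <= 1)%R -> mellin_iter a S f t = mellin_iter a S g t.
Proof.
intros H; induction S as [|S IH]; [exact H|]. intros t Ht. simpl. apply mellin_ext; assumption.
Qed.

Lemma mellin_iter_lin (a c : C) (S : nat) (f g : R -> C) : (2 <= Re a)%R ->
  bounded_lipschitz f -> bounded_lipschitz g -> forall t, (0 <= t <= 1)%R ->
  mellin_iter a S (fun t => f t + c * g t) t = mellin_iter a S f t + c * mellin_iter a S g t.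
Proof.
intros Ha Hf Hg; induction S as [|S IH]; [reflexivity|]. intros t Ht. simpl.
change (Nat.iter S (mellin a)) with (mellin_iter a S).
rewrite (mellin_ext a _ (fun t => mellin_iter a S f t + c * mellin_iter a S g t) t Ht IH).
rewrite mellin_plus, mellin_scal; auto.
- apply bounded_lipschitz_mellin_iter; assumption.
- apply bounded_lipschitz_mellin_iter; assumption.
- apply bounded_lipschitz_scal, bounded_lipschitz_mellin_iter; assumption.
Qed.

Lemma Cmod_mellin_iter_le (a : C) (S : nat) (f : R -> C) (B : R) : (2 <= Re a)%R ->
  bounded_lipschitz f -> (forall t, (Cmod (f t) <= B)%R) ->
  forall t, (Cmod (mellin_iter a S f t) <= B)%R.
Proof.
intros Ha Hf HB; induction S as [|S IH]; [exact HB|]. intros t. simpl.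
apply Cmod_mellin_le; auto. apply bounded_lipschitz_mellin_iter; assumption.
Qed.

Lemma mellin_iter_pow (a : C) (S n : nat) : (2 <= Re a)%R -> forall t, (0 <= t <= 1)%R ->
  mellin_iter a S (fun t => clamp t ^ n) t = / (a + INR n) ^ S * clamp t ^ n.
Proof.
intros Ha; induction S as [|S IH]; intros t Ht.
- simpl. field.
- simpl. change (Nat.iter S (mellin a)) with (mellin_iter a S).
  rewrite (mellin_ext a _ (fun t => / (a + INR n) ^ S * clamp t ^ n) t Ht IH).
  rewrite mellin_scal, mellin_pow; auto.
  + assert (Hn := pos_INR n).
    assert (Han : a + INR n <> 0) by (apply Re_neq_0; unfold Re in *; simpl; lra).
    field. split; [apply Cpow_nz|]; exact Han.
  + apply bounded_lipschitz_pow, bounded_lipschitz_clamp.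
Qed.

(** Transforming the geometric series in [x t] term by term and evaluating at 1 gives the Lerch
    series for [Cmod x < 1], while the integrand makes sense for every [x] of the sector. *)
Definition mellin_lerch (a : C) (S : nat) (x : C) : C :=
  mellin_iter a S (fun t => / (1 - x * clamp t)) 1.

(** Only finite sums are exchanged with the integrals; the limit is then a uniform bound on the
    remainder, preserved by [Cmod_mellin_iter_le]. *)
Lemma mellin_iter_psum (a h : C) (S N : nat) (f : R -> C) (g : nat -> R -> C) : (2 <= Re a)%R ->
  bounded_lipschitz f -> (forall k, bounded_lipschitz (g k)) ->
  bounded_lipschitz (fun t => f t - psum (fun k => h ^ k * g k t) N) /\
  mellin_iter a S (fun t => f t - psum (fun k => h ^ k * g k t) N) 1 =
  mellin_iter a S f 1 - psum (fun k => h ^ k * mellin_iter a S (g k) 1) N.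
Proof.
intros Ha Hf Hg. induction N as [|N [IH1 IH2]].
- simpl. split.
  + apply (bounded_lipschitz_plus f); [exact Hf|apply bounded_lipschitz_const].
  + rewrite (mellin_iter_ext a S _ f); [ring| |lra]. intros; ring.
- assert (E : forall t, f t - psum (fun k => h ^ k * g k t) (Datatypes.S N) =
     (f t - psum (fun k => h ^ k * g k t) N) + (- h ^ N) * g N t) by (intros; simpl; ring).
  split.
  + assert (K := bounded_lipschitz_plus _ _ IH1 (bounded_lipschitz_scal (- h ^ N) _ (Hg N))).
    destruct K as (B & L & K1 & K2). exists B, L; split; intros; rewrite !E; auto.
  + rewrite (mellin_iter_ext a S _ _ (fun t _ => E t)) by lra.
    rewrite mellin_iter_lin; auto; [|lra].
    rewrite IH2. simpl; ring.
Qed.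

(* Expand [1 / (1 - x t)] around [x = x0], uniformly for [t] in [0, 1]. *)
Lemma mellin_lerch_series (a x0 h : C) (S : nat) (d : R) : (2 <= Re a)%R ->
  (forall t, (0 <= t <= 1)%R -> (d <= Cmod (1 - x0 * t))%R) -> (Cmod h < d)%R ->
  cseries (fun k => mellin_iter a S (fun t => clamp t ^ k * (/ (1 - x0 * clamp t)) ^ (Datatypes.S k)) 1 * h ^ k)
    (mellin_lerch a S (x0 + h)).
Proof.
intros Ha Hd Hh. assert (Hh0 := Cmod_ge_0 h).
set (u := fun t : R => / (1 - x0 * clamp t)).
set (g := fun (k : nat) (t : R) => clamp t ^ k * u t ^ (Datatypes.S k)).
assert (Hlin : forall x, bounded_lipschitz (fun t => 1 - x * clamp t)).
{ intros x. destruct (bounded_lipschitz_plus _ _ (bounded_lipschitz_const 1)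
    (bounded_lipschitz_scal (- x) _ bounded_lipschitz_clamp)) as (B & K & K1 & K2).
  assert (E : forall t, 1 - x * clamp t = 1 + - x * clamp t) by (intros; ring).
  exists B, K; split; intros; rewrite !E; auto. }
assert (Hd0 : forall t, (d <= Cmod (1 - x0 * clamp t))%R) by (intros t; apply Hd, clamp_bounds).
assert (Hd1 : forall t, (d - Cmod h <= Cmod (1 - (x0 + h) * clamp t))%R).
{ intros t. assert (T := Cmod_triangle (1 - (x0 + h) * clamp t) (h * clamp t)).
  replace (1 - (x0 + h) * clamp t + h * clamp t) with (1 - x0 * clamp t) in T by ring.
  rewrite Cmod_mult, Cmod_R in T. assert (B := clamp_bounds t).
  rewrite (Rabs_pos_eq (clamp t)) in T by lra. specialize (Hd0 t). nra. }
assert (Hu : bounded_lipschitz u) by (apply (bounded_lipschitz_inv _ d); auto; lra).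
assert (Hf : bounded_lipschitz (fun t => / (1 - (x0 + h) * clamp t)))
  by (apply (bounded_lipschitz_inv _ (d - Cmod h)); auto; lra).
assert (Hg : forall k, bounded_lipschitz (g k)).
{ intros k. apply bounded_lipschitz_mult; apply bounded_lipschitz_pow;
  [apply bounded_lipschitz_clamp|exact Hu]. }
assert (Hn0 : forall t, 1 - x0 * clamp t <> 0)
  by (intros t; apply Cmod_gt_0; specialize (Hd0 t); lra).
assert (Hn1 : forall t, 1 - (x0 + h) * clamp t <> 0)
  by (intros t; apply Cmod_gt_0; specialize (Hd1 t); lra).
set (rho := (Cmod h / d)%R).
assert (Hr : (0 <= rho < 1)%R).
{ split; [apply Rdiv_le_0_compat; lra|]. unfold rho.
  apply Rmult_lt_reg_r with d; [lra|]. field_simplify; lra. }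
(* The remainder of a finite geometric sum of ratio [h * clamp t * u t], whose modulus is at most
   [rho] for all [t]. *)
assert (Hrem : forall N t, / (1 - (x0 + h) * clamp t) - psum (fun k => h ^ k * g k t) N =
   (h * clamp t * u t) ^ N * / (1 - (x0 + h) * clamp t)).
{ intros N t. specialize (Hn0 t). specialize (Hn1 t).
  assert (Hut : u t * (1 - x0 * clamp t) = 1) by (unfold u; field; exact Hn0).
  induction N as [|N IH]; [simpl; ring|].
  replace (psum (fun k => h ^ k * g k t) (Datatypes.S N))
    with (psum (fun k => h ^ k * g k t) N + h ^ N * g N t) by reflexivity.
  replace (/ (1 - (x0 + h) * clamp t) - (psum (fun k => h ^ k * g k t) N + h ^ N * g N t))
    with ((/ (1 - (x0 + h) * clamp t) - psum (fun k => h ^ k * g k t) N) - h ^ N * g N t) by ring.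
  rewrite IH. unfold g. rewrite !Cpow_mult_l, !Cpow_S.
  generalize (u t ^ N) (h ^ N) (RtoC (clamp t) ^ N). intros p q r.
  replace (u t) with (/ (1 - x0 * clamp t)) by reflexivity.
  field. split; assumption. }
apply cseries_eps. intros e He.
destruct (pow_lt_1_zero rho) with (y := (e * (d - Cmod h))%R) as [N HN].
- rewrite Rabs_pos_eq; lra.
- nra.
- exists N. intros n Hn. specialize (HN n Hn). rewrite Rabs_pos_eq in HN by (apply pow_le; lra).
  destruct (mellin_iter_psum a h S n _ g Ha Hf Hg) as [K1 K2].
  rewrite Cmod_sub_sym. unfold mellin_lerch.
  rewrite (psum_ext _ (fun k => h ^ k * mellin_iter a S (g k) 1)) by (intros; apply Cmult_comm).
  rewrite <- K2.
  apply Rle_lt_trans with (rho ^ n * / (d - Cmod h))%R.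
  + apply Cmod_mellin_iter_le; [exact Ha|exact K1|].
    intros t. rewrite Hrem, Cmod_mult, Cmod_pow, Cmod_inv by apply Hn1.
    apply Rmult_le_compat.
    * apply pow_le, Cmod_ge_0.
    * apply Rlt_le, Rinv_0_lt_compat. specialize (Hd1 t); lra.
    * apply pow_incr. split; [apply Cmod_ge_0|].
      rewrite !Cmod_mult, Cmod_R. assert (B := clamp_bounds t).
      rewrite (Rabs_pos_eq (clamp t)) by lra. unfold u. rewrite Cmod_inv by apply Hn0.
      unfold rho, Rdiv. apply Rmult_le_compat.
      -- nra.
      -- apply Rlt_le, Rinv_0_lt_compat. specialize (Hd0 t); lra.
      -- nra.
      -- apply Rinv_le_contravar; [lra|apply Hd0].
    * apply Rinv_le_contravar; [lra|apply Hd1].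
  + apply Rmult_lt_reg_r with (d - Cmod h)%R; [lra|].
    rewrite Rmult_assoc, Rinv_l by lra. lra.
Qed.

(** The minimum over the compact interval is attained, and it is positive since [t * x] stays in the
    sector. It is the radius of the expansion around [x]. *)
Lemma sector_segment_dist (x : C) : lerch_sector x -> exists d, (0 < d)%R /\
  forall t, (0 <= t <= 1)%R -> (d <= Cmod (1 - x * t))%R.
Proof.
intros Hx.
destruct (continuity_ab_min (fun t => Cmod (1 - x * t)) 0 1 ltac:(lra)) as (m & Hm & Hm01).
- intros t _ e He. assert (Hc := Cmod_ge_0 x).
  exists (e / (Cmod x + 1))%R. split; [apply Rdiv_lt_0_compat; lra|].
  intros s [_ Hs]. simpl in *. unfold R_dist in *.
  assert (K : (Cmod (1 - x * s - (1 - x * t)) < e)%R).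
  { replace (1 - x * s - (1 - x * t)) with (- (x * (s - t)%R)) by (rewrite RtoC_minus; ring).
    rewrite Cmod_opp, Cmod_mult, Cmod_R.
    apply Rle_lt_trans with (Cmod x * (e / (Cmod x + 1)))%R; [apply Rmult_le_compat_l; lra|].
    apply Rmult_lt_reg_r with (Cmod x + 1)%R; [lra|]. field_simplify; lra. }
  assert (T1 := Cmod_triangle (1 - x * s - (1 - x * t)) (1 - x * t)).
  assert (T2 := Cmod_triangle (- (1 - x * s - (1 - x * t))) (1 - x * s)).
  rewrite Cmod_opp in T2.
  replace (1 - x * s - (1 - x * t) + (1 - x * t)) with (1 - x * s) in T1 by ring.
  replace (- (1 - x * s - (1 - x * t)) + (1 - x * s)) with (1 - x * t) in T2 by ring.
  apply Rabs_def1; lra.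
- exists (Cmod (1 - x * m)); split; [|exact Hm].
  apply Cmod_gt_0. rewrite Cmult_comm. apply lerch_sector_ne_1.
  apply lerch_sector_scal; assumption.
Qed.

(** One expansion serves twice: centred at 0 with [d = 1] it is the defining series, centred at [z]
    it gives analyticity. *)
Lemma lerch_branch_mellin (a : C) (S : nat) : (2 <= Re a)%R ->
  is_lerch_branch (Z.of_nat S) a (mellin_lerch a S).
Proof.
intros Ha. split.
- intros z Hz.
  assert (K := mellin_lerch_series a 0 z S 1 Ha).
  replace (mellin_lerch a S z) with (mellin_lerch a S (0 + z)) by (f_equal; ring).
  eapply cseries_ext; [|apply K].
  + intros n; cbv beta. rewrite (mellin_iter_ext a S _ (fun t => clamp t ^ n)) by
      (try lra; intros; replace (1 - 0 * clamp t) with (RtoC 1) by ring;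
       replace (/ 1) with (RtoC 1) by (field; intros E; apply RtoC_inj in E; lra);
       rewrite Cpow_1_l; ring).
    rewrite mellin_iter_pow by (try lra; exact Ha). rewrite clamp_id, Cpow_1_l, Cpowz_of_nat by lra.
    unfold Cdiv; ring.
  + intros t _. replace (1 - 0 * t) with (RtoC 1) by ring. rewrite Cmod_1; lra.
  + exact Hz.
- intros z Hz. destruct (sector_segment_dist z Hz) as (d & Hd & K).
  eexists. apply is_taylor_cseries. exists d; split; [exact Hd|]. intros w Hw.
  replace (mellin_lerch a S w) with (mellin_lerch a S (z + (w - z))) by (f_equal; ring).
  apply (mellin_lerch_series a z (w - z) S d); assumption.
Qed.

(** * The exterior of the unit disc *)

Lemma lerch_branch_shift_nat (S : Z) (a : C) (N : nat) :
  (exists F, is_lerch_branch S (a + INR N) F) -> exists F, is_lerch_branch S a F.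
Proof.
revert a; induction N as [|N IH]; intros a.
- simpl. rewrite Cplus_0_r. auto.
- intros H. destruct (IH (a + 1)) as [F HF].
  + rewrite S_INR, RtoC_plus in H. replace (a + 1 + INR N) with (a + (INR N + 1)) by ring. exact H.
  + eexists. apply lerch_branch_shift; exact HF.
Qed.

Lemma lerch_branch_exists_pos (S : nat) (a : C) : exists F, is_lerch_branch (Z.of_nat S) a F.
Proof.
destruct (INR_unbounded (2 - Re a)) as [N HN].
apply (lerch_branch_shift_nat _ a N). exists (mellin_lerch (a + INR N) S).
apply lerch_branch_mellin. unfold Re in *; simpl; lra.
Qed.

Lemma lerch_branch_exists_neg (S : nat) (a : C) : exists F, is_lerch_branch (- Z.of_nat S) a F.
Proof.
induction S as [|S [F HF]]; [eexists; apply lerch_branch_0|].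
destruct (lerch_branch_pred (- Z.of_nat S) a F) as (G & HG & _); [left; lia|exact HF|].
exists G. replace (- Z.of_nat (Datatypes.S S))%Z with (- Z.of_nat S - 1)%Z by lia. exact HG.
Qed.

(** What gives the epsilon in [Lerch] its meaning. It holds for all [a], since [/ 0 = 0] keeps each
    coefficient defined. *)
Lemma lerch_branch_exists (S : Z) (a : C) : exists F, is_lerch_branch S a F.
Proof.
destruct (Z_le_gt_dec S 0) as [H|H].
- replace S with (- Z.of_nat (Z.to_nat (- S)))%Z by lia. apply lerch_branch_exists_neg.
- replace S with (Z.of_nat (Z.to_nat S)) by lia. apply lerch_branch_exists_pos.
Qed.

(** A uniform gap between [a] and the integers handles small [k], the triangle inequality large [k].
    The linear growth makes the series of order at least 2 absolutely convergent on the unit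
    circle. *)
Lemma dist_integers (a : C) : (forall k : Z, a <> IZR k) ->
  exists d, (0 < d)%R /\ forall k : Z, (d * (Rabs (IZR k) + 1) <= Cmod (a + IZR k))%R.
Proof.
intros Ha.
assert (H : exists d, (0 < d)%R /\ forall k : Z, (d <= Cmod (a + IZR k))%R).
{ destruct (Req_dec (Im a) 0) as [Him|Him].
  - set (r := Re a).
    assert (Har : a = RtoC r) by (apply injective_projections; [reflexivity|exact Him]).
    destruct (archimed r) as [U1 U2]. set (n := up r) in *.
    assert (U3 : (r <> IZR n - 1)%R).
    { intros E. apply (Ha (n - 1)%Z). rewrite Har, minus_IZR, E. reflexivity. }
    (* A real [a] lies strictly between the integers [n - 1] and [n], and [- k] is beyond one of
       them. *)
    exists (Rmin (IZR n - r) (r - (IZR n - 1))); split; [apply Rmin_pos; lra|].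
    intros k. rewrite Har, <- RtoC_plus, Cmod_R.
    assert (M1 := Rmin_l (IZR n - r) (r - (IZR n - 1))).
    assert (M2 := Rmin_r (IZR n - r) (r - (IZR n - 1))).
    destruct (Z_lt_le_dec (- k) n) as [Hk|Hk].
    + assert (Hk' : (- k <= n - 1)%Z) by lia. apply IZR_le in Hk'.
      rewrite opp_IZR, minus_IZR in Hk'. assert (K := Rle_abs (r + IZR k)). lra.
    + apply IZR_le in Hk. rewrite opp_IZR in Hk.
      assert (K := Rle_abs (- (r + IZR k))). rewrite Rabs_Ropp in K. lra.
  - exists (Rabs (Im a)); split; [apply Rabs_pos_lt; exact Him|].
    intros k. replace (Im a) with (Im (a + IZR k)) by (unfold Im; simpl; ring).
    apply Im_le_Cmod. }
destruct H as (d & Hd & H).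
assert (Hca := Cmod_ge_0 a).
(* Chosen so that [Rabs k + 1 <= Cmod (a + k) + (Cmod a + 1) <= c * Cmod (a + k)]. *)
set (c := (1 + (Cmod a + 1) / d)%R).
assert (Hc : (0 < c)%R).
{ unfold c. assert (0 < (Cmod a + 1) / d)%R by (apply Rdiv_lt_0_compat; lra). lra. }
exists (/ c)%R; split; [apply Rinv_0_lt_compat; exact Hc|]. intros k.
specialize (H k).
assert (T : (Rabs (IZR k) <= Cmod (a + IZR k) + Cmod a)%R).
{ rewrite <- Cmod_R, <- (Cmod_opp a).
  replace (RtoC (IZR k)) with (a + IZR k + - a) at 1 by ring. apply Cmod_triangle. }
apply Rmult_le_reg_l with c; [exact Hc|].
rewrite <- Rmult_assoc, Rinv_r, Rmult_1_l by lra.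
unfold c. apply Rle_trans with (Cmod (a + IZR k) + (Cmod a + 1) / d * d)%R.
- unfold Rdiv. rewrite Rmult_assoc, Rinv_l by lra. lra.
- rewrite Rmult_plus_distr_r, Rmult_1_l. apply Rplus_le_compat_l, Rmult_le_compat_l; [|exact H].
  apply Rlt_le, Rdiv_lt_0_compat; lra.
Qed.

(* Coefficients of the exterior series in the variable [1 / x]. *)
Definition ext_coef (S : Z) (a : C) (n : nat) : C :=
  match n with O => 0 | _ => / Cpowz (a - INR n) S end.

Definition lerch_ext (S : Z) (a y : C) : C := csum (fun n => ext_coef S a n * y ^ n).

Lemma ext_coef_pred (S : Z) (a : C) (n : nat) :
  ((S <= 0)%Z \/ forall k : Z, a <> IZR k) ->
  (a - INR n) * ext_coef S a n = ext_coef (S - 1) a n.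
Proof.
intros H. destruct n as [|n]; [simpl; ring|]. unfold ext_coef. apply Cpowz_pred.
destruct H as [H|H]; [right; exact H|left].
intros E. apply (H (Z.of_nat (Datatypes.S n))). rewrite <- INR_IZR_INZ.
replace a with (a - INR (Datatypes.S n) + INR (Datatypes.S n)) by ring. rewrite E; ring.
Qed.

Definition ext_converges (S : Z) (a : C) : Prop :=
  forall y, (Cmod y < 1)%R -> cseries (fun n => ext_coef S a n * y ^ n) (lerch_ext S a y).

(** In [y = 1 / x] the operator [a + x d/dx] becomes [a - y d/dy], and it multiplies the coefficient
    of [y ^ n] by [a - n]. *)
Lemma lerch_ext_pred (S : Z) (a : C) :
  ((S <= 0)%Z \/ forall k : Z, a <> IZR k) -> ext_converges S a ->
  ext_converges (S - 1) a /\
  forall y, (Cmod y < 1)%R -> exists l, cderiv (lerch_ext S a) y l /\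
    lerch_ext (S - 1) a y = a * lerch_ext S a y - y * l.
Proof.
intros Ha Hc.
assert (K : forall y, (Cmod y < 1)%R -> exists l, cderiv (lerch_ext S a) y l /\
   cseries (fun n => ext_coef (S - 1) a n * y ^ n) (a * lerch_ext S a y - y * l)).
{ intros y Hy.
  destruct (cpower_series_deriv _ _ 1 Hc y Hy) as (l & Hl & Hd).
  exists l; split; [exact Hd|].
  set (d := fun n => INR n * ext_coef S a n * y ^ n).
  assert (S1 : cseries d (d O + y * l)).
  { apply cseries_incr. eapply cseries_ext; [|apply (cseries_scal y), Hl].
    intros n; unfold d; cbv beta; simpl Cpow; ring. }
  replace (a * lerch_ext S a y - y * l) with (a * lerch_ext S a y + - (1) * (d O + y * l))
    by (unfold d; simpl; ring).
  eapply cseries_ext; [|apply cseries_plus; [apply (cseries_scal a), (Hc y Hy)|apply cseries_scal, S1]].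
  intros n; unfold d; cbv beta. rewrite <- ext_coef_pred by exact Ha. ring. }
split.
- intros y Hy. destruct (K y Hy) as (l & _ & Hs). apply csum_correct. exists (a * lerch_ext S a y - y * l). exact Hs.
- intros y Hy. destruct (K y Hy) as (l & Hd & Hs). exists l; split; [exact Hd|].
  apply csum_unique; exact Hs.
Qed.

Lemma ext_series_0 (a y : C) : (Cmod y < 1)%R ->
  cseries (fun n => ext_coef 0 a n * y ^ n) (y / (1 - y)).
Proof.
intros Hy. set (u := fun n => ext_coef 0 a n * y ^ n).
replace (y / (1 - y)) with (u O + y * / (1 - y)) by (unfold u, Cdiv; simpl; ring).
apply cseries_incr. eapply cseries_ext; [|apply (cseries_scal y), cseries_geom, Hy].
intros n; unfold u; cbv beta. unfold ext_coef, Cpowz.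
replace (/ 1) with (RtoC 1) by (field; intros E; apply RtoC_inj in E; lra). simpl; ring.
Qed.

Lemma ext_converges_neg (S : nat) (a : C) : ext_converges (- Z.of_nat S) a.
Proof.
induction S as [|S IH].
- intros y Hy. apply csum_correct. exists (y / (1 - y)). apply ext_series_0, Hy.
- replace (- Z.of_nat (Datatypes.S S))%Z with (- Z.of_nat S - 1)%Z by lia.
  apply lerch_ext_pred; [left; lia|exact IH].
Qed.

Lemma Cmod_inv_shift_le (a : C) (d : R) (S : nat) : (0 < d)%R ->
  (forall k : Z, (d * (Rabs (IZR k) + 1) <= Cmod (a + IZR k))%R) ->
  forall k : Z, (Cmod (/ (a + IZR k) ^ S) <= (/ d) ^ S * (/ (Rabs (IZR k) + 1)) ^ S)%R.
Proof.
intros Hd H k. specialize (H k). assert (Hk := Rabs_pos (IZR k)).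
assert (Hp : (0 < d * (Rabs (IZR k) + 1))%R) by nra.
assert (Hn : a + IZR k <> 0) by (apply Cmod_gt_0; lra).
rewrite Cmod_inv by (apply Cpow_nz; exact Hn). rewrite Cmod_pow, <- pow_inv, <- Rpow_mult_distr, <- Rinv_mult.
apply pow_incr. split; [apply Rlt_le, Rinv_0_lt_compat, Cmod_gt_0, Hn|].
apply Rinv_le_contravar; assumption.
Qed.

Lemma ext_coef_le (a : C) (d : R) (S : nat) : (0 < d)%R ->
  (forall k : Z, (d * (Rabs (IZR k) + 1) <= Cmod (a + IZR k))%R) ->
  forall n, (Cmod (ext_coef (Z.of_nat S) a n) <= (/ d) ^ S * (/ (INR n + 1)) ^ S)%R.
Proof.
intros Hd H n. assert (Hn := pos_INR n).
assert (Hn1 : (0 < / (INR n + 1))%R) by (apply Rinv_0_lt_compat; lra).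
assert (Hd' : (0 < / d)%R) by (apply Rinv_0_lt_compat; lra).
destruct n as [|n].
- simpl ext_coef. rewrite Cmod_0. apply Rmult_le_pos; apply pow_le; lra.
- unfold ext_coef. rewrite Cpowz_of_nat.
  assert (K := Cmod_inv_shift_le a d S Hd H (- Z.of_nat (Datatypes.S n))).
  rewrite opp_IZR, <- INR_IZR_INZ, Rabs_Ropp, (Rabs_pos_eq (INR _)), RtoC_opp in K by lra.
  exact K.
Qed.

Lemma ext_converges_pos (S : nat) (a : C) : (forall k : Z, a <> IZR k) ->
  ext_converges (Z.of_nat S) a.
Proof.
intros Ha y Hy. destruct (dist_integers a Ha) as (d & Hd & H).
apply csum_correct. apply (cseries_abs _ (fun n => (/ d) ^ S * Cmod y ^ n)%R).
- intros n. rewrite Cmod_mult, Cmod_pow. apply Rmult_le_compat_r; [apply pow_le, Cmod_ge_0|].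
  eapply Rle_trans; [apply (ext_coef_le a d S Hd H)|].
  assert (Hd' : (0 < / d)%R) by (apply Rinv_0_lt_compat; lra). assert (Hn := pos_INR n).
  rewrite <- (Rmult_1_r ((/ d) ^ S)) at 2. apply Rmult_le_compat_l; [apply pow_le; lra|].
  apply Rle_trans with (1 ^ S)%R; [|rewrite pow1; lra]. apply pow_incr. split.
  + apply Rlt_le, Rinv_0_lt_compat; lra.
  + rewrite <- Rinv_1. apply Rinv_le_contravar; lra.
- apply (ex_series_scal (V := R_NormedModule) ((/ d) ^ S)%R (fun n => Cmod y ^ n)%R).
  apply ex_series_geom. rewrite Rabs_pos_eq; [exact Hy|apply Cmod_ge_0].
Qed.

Lemma ext_converges_all (S : Z) (a : C) : ((1 <= S)%Z -> forall k : Z, a <> IZR k) ->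
  ext_converges S a.
Proof.
intros Ha. destruct (Z_le_gt_dec S 0) as [H|H].
- replace S with (- Z.of_nat (Z.to_nat (- S)))%Z by lia. apply ext_converges_neg.
- replace S with (Z.of_nat (Z.to_nat S)) by lia. apply ext_converges_pos. apply Ha; lia.
Qed.

(** * The equation in the logarithmic variable *)

Definition half_strip (L : C) : Prop := (0 < Re L)%R /\ (Rabs (Im L) < PI)%R.

Lemma half_strip_open (L : C) : half_strip L ->
  exists r, (0 < r)%R /\ forall w, (Cmod (w - L) < r)%R -> half_strip w.
Proof.
intros [H1 H2]. exists (Rmin (Re L) (PI - Rabs (Im L))). split; [apply Rmin_pos; lra|].
intros w Hw. assert (M1 := Rmin_l (Re L) (PI - Rabs (Im L))). assert (M2 := Rmin_r (Re L) (PI - Rabs (Im L))).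
assert (A1 := Re_le_Cmod (w - L)). assert (A2 := Im_le_Cmod (w - L)).
replace (Re (w - L)) with (Re w - Re L)%R in A1 by (unfold Re; simpl; ring).
replace (Im (w - L)) with (Im w - Im L)%R in A2 by (unfold Im; simpl; ring).
split.
- assert (B := Rle_abs (- (Re w - Re L))). rewrite Rabs_Ropp in B. lra.
- assert (B := Rabs_triang (Im w - Im L) (Im L)).
  replace (Im w - Im L + Im L)%R with (Im w) in B by ring. lra.
Qed.

(** Convexity is a benefit of the logarithm: the cut exterior in [z] is not convex, but integration
    along segments works in [L]. *)
Lemma half_strip_segment (z w : C) (t : R) : half_strip z -> half_strip w ->
  (0 <= t <= 1)%R -> half_strip (z + t * (w - z)).
Proof.
intros [H1 H2] [H3 H4] Ht. unfold half_strip, Re, Im in *; simpl.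
apply Rabs_def2 in H2. apply Rabs_def2 in H4. split.
- destruct (Rle_or_lt t 0); nra.
- apply Rabs_def1; destruct (Rle_or_lt t 0); nra.
Qed.

Lemma lerch_sector_opp_Cexp (L : C) : (Rabs (Im L) < PI)%R -> lerch_sector (- Cexp L).
Proof.
intros H. apply lerch_sector_iff. unfold Cexp, Re, Im in *; simpl.
assert (He := exp_pos (fst L)).
destruct (Req_dec (sin (snd L)) 0) as [E|E].
- right. rewrite (sin_0_lt_PI _ E H), cos_0. lra.
- left. apply Ropp_neq_0_compat, Rmult_integral_contrapositive. split; [lra|exact E].
Qed.

Lemma Cmod_opp_Cexp_opp_lt (L : C) : (0 < Re L)%R -> (Cmod (- Cexp (- L)) < 1)%R.
Proof.
intros H. rewrite Cmod_opp, Cmod_Cexp, <- exp_0. apply exp_increasing.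
unfold Re in *; simpl; lra.
Qed.

(* [z ^ a (Phi (- z, S, a) + exterior series)] in the variable [L = ln z]. *)
Definition exterior_sum (S : Z) (a : C) (F : C -> C) (L : C) : C :=
  Cexp (a * L) * (F (- Cexp L) + lerch_ext S a (- Cexp (- L))).

Lemma cderiv_opp_Cexp_scal (c z : C) :
  cderiv (fun w => - Cexp (c * w)) z (- (c * Cexp (c * z))).
Proof. apply cderiv_opp, cderiv_Cexp_scal. Qed.

(** Differentiation in [L] acts as [x d/dx] on the branch and as [- y d/dy] on the exterior series;
    the factor [Cexp (a * L)] supplies the term [a] of both operators. *)
Lemma cderiv_exterior_sum (S : Z) (a : C) (F G : C -> C) (L : C) :
  ((1 <= S)%Z -> forall k : Z, a <> IZR k) ->
  is_lerch_branch S a F -> is_lerch_branch (S - 1) a G -> half_strip L ->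
  cderiv (exterior_sum S a F) L (exterior_sum (S - 1) a G L).
Proof.
intros Ha HF HG [H1 H2].
assert (Ha' : (S <= 0)%Z \/ forall k : Z, a <> IZR k)
  by (destruct (Z_le_gt_dec S 0); [left; lia|right; apply Ha; lia]).
assert (Han : (S <= 0)%Z \/ forall n : nat, a + INR n <> 0).
{ destruct Ha' as [?|K]; [left; assumption|right]. intros n E.
  apply (K (- Z.of_nat n)%Z). rewrite opp_IZR, <- INR_IZR_INZ, RtoC_opp.
  replace a with (a + INR n - INR n) by ring. rewrite E; ring. }
destruct (lerch_branch_ode S a F G Han HF HG _ (lerch_sector_opp_Cexp L H2)) as (l & Hl & El).
destruct (proj2 (lerch_ext_pred S a Ha' (ext_converges_all S a Ha)) _
  (Cmod_opp_Cexp_opp_lt L H1)) as (m & Hm & Em).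
unfold exterior_sum. rewrite El, Em.
assert (D1 : cderiv (fun w => F (- Cexp w)) L (- Cexp L * l)).
{ apply (cderiv_comp F (fun w => - Cexp w)); [exact Hl|]. apply cderiv_opp, cderiv_Cexp. }
assert (D2 : cderiv (fun w => lerch_ext S a (- Cexp (- w))) L (Cexp (- L) * m)).
{ apply (cderiv_comp (lerch_ext S a) (fun w => - Cexp (- w))); [exact Hm|].
  apply (cderiv_ext (fun w => - Cexp (- (1) * w)) _ _ (- (- (1) * Cexp (- (1) * L)))).
  - intros w; do 2 f_equal; ring.
  - replace (- (1) * L) with (- L) by ring. ring.
  - apply cderiv_opp_Cexp_scal. }
assert (D := cderiv_mult _ _ _ _ _ (cderiv_Cexp_scal a L) (cderiv_plus _ _ _ _ _ D1 D2)).
eapply cderiv_ext; [|  |exact D]; [intros w; reflexivity|cbv beta; ring].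
Qed.

(** For [S = 0] both parts are geometric: with [x = - Cexp L] they are [1 / (1 - x)] and
    [(1 / x) / (1 - 1 / x)], of sum 0. *)
Lemma exterior_sum_0 (a : C) (F : C -> C) (L : C) :
  is_lerch_branch 0 a F -> half_strip L -> exterior_sum 0 a F L = 0.
Proof.
intros HF [H1 H2]. unfold exterior_sum.
assert (Hx := lerch_sector_opp_Cexp L H2). assert (Hy := Cmod_opp_Cexp_opp_lt L H1).
rewrite (lerch_branch_unique 0 a F _ HF (lerch_branch_0 a) _ Hx).
unfold lerch_ext. rewrite (csum_unique _ _ (ext_series_0 a _ Hy)).
assert (N1 := lerch_sector_ne_1 _ Hx). assert (N2 := ne_1_of_Cmod_lt _ Hy).
rewrite Cexp_opp in *. assert (N3 := Cexp_neq_0 L).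
replace (/ (1 - - Cexp L) + - / Cexp L / (1 - - / Cexp L)) with (RtoC 0); [ring|].
set (x := Cexp L) in *.
assert (N4 : x + 1 <> 0) by (replace (x + 1) with (1 - - x) by ring; exact N1).
field; repeat split; intros E; first [exact (N3 E)|apply N4; rewrite <- E; ring].
Qed.

Lemma exterior_sum_neg (n : nat) (a : C) (F : C -> C) (L : C) :
  is_lerch_branch (- Z.of_nat n) a F -> half_strip L ->
  exterior_sum (- Z.of_nat n) a F L = 0.
Proof.
revert F L; induction n as [|n IH]; intros G L HG HL; [apply exterior_sum_0; assumption|].
destruct (lerch_branch_exists (- Z.of_nat n) a) as [F HF].
replace (- Z.of_nat (S n))%Z with (- Z.of_nat n - 1)%Z in * by lia.
assert (D := cderiv_exterior_sum (- Z.of_nat n) a F G L ltac:(lia) HF HG HL).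
apply (cderiv_unique _ _ _ _ D).
destruct (half_strip_open L HL) as (r & Hr & Ho).
apply (cderiv_local (fun _ => 0) _ _ _ r Hr); [|apply cderiv_const].
intros w Hw. symmetry. apply IH; [exact HF|apply Ho, Hw].
Qed.

(** * Successive primitives and their constants *)

Definition exp_term (m : nat) (L : C) : C := L ^ m / INR (fact m).

(** Indexed so that differentiation lowers [S] and keeps [q], the [j]-th constant entering at
    [S = j + 1]. *)
Definition exp_poly (q : nat -> C) (S : nat) (L : C) : C :=
  psum (fun j => q j * exp_term (S - 1 - j) L) S.

Lemma INR_fact_neq_0_C (n : nat) : RtoC (INR (fact n)) <> 0.
Proof. intros E; apply RtoC_inj in E. exact (INR_fact_neq_0 n E). Qed.

Lemma cderiv_pow (n : nat) (z : C) : cderiv (fun w => w ^ S n) z (INR (S n) * z ^ n).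
Proof.
induction n as [|n IH].
- apply (cderiv_ext (fun w => w) _ _ 1); [intros; simpl; ring|simpl; ring|apply cderiv_id].
- eapply cderiv_ext; [| |apply (cderiv_mult (fun w => w) _ z _ _ (cderiv_id z) IH)].
  + intros w; simpl; ring.
  + rewrite (S_INR (S n)), RtoC_plus. simpl Cpow. ring.
Qed.

Lemma cderiv_exp_term (m : nat) (z : C) : cderiv (exp_term (S m)) z (exp_term m z).
Proof.
apply (cderiv_ext (fun w => / INR (fact (S m)) * w ^ S m) _ _ (/ INR (fact (S m)) * (INR (S m) * z ^ m))).
- intros w; unfold exp_term, Cdiv; ring.
- unfold exp_term. rewrite fact_simpl, mult_INR, RtoC_mult. field. split.
  + apply INR_fact_neq_0_C.
  + intros E; apply RtoC_inj in E. exact (not_0_INR _ (Nat.neq_succ_0 m) E).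
- apply cderiv_scal, cderiv_pow.
Qed.

Lemma cderiv_psum (f : nat -> C -> C) (l : nat -> C) (z : C) (n : nat) :
  (forall k, (k < n)%nat -> cderiv (f k) z (l k)) ->
  cderiv (fun w => psum (fun k => f k w) n) z (psum l n).
Proof.
induction n as [|n IH]; intros H; simpl; [apply cderiv_const|].
apply cderiv_plus; [apply IH; intros; apply H; lia|apply H; lia].
Qed.

Lemma cderiv_exp_poly (q : nat -> C) (S : nat) (z : C) :
  cderiv (exp_poly q (Datatypes.S S)) z (exp_poly q S z).
Proof.
unfold exp_poly. simpl psum.
replace (psum (fun j => q j * exp_term (S - 1 - j) z) S)
  with (psum (fun j => q j * exp_term (S - 1 - j) z) S + 0) by ring.
apply cderiv_plus.
- apply cderiv_psum. intros k Hk. apply cderiv_scal.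
  replace (S - 0 - k)%nat with (Datatypes.S (S - 1 - k)) by lia. apply cderiv_exp_term.
- replace (S - 0 - S)%nat with O by lia.
  apply (cderiv_ext (fun _ => q S) _ _ 0); [|reflexivity|apply cderiv_const].
  intros w; unfold exp_term; simpl. field.
Qed.

(** Strong recursion by finite approximations: [qs N] carries the first [N] values, and the locality
    of [step] makes them stable. *)
Lemma course_of_values (step : nat -> (nat -> C) -> C) :
  (forall n p p', (forall k, (k < n)%nat -> p k = p' k) -> step n p = step n p') ->
  exists q, forall n, q n = step n q.
Proof.
intros Hs.
set (qs := fix qs N : nat -> C := match N with
  | O => fun _ => RtoC 0 | S M => fun j => if Nat.eqb j M then step M (qs M) else qs M j end).
assert (Hst : forall N k, (k < N)%nat -> qs N k = qs (S k) k).
{ induction N as [|N IH]; intros k Hk; [lia|].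
  simpl. destruct (Nat.eqb_spec k N) as [->|Hne].
  - rewrite Nat.eqb_refl; reflexivity.
  - rewrite IH by lia. simpl. reflexivity. }
exists (fun k => qs (S k) k). intros n. simpl. rewrite Nat.eqb_refl.
apply Hs. intros k Hk. rewrite Hst by exact Hk. reflexivity.
Qed.

(** By induction the difference of both sides has derivative zero on the convex half-strip, and the
    choice of [q] makes it vanish at 1. The same [q] serves all [S]. *)
Lemma exterior_sum_pos (a : C) : (forall k : Z, a <> IZR k) ->
  exists q, forall (S : nat) (F : C -> C), is_lerch_branch (Z.of_nat S) a F ->
    forall L, half_strip L -> exterior_sum (Z.of_nat S) a F L = exp_poly q S L.
Proof.
intros Ha.
set (Fs := fun S : nat => epsilon (inhabits (fun _ : C => RtoC 0)) (is_lerch_branch (Z.of_nat S) a)).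
assert (HFs : forall S, is_lerch_branch (Z.of_nat S) a (Fs S)).
{ intros S. unfold Fs. apply epsilon_spec. apply lerch_branch_exists. }
assert (H1 : half_strip 1).
{ unfold half_strip, Re, Im; simpl. rewrite Rabs_R0. assert (P := PI_RGT_0). lra. }
(* The constant [q n] is what the sum of order [n + 1] has at the base point [L = 1] beyond the
   contributions of the earlier constants. *)
destruct (course_of_values (fun n p => exterior_sum (Z.of_nat (S n)) a (Fs (S n)) 1 -
   psum (fun j => p j * exp_term (n - j) 1) n)) as [q Hq].
{ intros n p p' H. rewrite (psum_ext _ (fun j => p' j * exp_term (n - j) 1)); [reflexivity|].
  intros k Hk. rewrite H by exact Hk. reflexivity. }
exists q.
assert (K : forall S L, half_strip L -> exterior_sum (Z.of_nat S) a (Fs S) L = exp_poly q S L).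
{ induction S as [|S IH]; intros L HL.
  - unfold exp_poly; simpl psum. apply exterior_sum_0; [apply (HFs O)|exact HL].
  - cut (exterior_sum (Z.of_nat (Datatypes.S S)) a (Fs (Datatypes.S S)) L + - (1) * exp_poly q (Datatypes.S S) L =
      exterior_sum (Z.of_nat (Datatypes.S S)) a (Fs (Datatypes.S S)) 1 + - (1) * exp_poly q (Datatypes.S S) 1).
    + assert (E1 : exp_poly q (Datatypes.S S) 1 = exterior_sum (Z.of_nat (Datatypes.S S)) a (Fs (Datatypes.S S)) 1).
      { unfold exp_poly. simpl psum. rewrite (Hq S) at 1.
        replace (S - 0 - S)%nat with O by lia. replace (S - 0)%nat with S by lia.
        assert (E2 : exp_term 0 1 = 1) by (unfold exp_term; simpl; field).
        rewrite E2. ring. }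
      rewrite E1. intros E.
      match type of E with ?A + _ = _ => replace A with (A + - (1) * exp_poly q (Datatypes.S S) L + exp_poly q (Datatypes.S S) L) by ring end.
      rewrite E; ring.
    + apply (cderiv_zero_segment (fun L => exterior_sum (Z.of_nat (Datatypes.S S)) a (Fs (Datatypes.S S)) L + - (1) * exp_poly q (Datatypes.S S) L) 1 L).
      intros t Ht. assert (Hz := half_strip_segment 1 L t H1 HL Ht).
      set (z := 1 + t * (L - 1)) in *.
      replace (RtoC 0) with (exterior_sum (Z.of_nat S) a (Fs S) z + - (1) * exp_poly q S z)
        by (rewrite IH by exact Hz; ring).
      apply cderiv_plus; [|apply cderiv_scal, cderiv_exp_poly].
      replace (Z.of_nat S) with (Z.of_nat (Datatypes.S S) - 1)%Z by lia.
      apply cderiv_exterior_sum; [auto|apply HFs| |exact Hz].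
      replace (Z.of_nat (Datatypes.S S) - 1)%Z with (Z.of_nat S) by lia. apply HFs. }
intros S F HF L HL. rewrite <- K by exact HL. unfold exterior_sum. do 2 f_equal.
apply (lerch_branch_unique _ _ _ _ HF (HFs S)). apply lerch_sector_opp_Cexp, HL.
Qed.

(** * The unit circle *)

Definition cont_on (D : C -> Prop) (f : C -> C) (z : C) : Prop :=
  forall e, (0 < e)%R -> exists d, (0 < d)%R /\
    forall w, D w -> (Cmod (w - z) < d)%R -> (Cmod (f w - f z) < e)%R.

Lemma cont_on_cderiv (D : C -> Prop) (f : C -> C) (z l : C) : cderiv f z l -> cont_on D f z.
Proof.
intros H e He. destruct (cderiv_cont f z l H e He) as (d & Hd & K).
exists d; split; [exact Hd|]. intros w _ Hw. apply K, Hw.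
Qed.

Lemma cont_on_plus (D : C -> Prop) (f g : C -> C) (z : C) :
  cont_on D f z -> cont_on D g z -> cont_on D (fun w => f w + g w) z.
Proof.
intros Hf Hg e He.
destruct (Hf (e / 2)%R ltac:(lra)) as (d1 & Hd1 & K1).
destruct (Hg (e / 2)%R ltac:(lra)) as (d2 & Hd2 & K2).
exists (Rmin d1 d2); split; [apply Rmin_pos; auto|]. intros w Dw Hw.
assert (M1 := Rmin_l d1 d2). assert (M2 := Rmin_r d1 d2).
specialize (K1 w Dw ltac:(lra)). specialize (K2 w Dw ltac:(lra)).
replace (f w + g w - (f z + g z)) with ((f w - f z) + (g w - g z)) by ring.
eapply Rle_lt_trans; [apply Cmod_triangle|lra].
Qed.

Lemma cont_on_comp (D D' : C -> Prop) (f g : C -> C) (z : C) :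
  cont_on D f (g z) -> cont_on D' g z -> (forall w, D' w -> D (g w)) ->
  cont_on D' (fun w => f (g w)) z.
Proof.
intros Hf Hg HD e He. destruct (Hf e He) as (d & Hd & K).
destruct (Hg d Hd) as (d' & Hd' & K'). exists d'; split; [exact Hd'|].
intros w Dw Hw. apply K; [apply HD, Dw|apply K'; assumption].
Qed.

Lemma cont_on_limit_eq (D : C -> Prop) (f g : C -> C) (z : C) :
  cont_on D f z -> cont_on D g z ->
  (forall d, (0 < d)%R -> exists w, D w /\ (Cmod (w - z) < d)%R /\ f w = g w) -> f z = g z.
Proof.
intros Hf Hg H.
cut (f z - g z = 0); [intros E; replace (f z) with (f z - g z + g z) by ring; rewrite E; ring|].
apply Cmod_eps_0. intros e He.
destruct (Hf (e / 2)%R ltac:(lra)) as (d1 & Hd1 & K1).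
destruct (Hg (e / 2)%R ltac:(lra)) as (d2 & Hd2 & K2).
destruct (H (Rmin d1 d2) ltac:(apply Rmin_pos; auto)) as (w & Dw & Hw & E).
assert (M1 := Rmin_l d1 d2). assert (M2 := Rmin_r d1 d2).
specialize (K1 w Dw ltac:(lra)). specialize (K2 w Dw ltac:(lra)).
replace (f z - g z) with ((g w - g z) - (f w - f z)) by (rewrite E; ring).
eapply Rle_trans; [apply Cmod_triangle|]. rewrite Cmod_opp. lra.
Qed.

Lemma cont_on_abs_series (c : nat -> C) (M : nat -> R) (y0 : C) :
  (forall n, Cmod (c n) <= M n)%R -> ex_series M -> (Cmod y0 <= 1)%R ->
  cont_on (fun y => (Cmod y <= 1)%R) (fun y => csum (fun n => c n * y ^ n)) y0.
Proof.
intros Hc HM Hy0 e He.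
destruct (Mtest_remainder M (e / 3) ltac:(lra) HM) as [N HN].
assert (Hb : forall y, (Cmod y <= 1)%R -> forall n, (Cmod (c n * y ^ n) <= M n)%R).
{ intros y Hy n. rewrite Cmod_mult, Cmod_pow. rewrite <- (Rmult_1_r (M n)).
  apply Rmult_le_compat; [apply Cmod_ge_0|apply pow_le, Cmod_ge_0|apply Hc|].
  rewrite <- (pow1 n). apply pow_incr. split; [apply Cmod_ge_0|exact Hy]. }
assert (Hs : forall y, (Cmod y <= 1)%R ->
  (Cmod (csum (fun n => c n * y ^ n)%C - psum (fun n => c n * y ^ n)%C N) < e / 3)%R).
{ intros y Hy. apply HN; [lia|apply Hb, Hy|]. apply csum_correct.
  apply (cseries_abs _ M); [apply Hb, Hy|exact HM]. }
assert (Hd : exists l, cderiv (fun y => psum (fun n => c n * y ^ n) N) y0 l).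
{ exists (psum (fun n => c n * (match n with O => 0 | S m => INR (S m) * y0 ^ m end)) N).
  apply (cderiv_psum (fun n y => c n * y ^ n)). intros k _. apply cderiv_scal.
  destruct k as [|k]; [exact (cderiv_const 1 y0)|apply cderiv_pow]. }
destruct Hd as [l Hl].
destruct (cderiv_cont _ _ _ Hl (e / 3)%R ltac:(lra)) as (d & Hd & K).
exists d; split; [exact Hd|]. intros y Hy Hyd.
specialize (K y Hyd). assert (S1 := Hs y Hy). assert (S2 := Hs y0 Hy0).
cbv beta in K.
set (p := psum (fun n => c n * y ^ n) N) in *. set (p0 := psum (fun n => c n * y0 ^ n) N) in *.
set (s := csum (fun n => c n * y ^ n)) in *. set (s0 := csum (fun n => c n * y0 ^ n)) in *.
replace (s - s0) with ((s - p) + ((p - p0) - (s0 - p0))) by ring.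
eapply Rle_lt_trans; [apply Cmod_triangle|].
eapply Rle_lt_trans; [apply Rplus_le_compat_l, Cmod_triangle|]. rewrite Cmod_opp. lra.
Qed.

(** Comparison with twice [1 / ((n + 1) (n + 2))], which telescopes to the sum 1. *)
Lemma ex_series_inv_pow (K : R) (S : nat) : (2 <= S)%nat -> (0 <= K)%R ->
  ex_series (fun n => K * (/ (INR n + 1)) ^ S)%R.
Proof.
intros HS HK. apply (ex_series_scal (V := R_NormedModule) K (fun n => (/ (INR n + 1)) ^ S)%R).
apply (@ex_series_le R_AbsRing R_CompleteNormedModule _ (fun n => 2 * (/ ((INR n + 1) * (INR n + 2))))%R).
- intros n. assert (Hn := pos_INR n).
  change (Rabs ((/ (INR n + 1)) ^ S) <= 2 * / ((INR n + 1) * (INR n + 2)))%R.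
  set (x := (/ (INR n + 1))%R).
  assert (Hx : (0 < x <= 1)%R).
  { unfold x. split; [apply Rinv_0_lt_compat; lra|]. rewrite <- Rinv_1. apply Rinv_le_contravar; lra. }
  rewrite Rabs_pos_eq by (apply pow_le; lra).
  replace S with (2 + (S - 2))%nat by lia. rewrite pow_add.
  apply Rle_trans with (x ^ 2 * 1)%R.
  + apply Rmult_le_compat_l; [apply pow_le; lra|]. rewrite <- (pow1 (S - 2)).
    apply pow_incr; lra.
  + unfold x. rewrite Rinv_mult.
    replace ((/ (INR n + 1)) ^ 2 * 1)%R with (/ (INR n + 1) * / (INR n + 1))%R by ring.
    replace (2 * (/ (INR n + 1) * / (INR n + 2)))%R with (/ (INR n + 1) * (2 * / (INR n + 2)))%R by ring.
    apply Rmult_le_compat_l; [apply Rlt_le, Rinv_0_lt_compat; lra|].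
    apply Rmult_le_reg_l with ((INR n + 1) * (INR n + 2))%R; [nra|]. field_simplify; lra.
- apply (ex_series_scal (V := R_NormedModule) 2%R (fun n => / ((INR n + 1) * (INR n + 2)))%R).
  exists 1%R. apply is_series_Reals. intros e He.
  destruct (INR_unbounded (/ e)) as [N HN]. exists N. intros n Hn.
  assert (E : sum_f_R0 (fun n => / ((INR n + 1) * (INR n + 2)))%R n = (1 - / (INR n + 2))%R).
  { clear. induction n as [|n IH]; [simpl; field|].
    rewrite tech5, IH, S_INR. assert (Hn := pos_INR n). field. lra. }
  rewrite E. unfold R_dist. replace (1 - / (INR n + 2) - 1)%R with (- / (INR n + 2))%R by ring.
  assert (Hp := pos_INR n). apply le_INR in Hn.
  assert (Hi : (0 < / (INR n + 2))%R) by (apply Rinv_0_lt_compat; lra).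
  rewrite Rabs_Ropp, Rabs_pos_eq by lra.
  rewrite <- (Rinv_inv e). apply Rinv_lt_contravar; [|lra].
  apply Rmult_lt_0_compat; [apply Rinv_0_lt_compat; lra|lra].
Qed.

Definition int_coef (S : Z) (a : C) (n : nat) : C := / Cpowz (a + INR n) S.

(** Separate from the branch because of the point [x = 1]: it is outside the sector, but for
    [S >= 2] the series converges there. *)
Definition lerch_int (S : Z) (a x : C) : C := csum (fun n => int_coef S a n * x ^ n).

Lemma coef_majorant (S : nat) (a : C) : (2 <= S)%nat -> (forall k : Z, a <> IZR k) ->
  exists M : nat -> R, ex_series M /\
   (forall n, (Cmod (int_coef (Z.of_nat S) a n) <= M n)%R) /\
   (forall n, (Cmod (ext_coef (Z.of_nat S) a n) <= M n)%R).
Proof.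
intros HS Ha. destruct (dist_integers a Ha) as (d & Hd & H).
exists (fun n => (/ d) ^ S * (/ (INR n + 1)) ^ S)%R. repeat split.
- apply ex_series_inv_pow; [exact HS|]. apply pow_le, Rlt_le, Rinv_0_lt_compat, Hd.
- intros n. assert (K := Cmod_inv_shift_le a d S Hd H (Z.of_nat n)).
  unfold int_coef. rewrite Cpowz_of_nat.
  rewrite <- INR_IZR_INZ, (Rabs_pos_eq (INR _)) in K by apply pos_INR. exact K.
- apply ext_coef_le; assumption.
Qed.

Lemma cont_on_lerch_int (S : nat) (a x : C) : (2 <= S)%nat -> (forall k : Z, a <> IZR k) ->
  (Cmod x <= 1)%R -> cont_on (fun y => (Cmod y <= 1)%R) (lerch_int (Z.of_nat S) a) x.
Proof.
intros HS Ha. destruct (coef_majorant S a HS Ha) as (M & HM & H1 & H2).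
apply (cont_on_abs_series _ M); assumption.
Qed.

Lemma cont_on_lerch_ext (S : nat) (a x : C) : (2 <= S)%nat -> (forall k : Z, a <> IZR k) ->
  (Cmod x <= 1)%R -> cont_on (fun y => (Cmod y <= 1)%R) (lerch_ext (Z.of_nat S) a) x.
Proof.
intros HS Ha. destruct (coef_majorant S a HS Ha) as (M & HM & H1 & H2).
apply (cont_on_abs_series _ M); assumption.
Qed.

Lemma exists_small (d : R) : (0 < d)%R -> exists t, (0 < t < 1)%R /\ (t < d)%R.
Proof.
intros Hd. assert (M1 := Rmin_l (1 / 2) (d / 2)). assert (M2 := Rmin_r (1 / 2) (d / 2)).
assert (M3 : (0 < Rmin (1 / 2) (d / 2))%R) by (apply Rmin_pos; lra).
exists (Rmin (1 / 2) (d / 2)). lra.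
Qed.

Lemma lerch_branch_lerch_int (S : Z) (a : C) (F : C -> C) (x : C) :
  is_lerch_branch S a F -> (Cmod x < 1)%R -> F x = lerch_int S a x.
Proof.
intros [F1 _] Hx. symmetry. apply csum_unique.
eapply cseries_ext; [|exact (F1 x Hx)]. intros n; unfold int_coef, Cdiv; ring.
Qed.

(** Both functions are continuous at [x] within the closed disc and agree at [(1 - t) * x]. *)
Lemma lerch_branch_circle (S : nat) (a : C) (F : C -> C) (x : C) :
  (2 <= S)%nat -> (forall k : Z, a <> IZR k) -> is_lerch_branch (Z.of_nat S) a F ->
  Cmod x = 1%R -> lerch_sector x -> F x = lerch_int (Z.of_nat S) a x.
Proof.
intros HS Ha HF Hx Hsec.
apply (cont_on_limit_eq (fun y => (Cmod y <= 1)%R)).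
- destruct (proj2 HF x Hsec) as [c Hc]. eapply cont_on_cderiv, is_taylor_cderiv_center, Hc.
- apply cont_on_lerch_int; auto. lra.
- intros d Hd. destruct (exists_small d Hd) as (t & Ht & Htd).
  exists ((1 - t)%R * x).
  assert (E : Cmod ((1 - t)%R * x) = (1 - t)%R).
  { rewrite Cmod_mult, Hx, Cmod_R, Rabs_pos_eq; lra. }
  rewrite E. repeat split; [lra| |].
  + replace ((1 - t)%R * x - x) with (- (t * x)) by (rewrite RtoC_minus; ring).
    rewrite Cmod_opp, Cmod_mult, Hx, Cmod_R, Rabs_pos_eq; lra.
  + apply lerch_branch_lerch_int; [exact HF|rewrite E; lra].
Qed.

Definition circle_sum (S : Z) (a L : C) : C :=
  lerch_int S a (- Cexp L) + lerch_ext S a (- Cexp (- L)).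

Lemma cderiv_opp_Cexp_opp (L : C) : cderiv (fun w => - Cexp (- w)) L (Cexp (- L)).
Proof.
apply (cderiv_ext (fun w => - Cexp (- (1) * w)) _ _ (- (- (1) * Cexp (- (1) * L)))).
- intros w; do 2 f_equal; ring.
- replace (- (1) * L) with (- L) by ring. ring.
- apply cderiv_opp_Cexp_scal.
Qed.

Lemma cderiv_Cexp_mul_poly (q : nat -> C) (S : nat) (a L : C) :
  exists l, cderiv (fun w => Cexp (- a * w) * exp_poly q S w) L l.
Proof.
destruct S as [|S]; eexists; (apply cderiv_mult; [apply cderiv_Cexp_scal|]).
- exact (cderiv_const 0 L).
- apply cderiv_exp_poly.
Qed.

(** The limit from outside the circle, along [L = t + i theta] with [t] decreasing to 0. For
    [Rabs theta < PI] the branch is analytic at the limit point. *)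
Lemma circle_sum_open (S : nat) (a : C) (q : nat -> C) (F : C -> C) (theta : R) :
  (2 <= S)%nat -> (forall k : Z, a <> IZR k) -> is_lerch_branch (Z.of_nat S) a F ->
  (forall L, half_strip L -> exterior_sum (Z.of_nat S) a F L = exp_poly q S L) ->
  (Rabs theta < PI)%R ->
  circle_sum (Z.of_nat S) a (Ci * theta) = Cexp (- a * (Ci * theta)) * exp_poly q S (Ci * theta).
Proof.
intros HS Ha HF Hq Hth. set (z := Ci * theta).
assert (Rz : Re z = 0%R) by (unfold z, Re; simpl; ring).
assert (Iz : Im z = theta) by (unfold z, Im; simpl; ring).
assert (Hsec : lerch_sector (- Cexp z)) by (apply lerch_sector_opp_Cexp; rewrite Iz; exact Hth).
assert (Hm : Cmod (- Cexp z) = 1%R) by (rewrite Cmod_opp, Cmod_Cexp, Rz; apply exp_0).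
unfold circle_sum. rewrite <- (lerch_branch_circle S a F _ HS Ha HF Hm Hsec).
destruct (cderiv_Cexp_mul_poly q S a z) as [l Hl].
apply (cont_on_limit_eq (fun L => (0 <= Re L)%R)
  (fun L => F (- Cexp L) + lerch_ext (Z.of_nat S) a (- Cexp (- L)))
  (fun L => Cexp (- a * L) * exp_poly q S L)).
- apply cont_on_plus.
  + apply (cont_on_comp (fun _ => True) _ F (fun L => - Cexp L)); [|eapply cont_on_cderiv, cderiv_opp, cderiv_Cexp|auto].
    destruct (proj2 HF _ Hsec) as [c Hc]. eapply cont_on_cderiv, is_taylor_cderiv_center, Hc.
  + apply (cont_on_comp (fun y => (Cmod y <= 1)%R) _ (lerch_ext (Z.of_nat S) a) (fun L => - Cexp (- L))).
    * apply cont_on_lerch_ext; auto. rewrite Cmod_opp, Cmod_Cexp.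
      replace (Re (- z)) with 0%R by (unfold Re in *; simpl; lra). rewrite exp_0; lra.
    * eapply cont_on_cderiv, cderiv_opp_Cexp_opp.
    * intros w Hw. rewrite Cmod_opp, Cmod_Cexp, <- exp_0.
      destruct (Req_dec (Re (- w)) 0) as [->|Hne]; [lra|]. apply Rlt_le, exp_increasing.
      unfold Re in *; simpl in *; lra.
- exact (cont_on_cderiv _ _ _ _ Hl).
- intros d Hd. destruct (exists_small d Hd) as (t & Ht & Htd).
  exists (t + z). assert (Hh : half_strip (t + z)).
  { split; [replace (Re (t + z)) with (t + Re z)%R by reflexivity; lra|].
    replace (Im (t + z)) with (0 + Im z)%R by reflexivity. rewrite Iz, Rplus_0_l; exact Hth. }
  repeat split; [apply Rlt_le, Hh| |].
  + replace (t + z - z) with (RtoC t) by ring. rewrite Cmod_R, Rabs_pos_eq; lra.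
  + rewrite <- (Hq _ Hh). unfold exterior_sum.
    replace (- a * (t + z)) with (- (a * (t + z))) by ring.
    rewrite Cmult_assoc, Cexp_opp_l. ring.
Qed.

(** The endpoints [PI] and [- PI] are reached along the circle, from [(1 - t) * theta]: there only
    the two power series are involved, and they are continuous up to [x = 1]. *)
Lemma circle_sum_eq (S : nat) (a : C) (q : nat -> C) (F : C -> C) (theta : R) :
  (2 <= S)%nat -> (forall k : Z, a <> IZR k) -> is_lerch_branch (Z.of_nat S) a F ->
  (forall L, half_strip L -> exterior_sum (Z.of_nat S) a F L = exp_poly q S L) ->
  (Rabs theta <= PI)%R ->
  circle_sum (Z.of_nat S) a (Ci * theta) = Cexp (- a * (Ci * theta)) * exp_poly q S (Ci * theta).
Proof.
intros HS Ha HF Hq Hth. set (z := Ci * theta).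
assert (Rz : Re z = 0%R) by (unfold z, Re; simpl; ring).
assert (Rz' : Re (- z) = 0%R) by (unfold z, Re; simpl; ring).
destruct (cderiv_Cexp_mul_poly q S a z) as [l Hl].
assert (Hth0 := Rabs_pos theta). assert (HPI := PI_RGT_0).
apply (cont_on_limit_eq (fun L => (Re L = 0)%R) (circle_sum (Z.of_nat S) a)
  (fun L => Cexp (- a * L) * exp_poly q S L)).
- apply cont_on_plus.
  + apply (cont_on_comp (fun y => (Cmod y <= 1)%R) _ (lerch_int (Z.of_nat S) a) (fun L => - Cexp L)).
    * apply cont_on_lerch_int; auto. rewrite Cmod_opp, Cmod_Cexp, Rz, exp_0; lra.
    * eapply cont_on_cderiv, cderiv_opp, cderiv_Cexp.
    * intros w Hw. rewrite Cmod_opp, Cmod_Cexp, Hw, exp_0; lra.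
  + apply (cont_on_comp (fun y => (Cmod y <= 1)%R) _ (lerch_ext (Z.of_nat S) a) (fun L => - Cexp (- L))).
    * apply cont_on_lerch_ext; auto. rewrite Cmod_opp, Cmod_Cexp, Rz', exp_0; lra.
    * eapply cont_on_cderiv, cderiv_opp_Cexp_opp.
    * intros w Hw. rewrite Cmod_opp, Cmod_Cexp.
      replace (Re (- w)) with 0%R by (unfold Re in *; simpl; lra). rewrite exp_0; lra.
- exact (cont_on_cderiv _ _ _ _ Hl).
- intros d Hd.
  destruct (exists_small (d / (Rabs theta + 1)) ltac:(apply Rdiv_lt_0_compat; lra)) as (t & Ht & Htd).
  exists (Ci * ((1 - t) * theta)%R). repeat split.
  + unfold Re; simpl; ring.
  + replace (Ci * ((1 - t) * theta)%R - z) with (- (Ci * (t * theta)%R))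
      by (unfold z; rewrite !RtoC_mult, RtoC_minus; ring).
    rewrite Cmod_opp, Cmod_mult, Cmod_R, Rabs_mult, (Rabs_pos_eq t) by lra.
    replace (Cmod Ci) with 1%R.
    2:{ unfold Cmod; simpl. rewrite Rmult_0_l, Rplus_0_l, !Rmult_1_r; symmetry; apply sqrt_1. }
    apply Rle_lt_trans with (t * (Rabs theta + 1))%R; [nra|].
    apply Rlt_le_trans with (d / (Rabs theta + 1) * (Rabs theta + 1))%R.
    * apply Rmult_lt_compat_r; lra.
    * apply Req_le; field; lra.
  + apply (circle_sum_open S a q F); auto.
    rewrite Rabs_mult, Rabs_pos_eq by lra. nra.
Qed.

Lemma Cexp_Ci_PI : Cexp (Ci * PI) = - (1).
Proof. rewrite Cexp_Ci, cos_PI, sin_PI. apply injective_projections; simpl; ring. Qed.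

Lemma Cexp_opp_Ci_PI : Cexp (- (Ci * PI)) = - (1).
Proof. rewrite Cexp_opp, Cexp_Ci_PI. field. Qed.

(** Both sides equal the bilateral series at the single point [- Cexp (Ci * PI) = - Cexp (- (Ci *
    PI)) = 1]. *)
Lemma exp_poly_periodicity (S : nat) (a : C) (q : nat -> C) (F : C -> C) :
  (2 <= S)%nat -> (forall k : Z, a <> IZR k) -> is_lerch_branch (Z.of_nat S) a F ->
  (forall L, half_strip L -> exterior_sum (Z.of_nat S) a F L = exp_poly q S L) ->
  Cexp (- a * (Ci * PI)) * exp_poly q S (Ci * PI) =
  Cexp (a * (Ci * PI)) * exp_poly q S (- (Ci * PI)).
Proof.
intros HS Ha HF Hq. assert (P := PI_RGT_0).
assert (E1 := circle_sum_eq S a q F PI HS Ha HF Hq ltac:(rewrite Rabs_pos_eq; lra)).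
assert (E2 := circle_sum_eq S a q F (- PI) HS Ha HF Hq ltac:(rewrite Rabs_Ropp, Rabs_pos_eq; lra)).
replace (Ci * (- PI)%R) with (- (Ci * PI)) in E2 by (rewrite RtoC_opp; ring).
replace (- a * - (Ci * PI)) with (a * (Ci * PI)) in E2 by ring.
rewrite <- E1, <- E2. unfold circle_sum.
replace (- - (Ci * PI)) with (Ci * PI) by ring.
rewrite Cexp_opp_Ci_PI, Cexp_Ci_PI. reflexivity.
Qed.

(** * Integration over the unit circle *)

Lemma is_cint_psum (f : nat -> R -> C) (I : nat -> C) (a b : R) (n : nat) : (a <= b)%R ->
  (forall k, is_cint (f k) a b (I k)) -> is_cint (fun t => psum (fun k => f k t) n) a b (psum I n).
Proof.
intros Hab H. induction n as [|n IH]; simpl.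
- apply (is_cint_ext (fun t => 0 * f O t) _ _ _ _ Hab); [intros; ring|].
  assert (K := is_cint_scal 0 _ _ _ _ (H O)). rewrite Cmult_0_l in K. exact K.
- apply is_cint_plus; [exact IH|apply H].
Qed.

Lemma rderiv_line (f : C -> C) (d l : C) (t : R) :
  cderiv f (d * t) l -> rderiv (fun s : R => f (d * s)) t (l * d).
Proof.
intros H. replace (d * t) with (0 + t * d) in H by ring. apply cderiv_line in H.
eapply (is_derive_ext (V := C_R_NormedModule)); [|exact H]. intros s; simpl. f_equal; ring.
Qed.

(** The primitive [(- Cexp (d t)) ^ (n + 1) / ((n + 1) d)] takes the same value at both ends. It is
    used with [d = Ci] and [d = - Ci]. *)
Lemma is_cint_circle_pow (d : C) (n : nat) : d <> 0 ->
  Cexp (d * PI) = - (1) -> Cexp (d * (- PI)%R) = - (1) ->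
  is_cint (fun t => (- Cexp (d * t)) ^ S n) (- PI) PI 0.
Proof.
intros Hd E1 E2. assert (P := PI_RGT_0).
assert (Hn : RtoC (INR (S n)) <> 0) by (intros E; apply RtoC_inj in E; exact (not_0_INR _ (Nat.neq_succ_0 n) E)).
set (f := fun w => / (INR (S n) * d) * (- Cexp w) ^ S n).
assert (D : forall w, cderiv f w (/ d * (- Cexp w) ^ S n)).
{ intros w. unfold f.
  apply (cderiv_ext (fun w => / (INR (S n) * d) * (- Cexp w) ^ S n) _ _
    (/ (INR (S n) * d) * (- Cexp w * (INR (S n) * (- Cexp w) ^ n)))); [reflexivity| |].
  - simpl Cpow. field. split; assumption.
  - apply cderiv_scal. apply (cderiv_comp (fun v => v ^ S n) (fun w => - Cexp w)).
    + apply cderiv_pow.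
    + apply cderiv_opp, cderiv_Cexp. }
replace (RtoC 0) with (f (d * PI) - f (d * (- PI)%R)) by (unfold f; rewrite E1, E2; ring).
apply (cint_derive (fun t => f (d * t))); [lra| |].
- intros t _. replace ((- Cexp (d * t)) ^ S n) with (/ d * (- Cexp (d * t)) ^ S n * d) by (field; exact Hd).
  apply rderiv_line, D.
- intros t _. eapply rderiv_ccont. apply (rderiv_line (fun w => (- Cexp w) ^ S n)).
  apply (cderiv_comp (fun v => v ^ S n) (fun w => - Cexp w)).
  + apply cderiv_pow.
  + apply cderiv_opp, cderiv_Cexp.
Qed.

Lemma is_cint_const (c : C) (a b : R) : (a <= b)%R -> is_cint (fun _ => c) a b ((b - a)%R * c).
Proof.
intros Hab. replace ((b - a)%R * c) with (c * b - c * a) by (rewrite RtoC_minus; ring).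
apply (cint_derive (fun t => c * t)); [exact Hab| |intros; apply ccont_const].
intros t _. assert (K := rderiv_line (fun w => w) c 1 t (cderiv_id _)).
rewrite Cmult_1_l in K. exact K.
Qed.

Lemma psum_head (u : nat -> C) (n : nat) : (1 <= n)%nat ->
  (forall k, u (S k) = 0) -> psum u n = u O.
Proof.
intros Hn H. destruct n as [|n]; [lia|]. rewrite psum_Sn_l, (psum_ext _ (fun _ => 0)).
- rewrite psum_zero; ring.
- intros; apply H.
Qed.

(* The zeroth Fourier coefficient of the bilateral series on the unit circle. *)
Lemma is_cint_circle_sum (S : nat) (a I : C) : (2 <= S)%nat -> (forall k : Z, a <> IZR k) ->
  is_cint (fun t => circle_sum (Z.of_nat S) a (Ci * t)) (- PI) PI I ->
  I = 2 * PI / a ^ S.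
Proof.
intros HS Ha HI. destruct (coef_majorant S a HS Ha) as (M & HM & H1 & H2).
assert (P := PI_RGT_0).
assert (HCi : Ci <> 0) by (intros E; apply (f_equal snd) in E; simpl in E; lra).
assert (Eopp : Ci * (- PI)%R = - (Ci * PI)) by (rewrite RtoC_opp; ring).
cut (I - 2 * PI / a ^ S = 0).
{ intros E. replace I with (I - 2 * PI / a ^ S + 2 * PI / a ^ S) by ring. rewrite E; ring. }
apply Cmod_eps_0. intros e He.
(* Two remainders, each below [e'], over an interval of length [2 PI]. The M-test gives one [N] for
   all points of the circle. *)
set (e' := (e / (4 * PI))%R). assert (He' : (0 < e')%R) by (apply Rdiv_lt_0_compat; lra).
destruct (Mtest_remainder M e' He' HM) as [N0 HN]. set (N := Datatypes.S N0).
specialize (HN N).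
set (x := fun t : R => - Cexp (Ci * t)). set (y := fun t : R => - Cexp (- (Ci * t))).
assert (Hx : forall t, Cmod (x t) = 1%R).
{ intros t. unfold x. rewrite Cmod_opp, Cmod_Cexp. replace (Re (Ci * t)) with 0%R by (unfold Re; simpl; ring). apply exp_0. }
assert (Hy : forall t, Cmod (y t) = 1%R).
{ intros t. unfold y. rewrite Cmod_opp, Cmod_Cexp. replace (Re (- (Ci * t))) with 0%R by (unfold Re; simpl; ring). apply exp_0. }
assert (B1 : forall c : nat -> C, (forall n, (Cmod (c n) <= M n)%R) -> forall u, Cmod u = 1%R ->
  (Cmod (csum (fun n => (c n * u ^ n)%C) - psum (fun n => (c n * u ^ n)%C) N) < e')%R).
{ intros c Hc u Hu. assert (Hb : forall n, (Cmod (c n * u ^ n) <= M n)%R).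
  { intros n. rewrite Cmod_mult, Cmod_pow, Hu, pow1, Rmult_1_r. apply Hc. }
  apply HN; [unfold N; lia|exact Hb|]. apply csum_correct, (cseries_abs _ M); assumption. }
set (u := int_coef (Z.of_nat S) a) in *. set (v := ext_coef (Z.of_nat S) a) in *.
assert (J : is_cint (fun t => psum (fun n => u n * x t ^ n) N + psum (fun n => v n * y t ^ n) N)
   (- PI) PI (2 * PI / a ^ S)).
(* Only the power 0 has a nonzero integral. The exterior series has no such term, so [2 PI] times
   [int_coef] at 0 remains. *)
{ set (I0 := fun n => match n with O => RtoC (PI - - PI)%R * 1 | Datatypes.S _ => 0 end).
  replace (2 * PI / a ^ S) with (psum (fun n => u n * I0 n) N + psum (fun n => v n * I0 n) N).
  - apply is_cint_plus; apply is_cint_psum; try lra; intros k; apply is_cint_scal;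
      (destruct k as [|k]; [apply (is_cint_const 1); lra|]).
    + apply (is_cint_circle_pow Ci); [exact HCi|apply Cexp_Ci_PI|rewrite Eopp; apply Cexp_opp_Ci_PI].
    + apply (is_cint_ext (fun t => (- Cexp (- Ci * t)) ^ Datatypes.S k)); [lra| |].
      { intros t _. unfold y. do 3 f_equal. ring. }
      apply is_cint_circle_pow.
      * intros E. apply HCi. replace Ci with (- - Ci) by ring. rewrite E; ring.
      * replace (- Ci * PI) with (- (Ci * PI)) by ring. apply Cexp_opp_Ci_PI.
      * replace (- Ci * (- PI)%R) with (Ci * PI) by (rewrite RtoC_opp; ring). apply Cexp_Ci_PI.
  - rewrite !psum_head; try (unfold N; lia); try (intros; unfold I0; ring).
    unfold u, v, int_coef, ext_coef, I0. rewrite Cpowz_of_nat. simpl INR. rewrite Cplus_0_r.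
    replace (PI - - PI)%R with (2 * PI)%R by ring. rewrite RtoC_mult. unfold Cdiv; ring. }
replace e with ((PI - - PI) * (e' + e'))%R by (unfold e'; field; lra).
apply (Cmod_is_cint_le (fun t => circle_sum (Z.of_nat S) a (Ci * t) +
   - (1) * (psum (fun n => u n * x t ^ n) N + psum (fun n => v n * y t ^ n) N))); [lra| |].
- intros t _. unfold circle_sum. fold (x t). fold (y t). unfold lerch_int, lerch_ext. fold u. fold v.
  assert (K1 := B1 u H1 (x t) (Hx t)). assert (K2 := B1 v H2 (y t) (Hy t)).
  set (p1 := psum (fun n => u n * x t ^ n) N) in *. set (p2 := psum (fun n => v n * y t ^ n) N) in *.
  set (s1 := csum (fun n => u n * x t ^ n)) in *. set (s2 := csum (fun n => v n * y t ^ n)) in *.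
  replace (s1 + s2 + - (1) * (p1 + p2)) with ((s1 - p1) + (s2 - p2)) by ring.
  eapply Rle_trans; [apply Cmod_triangle|lra].
- replace (I - 2 * PI / a ^ S) with (I + - (1) * (2 * PI / a ^ S)) by ring.
  apply is_cint_plus; [exact HI|apply is_cint_scal, J].
Qed.

(** The zeroth Fourier coefficient is computed a second time, from the closed form
    [(q 0 * L + q 1) * Cexp (- a * L)]; the boundary terms containing [q 1] cancel by
    periodicity. *)
Lemma exp_poly_normalization (a : C) (q : nat -> C) (F : C -> C) :
  (forall k : Z, a <> IZR k) -> is_lerch_branch 2 a F ->
  (forall L, half_strip L -> exterior_sum 2 a F L = exp_poly q 2 L) ->
  q O * (Cexp (- a * (Ci * PI)) - Cexp (a * (Ci * PI))) = - (2 * PI * Ci).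
Proof.
intros Ha HF Hq. assert (P := PI_RGT_0).
assert (Ha0 : a <> 0) by (apply (Ha 0%Z)).
assert (HCi : Ci <> 0) by (intros E; apply (f_equal snd) in E; simpl in E; lra).
assert (Hper := exp_poly_periodicity 2 a q F ltac:(lia) Ha HF Hq).
assert (E2 : forall L, exp_poly q 2 L = q O * L + q 1%nat)
  by (intros L; unfold exp_poly, exp_term; simpl; field).
(* From the equations [- a A = q 0] and [A - a B = q 1], which make [H] the primitive. *)
set (A := - q O / a). set (B := (A - q 1%nat) / a).
set (H := fun L => (A * L + B) * Cexp (- a * L)).
assert (DH : forall L, cderiv H L (Cexp (- a * L) * exp_poly q 2 L)).
{ intros L. unfold H. eapply cderiv_ext; [reflexivity| |apply cderiv_mult].
  3: apply cderiv_Cexp_scal.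
  2: apply (cderiv_plus (fun L => A * L)); [apply cderiv_scal, cderiv_id|apply cderiv_const].
  cbv beta. rewrite E2. unfold B, A. field. exact Ha0. }
assert (J : is_cint (fun t => circle_sum 2 a (Ci * t)) (- PI) PI
   (- Ci * (H (Ci * PI) - H (Ci * (- PI)%R)))).
{ apply (is_cint_ext (fun t => - Ci * (Cexp (- a * (Ci * t)) * exp_poly q 2 (Ci * t) * Ci))); [lra| |].
  - intros t Ht. change 2%Z with (Z.of_nat 2). rewrite (circle_sum_eq 2 a q F t ltac:(lia) Ha HF Hq) by (apply Rabs_le; lra).
    match goal with |- - Ci * (?X * Ci) = _ => replace (- Ci * (X * Ci)) with (- (Ci * Ci) * X) by ring end.
    replace (- (Ci * Ci)) with (RtoC 1) by (apply injective_projections; simpl; ring). ring.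
  - apply is_cint_scal. apply (cint_derive (fun t => H (Ci * t))); [lra| |].
    + intros t _. apply rderiv_line, DH.
    + intros t _. destruct (cderiv_Cexp_mul_poly q 2 a (Ci * t)) as [l Hl].
      apply ccont_mult; [|apply ccont_const].
      eapply rderiv_ccont. apply (rderiv_line (fun w => Cexp (- a * w) * exp_poly q 2 w)), Hl. }
apply (is_cint_circle_sum 2 a) in J; [|lia|exact Ha].
replace (Ci * (- PI)%R) with (- (Ci * PI)) in J by (rewrite RtoC_opp; ring).
rewrite !E2 in Hper. unfold H in J.
replace (- a * - (Ci * PI)) with (a * (Ci * PI)) in J by ring.
set (X := Cexp (- a * (Ci * PI))) in *. set (Y := Cexp (a * (Ci * PI))) in *.
(* Here [- a * H L] is [Cexp (- a * L)] times the polynomial minus [A]; periodicity cancels the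
   polynomial. *)
assert (K : - a * (((A * (Ci * PI) + B) * X) - ((A * - (Ci * PI) + B) * Y)) = - A * (X - Y)).
{ replace (- a * ((A * (Ci * PI) + B) * X - (A * - (Ci * PI) + B) * Y))
    with (X * (q O * (Ci * PI) + q 1%nat) - Y * (q O * - (Ci * PI) + q 1%nat) - A * (X - Y))
    by (unfold B, A; field; exact Ha0).
  rewrite Hper. ring. }
set (T := (A * (Ci * PI) + B) * X - (A * - (Ci * PI) + B) * Y) in *.
assert (EX : q O * (X - Y) = a * (- A * (X - Y))) by (unfold A; field; exact Ha0).
rewrite EX, <- K.
replace (a * (- a * T)) with (- (a * a) * (- (Ci * Ci) * T)).
2: { replace (- (Ci * Ci)) with (RtoC 1) by (apply injective_projections; simpl; ring). ring. }
replace (- (a * a) * (- (Ci * Ci) * T)) with (- (a * a) * Ci * (- Ci * T)) by ring.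
rewrite J. simpl. field. exact Ha0.
Qed.

(* Taylor coefficients at [t = 0] of [exp (i pi (t - a)) - exp (- i pi (t - a))]. *)
Definition sin_coef (a : C) (m : nat) : C :=
  Cexp (- a * (Ci * PI)) * exp_term m (Ci * PI) - Cexp (a * (Ci * PI)) * exp_term m (- (Ci * PI)).

(** The equation of index 0 is the normalization, that of index [n >= 1] is periodicity at order
    [n + 1]. Together they are the Cauchy product of [q] with the series of [sin_coef]. *)
Lemma exterior_polynomial (a : C) : (forall k : Z, a <> IZR k) ->
  exists q, (forall (S : nat) (F : C -> C), is_lerch_branch (Z.of_nat S) a F ->
      forall L, half_strip L -> exterior_sum (Z.of_nat S) a F L = exp_poly q S L) /\
    forall n, psum (fun j => q j * sin_coef a (n - j)) (S n) =
      match n with O => - (2 * PI * Ci) | S _ => 0 end.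
Proof.
intros Ha. destruct (exterior_sum_pos a Ha) as [q Hq]. exists q. split; [exact Hq|].
intros [|n].
- destruct (lerch_branch_exists 2 a) as [F HF].
  rewrite <- (exp_poly_normalization a q F Ha HF (Hq 2%nat F HF)).
  simpl. unfold sin_coef, exp_term. simpl. field.
- destruct (lerch_branch_exists (Z.of_nat (S (S n))) a) as [F HF].
  assert (E := exp_poly_periodicity (S (S n)) a q F ltac:(lia) Ha HF (Hq _ F HF)).
  unfold exp_poly in E. rewrite <- !psum_scal in E.
  replace (psum (fun j => q j * sin_coef a (S n - j)) (S (S n))) with
   (psum (fun j => Cexp (- a * (Ci * PI)) * (q j * exp_term (S (S n) - 1 - j) (Ci * PI)) +
     - (1) * (Cexp (a * (Ci * PI)) * (q j * exp_term (S (S n) - 1 - j) (- (Ci * PI))))) (S (S n))).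
  + rewrite psum_plus, (psum_scal (- (1))), E. ring.
  + apply psum_ext. intros k Hk. unfold sin_coef.
    replace (S (S n) - 1 - k)%nat with (S n - k)%nat by lia. ring.
Qed.

(** * Taylor coefficients of the cosecant, and Gamma at the integers *)

(** The sum [ex] of the series is its own derivative, so [ex w * Cexp (- w)] is constant, with value
    1 at the origin. *)
Lemma Cexp_series (L : C) : cseries (fun m => exp_term m L) (Cexp L).
Proof.
set (c := fun m => / RtoC (INR (fact m))).
set (ex := fun w => csum (fun m => c m * w ^ m)).
assert (Hc : forall w, cseries (fun m => c m * w ^ m) (ex w)).
{ intros w. apply csum_correct.
  apply (cseries_abs _ (fun m => / INR (fact m) * Cmod w ^ m)%R).
  - intros m. unfold c. rewrite Cmod_mult, Cmod_pow, <- RtoC_inv, Cmod_R, Rabs_pos_eq.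
    + lra.
    + apply Rlt_le, Rinv_0_lt_compat, INR_fact_lt_0.
    + apply INR_fact_neq_0.
  - exists (exp (Cmod w)). assert (K := is_exp_Reals (Cmod w)).
    eapply is_series_ext; [|exact K]. intros n; simpl. unfold scal; simpl; unfold mult; simpl.
    rewrite pow_n_pow. ring. }
assert (Hd : forall w, cderiv ex w (ex w)).
{ intros w.
  destruct (cpower_series_deriv c ex (Cmod w + 1)) with (h := w) as (l & Hl & Hd).
  - intros h _; apply Hc.
  - lra.
  - replace (ex w) with l; [exact Hd|].
    apply (cseries_unique (fun m => c m * w ^ m)); [|apply Hc].
    eapply cseries_ext; [|exact Hl]. intros n; cbv beta. unfold c.
    rewrite fact_simpl, mult_INR, RtoC_mult. field. split.
    + apply INR_fact_neq_0_C.
    + intros E; apply RtoC_inj in E. exact (not_0_INR _ (Nat.neq_succ_0 n) E). }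
assert (E : ex L = Cexp L).
{ assert (K : ex L * Cexp (- (1) * L) = ex 0 * Cexp (- (1) * 0)).
  { apply (cderiv_zero_segment (fun w => ex w * Cexp (- (1) * w)) 0 L).
    intros t _. set (w := 0 + t * (L - 0)).
    replace (RtoC 0) with (ex w * Cexp (- (1) * w) + ex w * (- (1) * Cexp (- (1) * w))) by ring.
    apply (cderiv_mult ex (fun w => Cexp (- (1) * w))); [apply Hd|apply cderiv_Cexp_scal]. }
  assert (E0 : ex 0 = 1).
  { unfold ex. rewrite (csum_unique _ _ (cseries_pow_0 c)). unfold c; simpl. field. }
  rewrite E0, Cmult_0_r, Cexp_0 in K. replace (- (1) * L) with (- L) in K by ring.
  replace (ex L) with (ex L * Cexp (- L) * Cexp L).
  - rewrite K; ring.
  - rewrite <- Cmult_assoc, Cexp_opp_l; ring. }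
rewrite <- E. eapply cseries_ext; [|apply Hc]. intros n; unfold c, exp_term, Cdiv; ring.
Qed.

Lemma sin_coef_series (a t : C) :
  cseries (fun m => sin_coef a m * t ^ m)
    (Cexp (Ci * PI * (t - a)) - Cexp (- (Ci * PI * (t - a)))).
Proof.
assert (S1 := cseries_scal (Cexp (- a * (Ci * PI))) _ _ (Cexp_series (Ci * PI * t))).
assert (S2 := cseries_scal (- Cexp (a * (Ci * PI))) _ _ (Cexp_series (- (Ci * PI) * t))).
assert (S3 := cseries_plus _ _ _ _ S1 S2).
replace (Cexp (Ci * PI * (t - a)) - Cexp (- (Ci * PI * (t - a)))) with
  (Cexp (- a * (Ci * PI)) * Cexp (Ci * PI * t) + - Cexp (a * (Ci * PI)) * Cexp (- (Ci * PI) * t)).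
- eapply cseries_ext; [|exact S3]. intros n; cbv beta. unfold sin_coef, exp_term, Cdiv.
  rewrite (Cpow_mult_l (Ci * PI) t), (Cpow_mult_l (- (Ci * PI)) t). ring.
- rewrite <- Cexp_plus.
  replace (- Cexp (a * (Ci * PI)) * Cexp (- (Ci * PI) * t)) with
    (- (Cexp (a * (Ci * PI)) * Cexp (- (Ci * PI) * t))) by ring.
  rewrite <- Cexp_plus. unfold Cminus. f_equal; [|f_equal]; f_equal; ring.
Qed.

Lemma Cmod_Ci : Cmod Ci = 1%R.
Proof. unfold Cmod; simpl. rewrite Rmult_0_l, Rplus_0_l, !Rmult_1_r; apply sqrt_1. Qed.

Lemma sin_coef_le (a : C) : exists A, (0 < A)%R /\
  forall m, (Cmod (sin_coef a m) <= A * PI ^ m)%R.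
Proof.
assert (P := PI_RGT_0).
set (x := Cexp (- a * (Ci * PI))). set (y := Cexp (a * (Ci * PI))).
assert (Hx : (0 < Cmod x)%R) by (apply Cmod_gt_0, Cexp_neq_0).
assert (Hy : (0 < Cmod y)%R) by (apply Cmod_gt_0, Cexp_neq_0).
exists (Cmod x + Cmod y)%R; split; [lra|]. intros m.
assert (T : forall p, Cmod p = PI -> (Cmod (exp_term m p) <= PI ^ m)%R).
{ intros p Hp. unfold exp_term, Cdiv. rewrite Cmod_mult, Cmod_pow, Hp, <- RtoC_inv, Cmod_R
    by apply INR_fact_neq_0.
  rewrite <- (Rmult_1_r (PI ^ m)) at 2. apply Rmult_le_compat_l; [apply pow_le; lra|].
  assert (F1 : (1 <= INR (fact m))%R) by (apply (le_INR 1), Nat.le_succ_l, lt_O_fact).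
  rewrite Rabs_pos_eq by (apply Rlt_le, Rinv_0_lt_compat; lra).
  rewrite <- Rinv_1. apply Rinv_le_contravar; lra. }
assert (HP : Cmod (Ci * PI) = PI) by (rewrite Cmod_mult, Cmod_Ci, Cmod_R, Rabs_pos_eq; lra).
unfold sin_coef. fold x. fold y.
eapply Rle_trans; [apply Cmod_triangle|]. rewrite Cmod_opp, !Cmod_mult, Rmult_plus_distr_r.
apply Rplus_le_compat; (apply Rmult_le_compat_l; [lra|]); apply T; rewrite ?Cmod_opp; exact HP.
Qed.

Lemma reciprocal_coef_le (q s : nat -> C) (A B : R) : (0 < A)%R -> (0 < B)%R ->
  (forall m, (Cmod (s m) <= A * B ^ m)%R) -> s O <> 0 ->
  (forall n, psum (fun j => q j * s (S n - j)%nat) (S (S n)) = 0) ->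
  exists K M, (0 <= K)%R /\ (B <= M)%R /\ forall n, (Cmod (q n) <= K * M ^ n)%R.
Proof.
intros HA HB Hs Hs0 Hq.
set (s0 := Cmod (s O)). assert (Hs0' : (0 < s0)%R) by (apply Cmod_gt_0; exact Hs0).
set (K := Cmod (q O)). assert (HK : (0 <= K)%R) by apply Cmod_ge_0.
(* Solves [s0 * M = B * (s0 + A)], the relation that closes the induction on partial sums below. *)
set (M := (B * (1 + A / s0))%R).
assert (HAs : (0 < A / s0)%R) by (apply Rdiv_lt_0_compat; assumption).
assert (HBM : (B <= M)%R) by (unfold M; nra).
exists K, M. split; [exact HK|]. split; [exact HBM|].
assert (HM : (0 < M)%R) by lra.
assert (EM : (s0 * M = B * (s0 + A))%R) by (unfold M; field; lra).
intros n. induction n as [n IH] using (well_founded_induction lt_wf).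
destruct n as [|n]; [simpl; unfold K; lra|].
(* At [m = S n] this bound is [K * s0 * M ^ (S n)]; divided by [s0] it is the claim for
   [q (S n)]. *)
assert (Hp : forall m, (m <= S n)%nat ->
  (Cmod (psum (fun j => (q j * s (S n - j)%nat)%C) m) <= K * s0 * M ^ m * B ^ (S n - m))%R).
{ induction m as [|m IHm]; intros Hm.
  - simpl psum. rewrite Cmod_0. repeat apply Rmult_le_pos; try apply pow_le; lra.
  - rewrite psum_S. eapply Rle_trans; [apply Cmod_triangle|].
    specialize (IHm ltac:(lia)). assert (Hqm := IH m ltac:(lia)). assert (Hsm := Hs (S n - m)%nat).
    rewrite Cmod_mult.
    assert (H : (Cmod (q m) * Cmod (s (S n - m)%nat) <= (K * M ^ m) * (A * B ^ (S n - m)))%R)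
      by (apply Rmult_le_compat; try apply Cmod_ge_0; assumption).
    replace (S n - m)%nat with (S (S n - S m)) in * by lia.
    apply Rle_trans with (K * M ^ m * B ^ (S n - S m) * (B * (s0 + A)))%R.
    + rewrite <- tech_pow_Rmult in IHm, H. lra.
    + rewrite <- EM, <- tech_pow_Rmult. lra. }
specialize (Hp (S n) (Nat.le_refl _)). specialize (Hq n). rewrite psum_S, Nat.sub_diag in Hq.
assert (E : q (S n) * s O = - psum (fun j => q j * s (S n - j)%nat) (S n)).
{ match type of Hq with ?X + ?Y = _ => replace Y with (X + Y - X) by ring; rewrite Hq end. ring. }
apply (f_equal Cmod) in E. rewrite Cmod_opp, Cmod_mult in E. fold s0 in E.
rewrite <- E, Nat.sub_diag in Hp. simpl pow in Hp at 2.
apply Rmult_le_reg_r with s0; [exact Hs0'|]. lra.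
Qed.

Lemma INR_le_pow2 (n : nat) : (INR n <= 2 ^ n)%R.
Proof.
induction n as [|n IH]; [simpl; lra|]. rewrite S_INR. simpl pow.
assert (1 <= 2 ^ n)%R by (apply pow_R1_Rle; lra). lra.
Qed.

Lemma Cmod_psum_le_const (u : nat -> C) (n : nat) (M : R) :
  (forall k, (k < n)%nat -> (Cmod (u k) <= M)%R) -> (Cmod (psum u n) <= INR n * M)%R.
Proof.
induction n as [|n IH]; intros H; [simpl; rewrite Cmod_0; lra|].
rewrite S_INR. simpl psum. eapply Rle_trans; [apply Cmod_triangle|].
specialize (IH ltac:(intros; apply H; lia)). specialize (H n ltac:(lia)). lra.
Qed.

Lemma is_series_geom_scal (A x : R) (k : nat) : (0 <= x < 1)%R ->
  is_series (fun n => A * x ^ (k + n))%R (A * x ^ k * / (1 - x))%R.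
Proof.
intros Hx. assert (K := is_series_geom x ltac:(rewrite Rabs_pos_eq; lra)).
apply (is_series_scal (K := R_AbsRing) (V := R_NormedModule) (A * x ^ k)%R) in K.
eapply is_series_ext; [|exact K]. intros n. rewrite pow_add.
unfold scal; simpl; unfold mult; simpl. ring.
Qed.

(* The product of the [N]-th partial sum of [q] with [g] differs from [k] by a sum
   of terms [q_j t ^ j R_(N-j)], with [R_n] the remainders of the series of [s]. *)
Lemma reciprocal_series (q s : nat -> C) (k : C) (g : C -> C) (A B : R) :
  (0 < A)%R -> (0 < B)%R -> (forall m, (Cmod (s m) <= A * B ^ m)%R) ->
  (forall t, cseries (fun m => s m * t ^ m) (g t)) ->
  k <> 0 ->
  (forall n, psum (fun j => q j * s (n - j)%nat) (S n) = match n with O => k | S _ => 0 end) ->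
  exists r, (0 < r)%R /\ forall t, (Cmod t < r)%R -> g t <> 0 /\
    cseries (fun n => q n * t ^ n) (k / g t).
Proof.
intros HA HB Hs Hg Hk Hq.
assert (Hs0 : s O <> 0).
{ intros E. apply Hk. rewrite <- (Hq O). simpl. rewrite E; ring. }
destruct (reciprocal_coef_le q s A B HA HB Hs Hs0 (fun n => Hq (S n))) as (K & M & HK & HBM & HqM).
(* The error is at most [S N] terms of size [y ^ S N] up to a constant. With [y < 1 / 4] and
   [S N <= 2 ^ S N] it decays like [(1 / 2) ^ S N]. *)
exists (/ (4 * M))%R. split; [apply Rinv_0_lt_compat; lra|]. intros t Ht.
assert (Ht0 := Cmod_ge_0 t).
set (y := (M * Cmod t)%R).
assert (Hy0 : (0 <= y)%R) by (unfold y; nra).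
assert (Hy : (y < 1 / 4)%R).
{ unfold y. apply Rlt_le_trans with (M * / (4 * M))%R; [apply Rmult_lt_compat_l; lra|].
  apply Req_le; field; lra. }
assert (HBy : (B * Cmod t <= y)%R) by (unfold y; apply Rmult_le_compat_r; lra).
assert (HB0 : (0 <= B * Cmod t)%R) by (apply Rmult_le_pos; lra).
set (Rm := fun n : nat => g t - psum (fun m => s m * t ^ m) (S n)).
assert (HR : forall n, (Cmod (Rm n) <= 2 * A * y ^ S n)%R).
{ intros n. apply Rle_trans with (A * (B * Cmod t) ^ S n * / (1 - B * Cmod t))%R.
  - unfold Rm. apply (Cmod_cseries_le (fun m => s (S n + m)%nat * t ^ (S n + m)) _
      (fun m => A * (B * Cmod t) ^ (S n + m))%R).
    + intros m. rewrite Cmod_mult, Cmod_pow, Rpow_mult_distr, <- Rmult_assoc.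
      apply Rmult_le_compat_r; [apply pow_le; lra|apply Hs].
    + apply is_series_geom_scal; lra.
    + apply (cseries_tail (fun m => s m * t ^ m) (g t) (S n)), Hg.
  - assert (H1 : (/ (1 - B * Cmod t) <= 2)%R).
    { rewrite <- (Rinv_inv 2). apply Rinv_le_contravar; lra. }
    assert (H2 : ((B * Cmod t) ^ S n <= y ^ S n)%R) by (apply pow_incr; lra).
    assert (H3 : (0 <= (B * Cmod t) ^ S n)%R) by (apply pow_le; lra).
    assert (H4 : (0 < / (1 - B * Cmod t))%R) by (apply Rinv_0_lt_compat; lra).
    apply Rle_trans with (A * y ^ S n * 2)%R; [|lra].
    apply Rmult_le_compat; try lra.
    + apply Rmult_le_pos; lra.
    + apply Rmult_le_compat_l; lra. }
assert (Hid : forall N, psum (fun j => q j * t ^ j) (S N) * g t - k =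
   psum (fun j => q j * t ^ j * Rm (N - j)%nat) (S N)).
{ induction N as [|N IH].
  - unfold Rm. rewrite <- (Hq O). simpl. ring.
  - replace (psum (fun j => q j * t ^ j) (S (S N)) * g t - k)
      with ((psum (fun j => q j * t ^ j) (S N) * g t - k) + q (S N) * t ^ S N * g t)
      by (rewrite (psum_S _ (S N)); ring).
    rewrite IH.
    replace (psum (fun j => q j * t ^ j * Rm (S N - j)%nat) (S (S N)))
      with (psum (fun j => q j * t ^ j * Rm (S N - j)%nat) (S N) + q (S N) * t ^ S N * Rm O)
      by (rewrite (psum_S _ (S N)), Nat.sub_diag; reflexivity).
    rewrite (psum_ext (fun j => q j * t ^ j * Rm (S N - j)%nat)
      (fun j => q j * t ^ j * Rm (N - j)%nat + (- t ^ S N) * (q j * s (S N - j)%nat))).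
    + rewrite psum_plus, psum_scal.
      assert (E := Hq (S N)).
      replace (psum (fun j => q j * s (S N - j)%nat) (S (S N)))
        with (psum (fun j => q j * s (S N - j)%nat) (S N) + q (S N) * s O) in E
        by (rewrite (psum_S _ (S N)), Nat.sub_diag; reflexivity).
      replace (psum (fun j => q j * s (S N - j)%nat) (S N)) with (- (q (S N) * s O)).
      2:{ match type of E with ?X + ?Y = _ => replace X with (X + Y - Y) by ring; rewrite E end. ring. }
      replace (Rm O) with (g t - s O) by (unfold Rm; simpl; ring). ring.
    + intros j Hj. replace (S N - j)%nat with (S (N - j)) by lia.
      unfold Rm. change (psum (fun m => s m * t ^ m) (S (S (N - j)))) with
        (psum (fun m => s m * t ^ m) (S (N - j)) + s (S (N - j)) * t ^ S (N - j)).
      replace (t ^ S N) with (t ^ j * t ^ S (N - j)) by (rewrite <- Cpow_add_r; f_equal; lia).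
      ring. }
assert (Hlim : forall N, (Cmod (psum (fun j => (q j * t ^ j)%C) (S N) * g t - k) <= 2 * A * K * (1 / 2) ^ S N)%R).
{ intros N. rewrite Hid. eapply Rle_trans; [apply (Cmod_psum_le_const _ _ (2 * A * K * y ^ S N)%R)|].
  - intros j Hj. rewrite !Cmod_mult, Cmod_pow.
    replace (2 * A * K * y ^ S N)%R with ((K * y ^ j) * (2 * A * y ^ S (N - j)))%R.
    + apply Rmult_le_compat; [|apply Cmod_ge_0| |apply HR].
      * apply Rmult_le_pos; [apply Cmod_ge_0|apply pow_le; lra].
      * unfold y. rewrite Rpow_mult_distr, <- Rmult_assoc.
        apply Rmult_le_compat_r; [apply pow_le; lra|apply HqM].
    + replace (S N) with (j + S (N - j))%nat by lia. rewrite pow_add. ring.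
  - apply Rle_trans with (2 * A * K * (2 * y) ^ S N)%R.
    + rewrite Rpow_mult_distr. assert (I := INR_le_pow2 (S N)).
      assert (0 <= y ^ S N)%R by (apply pow_le; lra).
      assert (0 <= 2 * A * K * y ^ S N)%R
        by (apply Rmult_le_pos; [repeat apply Rmult_le_pos; lra|assumption]).
      replace (2 * A * K * (2 ^ S N * y ^ S N))%R with (2 ^ S N * (2 * A * K * y ^ S N))%R by ring.
      apply Rmult_le_compat_r; assumption.
    + apply Rmult_le_compat_l; [repeat apply Rmult_le_pos; lra|]. apply pow_incr; lra. }
assert (Hlim' : forall e, (0 < e)%R -> exists N, forall n, (N <= n)%nat ->
  (Cmod (psum (fun j => (q j * t ^ j)%C) n * g t - k) < e)%R).
{ intros e He. set (c := (2 * A * K + 1)%R).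
  assert (Hc : (0 < c)%R) by (unfold c; assert (0 <= 2 * A * K)%R by (repeat apply Rmult_le_pos; lra); lra).
  destruct (pow_lt_1_zero (1 / 2) ltac:(rewrite Rabs_pos_eq; lra) (e / c)) as [N HN];
    [apply Rdiv_lt_0_compat; assumption|].
  exists (S N). intros [|n] Hn; [lia|].
  specialize (HN (S n) ltac:(lia)). rewrite Rabs_pos_eq in HN by (apply pow_le; lra).
  eapply Rle_lt_trans; [apply Hlim|].
  assert (Hp : (0 <= (1 / 2) ^ S n)%R) by (apply pow_le; lra).
  apply Rle_lt_trans with (c * (1 / 2) ^ S n)%R; [unfold c; nra|].
  apply Rlt_le_trans with (c * (e / c))%R; [apply Rmult_lt_compat_l; assumption|].
  apply Req_le; field; lra. }
(* If [g t] were 0, the products with the partial sums would all be 0, yet they tend to [k]. *)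
assert (Hg0 : g t <> 0).
{ intros E. apply Hk. apply Cmod_eps_0. intros e He. destruct (Hlim' e He) as [N HN].
  specialize (HN N (Nat.le_refl _)). rewrite E in HN.
  replace (psum (fun j => q j * t ^ j) N * 0 - k) with (- k) in HN by ring.
  rewrite Cmod_opp in HN. lra. }
split; [exact Hg0|]. apply cseries_eps. intros e He.
assert (Hgm : (0 < Cmod (g t))%R) by (apply Cmod_gt_0; exact Hg0).
destruct (Hlim' (e * Cmod (g t))%R ltac:(apply Rmult_lt_0_compat; assumption)) as [N HN].
exists N. intros n Hn. specialize (HN n Hn).
replace (psum (fun j => q j * t ^ j) n * g t - k)
  with ((psum (fun j => q j * t ^ j) n - k / g t) * g t) in HN by (field; exact Hg0).
rewrite Cmod_mult in HN. apply Rmult_lt_reg_r with (Cmod (g t)); assumption.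
Qed.

Lemma Ci_neq_0 : Ci <> 0.
Proof. intros E; apply (f_equal snd) in E; simpl in E; lra. Qed.

Lemma Ci_Ci : Ci * Ci = - (1).
Proof. apply injective_projections; simpl; ring. Qed.

Lemma two_neq_0_C : RtoC 2 <> 0.
Proof. intros E; apply RtoC_inj in E; lra. Qed.

Lemma PI_neq_0_C : RtoC PI <> 0.
Proof. intros E; apply RtoC_inj in E; assert (P := PI_RGT_0); lra. Qed.

(** The cosecant is [Ci * Ci / g], with [g] the difference of the exponentials, so its expansion
    comes from [reciprocal_series]. Uniqueness of Taylor coefficients identifies the epsilon
    choice. *)
Lemma csc_taylor (a : C) (q : nat -> C) :
  (forall n, psum (fun j => q j * sin_coef a (n - j)) (S n) =
      match n with O => - (2 * PI * Ci) | S _ => 0 end) ->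
  forall n, taylor_coef (fun t : C => Ci / (2 * Csin (PI * (t - a)))) 0 n = q n / (2 * PI * Ci).
Proof.
intros Hq. set (f := fun t : C => Ci / (2 * Csin (PI * (t - a)))).
destruct (sin_coef_le a) as (A & HA & Hs).
assert (Hk : 2 * PI * Ci <> 0).
{ repeat apply Cmult_neq_0; [apply two_neq_0_C|apply PI_neq_0_C|apply Ci_neq_0]. }
destruct (reciprocal_series q (sin_coef a) (- (2 * PI * Ci))
  (fun t => Cexp (Ci * PI * (t - a)) - Cexp (- (Ci * PI * (t - a)))) A PI HA PI_RGT_0 Hs
  (sin_coef_series a)) as (r & Hr & H).
- intros E. apply Hk. replace (2 * PI * Ci) with (- - (2 * PI * Ci)) by ring. rewrite E; ring.
- exact Hq.
- assert (T : is_taylor f 0 (fun n => q n / (2 * PI * Ci))).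
  { apply is_taylor_cseries. exists r; split; [exact Hr|]. intros w Hw.
    replace (w - 0) with w in * by ring. destruct (H w Hw) as [Hg Hser]. cbv beta in *.
    apply (cseries_scal (/ (2 * PI * Ci))) in Hser.
    replace (f w) with (/ (2 * PI * Ci) * (- (2 * PI * Ci) / (Cexp (Ci * PI * (w - a)) - Cexp (- (Ci * PI * (w - a)))))).
    - eapply cseries_ext; [|exact Hser]. intros n; cbv beta; unfold Cdiv; ring.
    - unfold f, Csin. replace (Ci * (PI * (w - a))) with (Ci * PI * (w - a)) by ring.
      set (g := Cexp (Ci * PI * (w - a)) - Cexp (- (Ci * PI * (w - a)))) in *.
      replace (Ci / (2 * (g / (2 * Ci)))) with ((Ci * Ci) / g).
      + rewrite Ci_Ci. field. repeat split; first [exact Hg|apply Ci_neq_0|apply PI_neq_0_C].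
      + field. split; [apply Ci_neq_0|exact Hg]. }
  intros n. apply (is_taylor_unique f 0 _ (fun n => q n / (2 * PI * Ci))); [|exact T].
  unfold taylor_coef. apply epsilon_spec. eexists; exact T.
Qed.

(** Repeated integration by parts: [gamma_poly m t * exp (- t)] is the upper incomplete Gamma
    function of order [m + 1] at [t >= 0]. *)
Fixpoint gamma_poly (m : nat) (t : R) : R :=
  match m with O => 1 | S k => t ^ S k + INR (S k) * gamma_poly k t end%R.

Lemma gamma_poly_S (m : nat) (t : R) :
  gamma_poly (S m) t = (t ^ S m + INR (S m) * gamma_poly m t)%R.
Proof. reflexivity. Qed.

Lemma is_derive_gamma_poly (m : nat) (t : R) :
  is_derive (gamma_poly m) t (gamma_poly m t - t ^ m)%R.
Proof.
induction m as [|m IH].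
- simpl. replace (1 - 1)%R with 0%R by ring. apply (is_derive_const (V := R_NormedModule) 1%R).
- apply (is_derive_ext (fun t => t ^ S m + INR (S m) * gamma_poly m t)%R); [reflexivity|].
  replace (gamma_poly (S m) t - t ^ S m)%R
    with (INR (S m) * t ^ m + INR (S m) * (gamma_poly m t - t ^ m))%R by (rewrite gamma_poly_S; ring).
  apply (is_derive_plus (V := R_NormedModule) (fun t => t ^ S m)%R).
  + replace (INR (S m) * t ^ m)%R with (INR (S m) * 1 * t ^ pred (S m))%R by (simpl pred; ring).
    apply (is_derive_pow (fun t => t) (S m) t 1). apply (is_derive_id (K := R_AbsRing)).
  + apply (is_derive_scal (gamma_poly m)). exact IH.
Qed.

Lemma gamma_poly_0 (m : nat) : gamma_poly m 0 = INR (fact m).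
Proof.
induction m as [|m IH]; [reflexivity|]. rewrite gamma_poly_S, IH, fact_simpl, mult_INR, pow_i by lia. ring.
Qed.

Lemma is_lim_pow_exp (k : nat) : is_lim (fun t => t ^ k * exp (- t))%R p_infty 0%R.
Proof.
apply is_lim_spec. intros e. exists (INR (fact (S k)) / e)%R. intros t Ht.
assert (He := cond_pos e). assert (Hf := INR_fact_lt_0 (S k)).
assert (Ht0 : (0 < t)%R).
{ eapply Rlt_trans; [|exact Ht]. apply Rdiv_lt_0_compat; assumption. }
assert (Hp : (0 < t ^ k)%R) by (apply pow_lt; exact Ht0).
rewrite Rminus_0_r, Rabs_pos_eq by (apply Rmult_le_pos; [lra|apply Rlt_le, exp_pos]).
assert (Hex : (t ^ S k / INR (fact (S k)) <= exp t)%R).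
{ eapply Rle_trans; [|apply (exp_ge_taylor t (S k)); lra].
  rewrite tech5. assert (0 <= sum_f_R0 (fun j => t ^ j / INR (fact j)) k)%R; [|lra].
  apply cond_pos_sum. intros n. apply Rmult_le_pos; [apply pow_le; lra|].
  apply Rlt_le, Rinv_0_lt_compat, INR_fact_lt_0. }
rewrite exp_Ropp. assert (Hep := exp_pos t).
apply Rmult_lt_reg_r with (exp t); [exact Hep|].
rewrite Rmult_assoc, Rinv_l, Rmult_1_r by lra.
apply Rlt_le_trans with (e * (t ^ S k / INR (fact (S k))))%R.
- apply Rmult_lt_reg_r with (INR (fact (S k))); [exact Hf|].
  replace (e * (t ^ S k / INR (fact (S k))) * INR (fact (S k)))%R with (t ^ k * (e * t))%R
    by (simpl pow; field; lra).
  apply Rmult_lt_compat_l; [exact Hp|].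
  apply Rmult_lt_reg_r with (/ e)%R; [apply Rinv_0_lt_compat; exact He|].
  replace (e * t * / e)%R with t by (field; lra). exact Ht.
- apply Rmult_le_compat_l; lra.
Qed.

Lemma is_lim_gamma_poly_exp (m : nat) : is_lim (fun t => gamma_poly m t * exp (- t))%R p_infty 0%R.
Proof.
induction m as [|m IH].
- apply (is_lim_ext (fun t => t ^ 0 * exp (- t))%R); [intros; simpl; ring|apply is_lim_pow_exp].
- apply (is_lim_ext (fun t => t ^ S m * exp (- t) + INR (S m) * (gamma_poly m t * exp (- t)))%R).
  + intros t. rewrite gamma_poly_S. ring.
  + replace (Finite 0) with (Rbar_plus 0 (Rbar_mult (INR (S m)) 0))
      by (simpl; f_equal; ring).
    apply is_lim_plus'; [apply is_lim_pow_exp|].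
    replace (Finite (INR (S m) * 0)) with (Rbar_mult (INR (S m)) 0) by reflexivity.
    apply is_lim_scal_l, IH.
Qed.

Lemma Gamma_nat (m : nat) : Gamma (INR (S m)) = INR (fact m).
Proof.
unfold Gamma. apply is_RInt_gen_unique.
set (f := fun t => (- (gamma_poly m t * exp (- t)))%R).
assert (Df : forall t, is_derive f t (t ^ m * exp (- t))%R).
{ intros t. unfold f.
  replace (t ^ m * exp (- t))%R
    with (- ((gamma_poly m t - t ^ m) * exp (- t) + gamma_poly m t * (- exp (- t))))%R by ring.
  apply (is_derive_opp (V := R_NormedModule) (fun t => gamma_poly m t * exp (- t))%R).
  apply (is_derive_mult (gamma_poly m) (fun t => exp (- t))%R); [apply is_derive_gamma_poly| |intros; apply Rmult_comm].
  auto_derive; [exact I|ring]. }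
assert (DD : forall t, Derive f t = (t ^ m * exp (- t))%R) by (intros t; apply is_derive_unique, Df).
(* [Rpower] agrees with the integer power for positive [t] only, so the integrands are compared
   between positive bounds. *)
apply (is_RInt_gen_ext (Derive f)).
- exists (fun t => 0 < t)%R (fun t => 0 < t)%R.
  + exists (mkposreal 1 Rlt_0_1). intros y _ Hy. exact Hy.
  + exists 0%R. auto.
  + intros x y Hx Hy t Ht. simpl in Ht. rewrite DD. f_equal.
    assert (Ht0 : (0 < t)%R).
    { eapply Rlt_trans; [|apply Ht]. apply Rmin_pos; assumption. }
    replace (INR (S m) - 1)%R with (INR m) by (rewrite S_INR; ring).
    symmetry. apply Rpower_pow; exact Ht0.
- replace (INR (fact m)) with (0 - (- INR (fact m)))%R by ring.
  apply is_RInt_gen_Derive.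
  + apply filter_forall. intros ab t _. eexists; apply Df.
  + apply filter_forall. intros ab t _.
    apply (continuous_ext (fun t => t ^ m * exp (- t))%R); [intros; symmetry; apply DD|].
    apply (ex_derive_continuous (V := R_NormedModule)). auto_derive. exact I.
  + assert (E : (- INR (fact m))%R = f 0%R).
    { unfold f. rewrite gamma_poly_0, Ropp_0, exp_0. ring. }
    rewrite E. apply (filterlim_filter_le_1 (F := locally 0%R) (G := at_right 0%R)).
    * intros P [d Hd]. exists d. intros y Hy _. apply Hd, Hy.
    * apply (ex_derive_continuous (V := R_NormedModule)). eexists; apply Df.
  + assert (K := is_lim_opp _ _ _ (is_lim_gamma_poly_exp m)). simpl in K.
    rewrite Ropp_0 in K. exact K.
Qed.

(** * The two sides of the cut *)

Lemma Cexp_log_right_half_plane (u : C) : (0 < Re u)%R ->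
  Cexp (ln (Cmod u), atan (Im u / Re u)) = u.
Proof.
destruct u as [x y]. unfold Re, Im; simpl fst; simpl snd. intros Hx.
set (t := (y / x)%R).
assert (Hs : (0 < sqrt (1 + Rsqr t))%R).
{ apply sqrt_lt_R0. assert (H := Rle_0_sqr t). lra. }
assert (Hm : Cmod (x, y) = (x * sqrt (1 + Rsqr t))%R).
{ unfold Cmod; simpl fst; simpl snd.
  replace (x ^ 2 + y ^ 2)%R with (Rsqr x * (1 + Rsqr t))%R.
  - rewrite sqrt_mult, sqrt_Rsqr; [reflexivity|lra|apply Rle_0_sqr|]. assert (H := Rle_0_sqr t). lra.
  - unfold t, Rsqr. field. lra. }
unfold Cexp, Re, Im; simpl fst; simpl snd.
rewrite exp_ln by (rewrite Hm; apply Rmult_lt_0_compat; assumption).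
rewrite cos_atan, sin_atan, Hm. replace (t ^ 2)%R with (Rsqr t) by (unfold Rsqr; ring).
apply injective_projections; simpl; unfold t; field; unfold t in Hs; lra.
Qed.

(** The principal logarithm near 1. That it keeps the sign of the imaginary part is what decides on
    which side of the cut a nearby point lies. *)
Lemma log_near_1 (e : R) : (0 < e)%R -> exists d, (0 < d)%R /\
  forall u, (Cmod (u - 1) < d)%R -> exists l, Cexp l = u /\ (Cmod l < e)%R /\
    (Im u < 0 -> Im l < 0)%R /\ (0 < Im u -> 0 < Im l)%R.
Proof.
intros He.
assert (C1 : continuity_pt ln 1).
{ apply derivable_continuous_pt. exists 1%R. replace 1%R with (/ 1)%R at 2 by field.
  apply derivable_pt_lim_ln; lra. }
assert (C2 : continuity_pt atan 0).
{ apply derivable_continuous_pt. apply derivable_pt_atan. }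
destruct (C1 (e / 2)%R ltac:(lra)) as (d1 & Hd1 & K1).
destruct (C2 (e / 2)%R ltac:(lra)) as (d2 & Hd2 & K2).
unfold dist in K1, K2; simpl in K1, K2; unfold R_dist in K1, K2. rewrite ln_1 in K1. rewrite atan_0 in K2.
exists (Rmin (1 / 2) (Rmin d1 (d2 / 2))). split; [repeat apply Rmin_pos; lra|].
intros u Hu.
assert (M1 := Rmin_l (1 / 2) (Rmin d1 (d2 / 2))). assert (M2 := Rmin_r (1 / 2) (Rmin d1 (d2 / 2))).
assert (M3 := Rmin_l d1 (d2 / 2)). assert (M4 := Rmin_r d1 (d2 / 2)).
assert (A1 := Re_le_Cmod (u - 1)). assert (A2 := Im_le_Cmod (u - 1)).
replace (Re (u - 1)) with (Re u - 1)%R in A1 by (unfold Re; simpl; ring).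
replace (Im (u - 1)) with (Im u) in A2 by (unfold Im; simpl; ring).
assert (Hre : (1 / 2 < Re u)%R).
{ assert (B := Rle_abs (- (Re u - 1))). rewrite Rabs_Ropp in B. lra. }
assert (Hri : (0 < / Re u)%R) by (apply Rinv_0_lt_compat; lra).
exists (ln (Cmod u), atan (Im u / Re u)). split; [apply Cexp_log_right_half_plane; lra|].
split; [|split].
- eapply Rle_lt_trans; [apply Cmod_le_Re_Im|].
  change (Rabs (ln (Cmod u)) + Rabs (atan (Im u / Re u)) < e)%R.
  assert (H1 : (Rabs (ln (Cmod u)) < e / 2)%R).
  { destruct (Req_dec (Cmod u) 1) as [->|Hn]; [rewrite ln_1, Rabs_R0; lra|].
    replace (ln (Cmod u)) with (ln (Cmod u) - 0)%R by ring. apply K1.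
    split; [split; [exact I|auto]|].
    assert (T1 := Cmod_triangle (u - 1) 1). assert (T2 := Cmod_triangle (- (u - 1)) u).
    replace (u - 1 + 1) with u in T1 by ring. replace (- (u - 1) + u) with (RtoC 1) in T2 by ring.
    rewrite Cmod_opp in T2. rewrite Cmod_1 in T1, T2. apply Rabs_def1; lra. }
  assert (H2 : (Rabs (atan (Im u / Re u)) < e / 2)%R).
  { destruct (Req_dec (Im u / Re u) 0) as [->|Hn]; [rewrite atan_0, Rabs_R0; lra|].
    replace (atan (Im u / Re u)) with (atan (Im u / Re u) - 0)%R by ring. apply K2.
    split; [split; [exact I|auto]|]. rewrite Rminus_0_r. unfold Rdiv. rewrite Rabs_mult, (Rabs_pos_eq (/ _)) by lra.
    apply Rmult_lt_reg_r with (Re u); [lra|]. rewrite Rmult_assoc, Rinv_l by lra. nra. }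
  lra.
- intros Hi. change (atan (Im u / Re u) < 0)%R. rewrite <- atan_0. apply atan_increasing.
  unfold Rdiv. nra.
- intros Hi. change (0 < atan (Im u / Re u))%R. rewrite <- atan_0. apply atan_increasing.
  unfold Rdiv. nra.
Qed.

Lemma Lerch_branch (S : Z) (a : C) : is_lerch_branch S a (fun z => Lerch z S a).
Proof. unfold Lerch. apply epsilon_spec. apply lerch_branch_exists. Qed.

Lemma Cexp_Cln (z : C) (theta : R) : is_arg z theta -> Cexp (Cln z theta) = z.
Proof.
intros [Hz E]. assert (Hm : (0 < Cmod z)%R) by (apply Cmod_gt_0; exact Hz).
unfold Cln. rewrite Cexp_plus. rewrite E at 2. f_equal.
unfold Cexp, Re, Im; simpl. rewrite exp_ln, cos_0, sin_0 by exact Hm.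
apply injective_projections; simpl; ring.
Qed.

Lemma Re_Cln (z : C) (theta : R) : Re (Cln z theta) = ln (Cmod z).
Proof. unfold Cln, Re; simpl; ring. Qed.

Lemma Im_Cln (z : C) (theta : R) : Im (Cln z theta) = theta.
Proof. unfold Cln, Im; simpl; ring. Qed.

Lemma is_arg_PI (z : C) (theta : R) : is_arg z theta -> Rabs theta = PI ->
  z = RtoC (- Cmod z).
Proof.
intros [Hz E] Hth. rewrite E at 1. rewrite Cexp_Ci.
assert (H : (cos theta = - 1 /\ sin theta = 0)%R).
{ unfold Rabs in Hth. destruct Rcase_abs.
  - replace theta with (- PI)%R by lra. rewrite cos_neg, sin_neg, cos_PI, sin_PI. split; ring.
  - rewrite Hth, cos_PI, sin_PI. split; ring. }
destruct H as [-> ->]. apply injective_projections; simpl; ring.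
Qed.

(** With [Rabs theta = PI] the point [z] is real and below - 1, so [1 + z] is negative and has no
    argument strictly between [- PI] and [PI]. *)
Lemma arg_lt_PI (z : C) (phi theta : R) : (1 < Cmod z)%R ->
  is_arg (1 + z) phi -> is_arg z theta -> (Rabs theta <= PI)%R ->
  (Rabs phi < PI)%R -> (Rabs theta < PI)%R.
Proof.
intros Hz Hphi Hth [Hle|Heq] Hlt; [exact Hle|exfalso].
assert (E := is_arg_PI z theta Hth Heq).
destruct (is_arg_Re_Im _ _ Hphi) as (Hm & HR & HI).
set (m := Cmod (1 + z)) in *.
assert (ER : Re (1 + z) = (1 - Cmod z)%R) by (rewrite E at 1; unfold Re; simpl; ring).
assert (EI : Im (1 + z) = 0%R) by (rewrite E; unfold Im; simpl; ring).
assert (Hs : sin phi = 0%R) by (apply Rmult_eq_reg_l with m; lra).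
rewrite (sin_0_lt_PI _ Hs Hlt), cos_0 in HR. lra.
Qed.

(** The right-hand side of the theorem in [L = ln z], with [P] the polynomial for [S >= 1] and 0 for
    [S <= 0]. *)
Definition exterior_value (S : Z) (a : C) (P : C -> C) (L : C) : C :=
  Cexp (- a * L) * P L - lerch_ext S a (- Cexp (- L)).

(** No bound on [Im L] appears: the right-hand side continues across the lines over the cut, hence
    the limits there. *)
Lemma cderiv_exterior_value (S : Z) (a : C) (P : C -> C) (L : C) :
  ((1 <= S)%Z -> forall k : Z, a <> IZR k) -> (exists l, cderiv P L l) -> (0 < Re L)%R ->
  exists l, cderiv (exterior_value S a P) L l.
Proof.
intros Ha [p Hp] HL.
assert (Hy := Cmod_opp_Cexp_opp_lt L HL).
destruct (cpower_series_deriv _ _ 1 (ext_converges_all S a Ha) _ Hy) as (m & _ & Hm).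
eexists. unfold exterior_value.
apply (cderiv_plus (fun L => Cexp (- a * L) * P L) (fun L => - lerch_ext S a (- Cexp (- L)))).
- apply cderiv_mult; [apply cderiv_Cexp_scal|exact Hp].
- apply cderiv_opp. apply (cderiv_comp (lerch_ext S a) (fun L => - Cexp (- L))); [exact Hm|].
  apply cderiv_opp_Cexp_opp.
Qed.

(* On the cut [z < -1] the logarithms of the points [- w] of the prescribed side
   lie in the open strip and tend to [L]. *)
Lemma is_Lerch_exterior (S : Z) (a z : C) (phi theta : R) (P : C -> C) :
  ((1 <= S)%Z -> forall k : Z, a <> IZR k) ->
  (1 < Cmod z)%R -> is_arg (1 + z) phi -> (Rabs phi <= PI)%R ->
  is_arg z theta -> (Rabs theta <= PI)%R -> (Rabs phi = PI -> theta = phi) ->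
  (forall L, exists l, cderiv P L l) ->
  (forall L, half_strip L -> Lerch (- Cexp L) S a = exterior_value S a P L) ->
  is_Lerch (- z) phi S a (exterior_value S a P (Cln z theta)).
Proof.
intros Ha Hz Hphi Hphi' Hth Hth' Hcut HP HF. set (L0 := Cln z theta).
assert (EL : Cexp L0 = z) by (apply Cexp_Cln, Hth).
assert (HL0 : (0 < Re L0)%R).
{ unfold L0. rewrite Re_Cln, <- ln_1. apply ln_increasing; lra. }
assert (IL0 : Im L0 = theta) by apply Im_Cln.
unfold is_Lerch. destruct Rlt_dec as [Hlt|Hge].
{ rewrite <- EL. apply HF. split; [exact HL0|]. rewrite IL0.
  exact (arg_lt_PI z phi theta Hz Hphi Hth Hth' Hlt). }
assert (Hpi : Rabs phi = PI) by lra. specialize (Hcut Hpi). subst theta.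
assert (Ez := is_arg_PI z phi Hth Hpi).
assert (Hz0 : z <> 0) by apply Hth.
assert (HPI := PI_RGT_0).
destruct (cderiv_exterior_value S a P L0 Ha (HP L0) HL0) as [l Hl].
intros Q HQ. apply (proj1 (locally_Cmod _ _)) in HQ. destruct HQ as (e & He & HQ).
destruct (cderiv_cont _ _ _ Hl e He) as (d & Hd & Kd).
(* [d] serves continuity at [L0], 1 keeps the imaginary part in the strip, and [Re L0] keeps the
   real part positive. *)
set (d' := Rmin d (Rmin 1 (Re L0))).
assert (Hd' : (0 < d')%R) by (repeat apply Rmin_pos; lra).
assert (D1 : (d' <= d)%R) by apply Rmin_l.
assert (D2 : (d' <= 1)%R) by (eapply Rle_trans; [apply Rmin_r|apply Rmin_l]).
assert (D3 : (d' <= Re L0)%R) by (eapply Rle_trans; [apply Rmin_r|apply Rmin_r]).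
destruct (log_near_1 d' Hd') as (r & Hr & Hlog).
apply (proj2 (locally_Cmod (- z) (fun w => (0 < phi * Im (1 - w))%R -> Q (Lerch w S a)))).
exists (r * Cmod z)%R. split; [apply Rmult_lt_0_compat; lra|].
intros w Hw Hside.
(* Then [- w = z * u] has the logarithm [L0 + v] with [v] a small logarithm of [u]; since [z] is
   negative, [Im u] has the sign of [Im w]. *)
set (u := - w / z).
assert (Hu1 : (Cmod (u - 1) < r)%R).
{ replace (u - 1) with (- ((w - - z) / z)) by (unfold u; field; exact Hz0).
  unfold Cdiv. rewrite Cmod_opp, Cmod_mult, Cmod_inv by exact Hz0.
  apply Rmult_lt_reg_r with (Cmod z); [lra|]. rewrite Rmult_assoc, Rinv_l by lra. lra. }
destruct (Hlog u Hu1) as (v & Ev & Hv & Hneg & Hpos).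
assert (Hx : (0 < / Cmod z)%R) by (apply Rinv_0_lt_compat; lra).
assert (Iu : Im u = (Im w * / Cmod z)%R).
{ unfold u. replace (- w / z) with (w * RtoC (/ Cmod z)).
  - unfold Im; simpl; ring.
  - rewrite Ez at 2. rewrite RtoC_opp, RtoC_inv by lra. field.
    intros E; apply RtoC_inj in E; lra. }
replace (Im (1 - w)) with (- Im w)%R in Hside by (unfold Im; simpl; ring).
assert (Rv := Re_le_Cmod v). assert (Iv := Im_le_Cmod v).
assert (Bv1 := Rle_abs (- Re v)). rewrite Rabs_Ropp in Bv1.
assert (Bv2 := Rle_abs (Im v)). assert (Bv3 := Rle_abs (- Im v)). rewrite Rabs_Ropp in Bv3.
assert (Hstrip : half_strip (L0 + v)).
{ split.
  - replace (Re (L0 + v)) with (Re L0 + Re v)%R by reflexivity. lra.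
  - replace (Im (L0 + v)) with (Im L0 + Im v)%R by reflexivity. rewrite IL0.
    (* As [PI > 3], a move of less than 1 from one edge towards the interior cannot cross the other
       edge. *)
    assert (P3 := PI2_3_2). unfold PI2 in P3.
    unfold Rabs in Hpi. destruct Rcase_abs in Hpi.
    + assert (0 < Im w)%R by nra.
      assert (0 < Im v)%R by (apply Hpos; rewrite Iu; apply Rmult_lt_0_compat; assumption).
      apply Rabs_def1; lra.
    + assert (Im w < 0)%R by nra.
      assert (Im v < 0)%R by (apply Hneg; rewrite Iu; nra).
      apply Rabs_def1; lra. }
assert (Ew : w = - Cexp (L0 + v)).
{ rewrite Cexp_plus, EL, Ev. unfold u. field. exact Hz0. }
apply HQ. rewrite Ew, (HF _ Hstrip). apply Kd.
replace (L0 + v - L0) with v by ring. lra.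
Qed.

Lemma exterior_series (S : Z) (a z : C) : ((1 <= S)%Z -> forall k : Z, a <> IZR k) ->
  (1 < Cmod z)%R ->
  cseries (fun m : nat => Cpowz (- z) (- Z.of_nat (m + 1)) / Cpowz (a - IZR (Z.of_nat (m + 1))) S)
    (lerch_ext S a (/ - z)).
Proof.
intros Ha Hz.
assert (Hn : - z <> 0) by (apply Cmod_gt_0; rewrite Cmod_opp; lra).
assert (Hy : (Cmod (/ - z) < 1)%R).
{ rewrite Cmod_inv, Cmod_opp by exact Hn. rewrite <- Rinv_1. apply Rinv_lt_contravar; lra. }
assert (K := cseries_decr _ _ (ext_converges_all S a Ha _ Hy)).
cbv beta in K.
replace (lerch_ext S a (/ - z) - ext_coef S a 0 * (/ - z) ^ 0) with (lerch_ext S a (/ - z)) in K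
  by (simpl; ring).
eapply cseries_ext; [|exact K]. intros n; cbv beta. rewrite Nat.add_1_r.
rewrite Cpowz_opp_of_nat, <- INR_IZR_INZ, Cpow_inv by exact Hn. unfold ext_coef, Cdiv. ring.
Qed.

(** With [k = S - 1 - n], the Gamma factor is [k!] and the power of the logarithm in the denominator
    is [L ^ (- k)], so each term is [b n * exp_term k L]. Here [L] is nonzero since
    [Re L = ln (Cmod z) > 0]. *)
Lemma polynomial_part (S : Z) (a z : C) (theta : R) (q b : nat -> C) :
  (1 <= S)%Z -> (1 < Cmod z)%R -> (forall n, b n = q n / (2 * PI * Ci)) ->
  2 * PI * Ci / Cpower z theta a *
     @sum_n C_AbelianMonoid
       (fun n : nat => b n / (Gamma (IZR (S - Z.of_nat n)) *
                  Cpowz (Cln z theta) (Z.of_nat n - S + 1)))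
       (Z.to_nat (S - 1)) =
  Cexp (- a * Cln z theta) * exp_poly q (Z.to_nat S) (Cln z theta).
Proof.
intros HS Hz Hb. rewrite sum_n_psum.
replace (Datatypes.S (Z.to_nat (S - 1))) with (Z.to_nat S) by lia.
set (L := Cln z theta).
assert (HL : L <> 0).
{ apply Re_neq_0. unfold L. rewrite Re_Cln, <- ln_1. apply ln_increasing; lra. }
assert (Hk : 2 * PI * Ci <> 0).
{ repeat apply Cmult_neq_0; [apply two_neq_0_C|apply PI_neq_0_C|apply Ci_neq_0]. }
unfold Cpower. fold L. replace (- a * L) with (- (a * L)) by ring. rewrite Cexp_opp.
unfold exp_poly.
rewrite (psum_ext _ (fun n => / (2 * PI * Ci) * (q n * exp_term (Z.to_nat S - 1 - n) L))).
- rewrite psum_scal. field. repeat split;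
    first [apply Cexp_neq_0|apply Ci_neq_0|apply PI_neq_0_C].
- intros n Hn. set (k := (Z.to_nat S - 1 - n)%nat).
  replace (S - Z.of_nat n)%Z with (Z.of_nat (Datatypes.S k)) by (unfold k; lia).
  replace (Z.of_nat n - S + 1)%Z with (- Z.of_nat k)%Z by (unfold k; lia).
  rewrite <- INR_IZR_INZ, Gamma_nat, Cpowz_opp_of_nat, Hb. unfold exp_term.
  assert (Hf := INR_fact_neq_0_C k). assert (HLk : L ^ k <> 0) by (apply Cpow_nz; exact HL).
  field. repeat split; first [exact Hf|exact HLk|apply Ci_neq_0|apply PI_neq_0_C].
Qed.

Theorem mainTheorem2 :
  forall (S : Z) (a z : C) (phi theta : R),
    ((1 <= S)%Z -> forall k : Z, a <> IZR k) ->
    (1 < Cmod z)%R ->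
    is_arg (1 + z) phi -> (Rabs phi <= PI)%R ->
    is_arg z theta -> (Rabs theta <= PI)%R ->
    (* on the cut, z and 1 + z lie on the same side *)
    (Rabs phi = PI -> theta = phi) ->
    let b := taylor_coef (fun t : C => Ci / (2 * Csin (PI * (t - a)))) 0 in
    exists sigma : C,
      @is_series C_AbsRing C_NormedModule
        (fun m : nat => let n := Z.of_nat (m + 1) in
           Cpowz (- z) (- n) / Cpowz (a - IZR n) S) sigma /\
      is_Lerch (- z) phi S a
        ((if (S <=? 0)%Z then 0
          else 2 * PI * Ci / Cpower z theta a *
               @sum_n C_AbelianMonoid
                 (fun n : nat =>
                    b n / (Gamma (IZR (S - Z.of_nat n)) *
                           Cpowz (Cln z theta) (Z.of_nat n - S + 1)))
                 (Z.to_nat (S - 1)))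
         - sigma).
Proof.
intros S a z phi theta Ha Hz Hphi Hphi' Hth Hth' Hcut b.
exists (lerch_ext S a (/ - z)). split; [exact (exterior_series S a z Ha Hz)|].
assert (EL := Cexp_Cln z theta Hth).
assert (Hz0 : z <> 0) by apply Hth.
assert (Ey : - Cexp (- Cln z theta) = / - z).
{ rewrite Cexp_opp, EL. field. exact Hz0. }
(* Division by [z ^ a] isolates the transcendent. *)
assert (Hdiv : forall (P : C -> C) (L : C), exterior_sum S a (fun w => Lerch w S a) L = P L ->
   Lerch (- Cexp L) S a = exterior_value S a P L).
{ intros P L HP. unfold exterior_value. rewrite <- HP. unfold exterior_sum.
  replace (- a * L) with (- (a * L)) by ring. rewrite Cmult_assoc, Cexp_opp_l. ring. }
destruct (Z.leb_spec S 0) as [HS|HS].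
- replace (0 - lerch_ext S a (/ - z)) with (exterior_value S a (fun _ => 0) (Cln z theta))
    by (unfold exterior_value; rewrite Ey; ring).
  apply is_Lerch_exterior; auto.
  + intros L; exists 0; apply cderiv_const.
  + intros L HL. apply Hdiv. replace S with (- Z.of_nat (Z.to_nat (- S)))%Z in * by lia.
    apply exterior_sum_neg; [apply Lerch_branch|exact HL].
- destruct (exterior_polynomial a (Ha ltac:(lia))) as (q & Hq & Hconv).
  rewrite (polynomial_part S a z theta q b ltac:(lia) Hz (csc_taylor a q Hconv)).
  rewrite <- Ey. apply (is_Lerch_exterior S a z phi theta (exp_poly q (Z.to_nat S))); auto.
  + intros L. replace (Z.to_nat S) with (Datatypes.S (Z.to_nat (S - 1))) by lia.
    eexists; apply cderiv_exp_poly.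
  + intros L HL. apply Hdiv.
    assert (K := Hq (Z.to_nat S) (fun w => Lerch w S a)).
    replace (Z.of_nat (Z.to_nat S)) with S in K by lia.
    apply K; [apply Lerch_branch|exact HL].
Qed.
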